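(* Let $f\in\mathcal{M}_S$. Then $f$ has infinitely many weakly repelling fixed points. Moreover, if the bov of $f$ is the only limit point of the set of critical values of $f$, then $f$ has infinitely many repelling fixed points.
   Context: A general transcendental meromorphic function is a meromorphic function $f:\mathbb{C}\to\widehat{\mathbb{C}}$ whose only essential singularity is at $\infty$ and which has either at least two poles or exactly one pole that is not an omitted value. An omitted value is $b\in\mathbb{C}$ with $f(z)\neq b$ for all $z$. A Baker omitted value (bov) is an omitted value $b$ for which there is a disk $D$ centred at $b$ such that each component of the boundary of $f^{-1}(D)$ is bounded; it is stable if all iterates $f^n$ are defined (analytic) in a neighbourhood of $b$. $\mathcal{M}_S$ denotes the class of general transcendental meromorphic functions having a stable bov. A fixed point $z_0$ is weakly repelling if $|f'(z_0)|>1$ or $f'(z_0)=1$, and repelling if $|f'(z_0)|>1$. *)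

(* Defs.v *)
(* The complex plane is R[i] (= complex R) for an
   arbitrary R : realType; R[i] is a numClosedFieldType, hence a normed
   module over itself, so [derivable g z 1] / [derive1] are the complex
   derivative. The Riemann sphere is [option C] with [None] = infinity. *)
From HB Require Import structures.
From mathcomp Require Import all_boot all_order all_algebra.
From mathcomp Require Import complex.
From mathcomp Require Import all_classical all_reals all_analysis.
Set Implicit Arguments. Unset Strict Implicit. Unset Printing Implicit Defensive.
Import Order.TTheory GRing.Theory Num.Theory.
Import numFieldNormedType.Exports.
Local Open Scope classical_set_scope.
Local Open Scope ring_scope.

Section Defs.
Variable R : realType.
Local Notation C := (R[i]^o).

Definition disk (z r : C) : set C := [set w | `|w - z| < r].

Definition holo_on (U : set C) (g : C -> C) : Prop :=
  forall z, U z -> derivable g z 1.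

Definition meromorphic (f : C -> option C) : Prop :=
  forall z0 : C,
    (exists (r : C) (g : C -> C), 0 < r /\ holo_on (disk z0 r) g /\
        forall z, disk z0 r z -> f z = Some (g z))
    \/
    (f z0 = None /\
     exists (r : C) (h : C -> C), 0 < r /\ holo_on (disk z0 r) h /\ h z0 = 0 /\
        forall z, disk z0 r z -> z != z0 -> h z != 0 /\ f z = Some (h z)^-1).

Definition rational_fun (f : C -> option C) : Prop :=
  exists p q : {poly C}, q != 0 /\
    forall z, q.[z] != 0 -> f z = Some (p.[z] / q.[z]).

(* transcendental: infinity is an essential singularity, i.e. f is not rational *)
Definition transcendental (f : C -> option C) : Prop := ~ rational_fun f.

Definition is_pole (f : C -> option C) (p : C) : Prop := f p = None.

Definition omitted_value (f : C -> option C) (b : C) : Prop :=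
  forall z, f z <> Some b.

Definition general_transcendental_meromorphic (f : C -> option C) : Prop :=
  meromorphic f /\ transcendental f /\
  ((exists p1 p2, p1 != p2 /\ is_pole f p1 /\ is_pole f p2)
   \/ (exists p, is_pole f p /\ (forall q, is_pole f q -> q = p)
                 /\ ~ omitted_value f p)).

Definition preim (f : C -> option C) (D : set C) : set C :=
  [set z | exists w, f z = Some w /\ D w].

Definition boundary (A : set C) : set C := closure A `\` interior A.

Definition baker_omitted_value (f : C -> option C) (b : C) : Prop :=
  omitted_value f b /\
  exists r : C, 0 < r /\
    forall x, boundary (preim f (disk b r)) x ->
      bounded_set (connected_component (boundary (preim f (disk b r))) x).

Fixpoint fiter (f : C -> option C) (n : nat) (z : C) : option C :=
  match n with
  | O => Some z
  | S m => match fiter f m z with Some w => f w | None => None end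
  end.

Definition stable_at (f : C -> option C) (b : C) : Prop :=
  forall n : nat, exists (r : C) (g : C -> C), 0 < r /\ holo_on (disk b r) g /\
    forall z, disk b r z -> fiter f n z = Some (g z).

Definition in_MS (f : C -> option C) : Prop :=
  general_transcendental_meromorphic f /\
  exists b, baker_omitted_value f b /\ stable_at f b.

Definition deriv_at (f : C -> option C) (z0 d : C) : Prop :=
  exists (r : C) (g : C -> C), 0 < r /\ holo_on (disk z0 r) g /\
    (forall z, disk z0 r z -> f z = Some (g z)) /\ derive1 g z0 = d.

Definition weakly_repelling_fp (f : C -> option C) (z0 : C) : Prop :=
  f z0 = Some z0 /\ exists d, deriv_at f z0 d /\ (1 < `|d| \/ d = 1).

Definition repelling_fp (f : C -> option C) (z0 : C) : Prop :=
  f z0 = Some z0 /\ exists d, deriv_at f z0 d /\ 1 < `|d|.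

(* finite critical values: f(c) for c ∈ C with f(c) finite and f'(c) = 0.
   (The possible critical value ∞ coming from multiple poles is irrelevant to
   the set of limit points.) *)
Definition crit_value (f : C -> option C) (w : C) : Prop :=
  exists c, f c = Some w /\ deriv_at f c 0.

Definition limit_point (S : set C) (w : C) : Prop :=
  forall e : C, 0 < e -> exists v, S v /\ v != w /\ disk w e v.

(* b is the only limit point in the Riemann sphere of the set of critical
   values: b is a limit point, no other finite point is, and ∞ is not one
   (i.e. the critical values are bounded). *)
Definition only_limit_point_of_crit_values (f : C -> option C) (b : C) : Prop :=
  limit_point (crit_value f) b /\
  (forall w, limit_point (crit_value f) w -> w = b) /\
  bounded_set (crit_value f).

End Defs.

(* Main.v *)
(** Since [b] is omitted, [F = 1 / (f - b)] is entire and [f = b + 1 / F]; the fixed points of [f] are the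
    solutions of [T = 1] with [T z = (z - b) * F z], with multiplier [lambda = - (z - b) ^+ 2 * F' z].
    As the boundary components of [{|F| > rho}], [rho = 1 / r], are bounded, so are the pieces into which
    [{|F| <= rho}] splits: compact relatively clopen subsets [L] occur arbitrarily far out, and each contains
    a zero of [F] by the minimum principle.

    Let [B] be the normalised integral over a contour just outside [L], where [|F| > rho] and [|T| > 1], and
    let [d] be the number of zeros of [F] inside, which by Rouche is that of [T - 1].  The residue theorem
    gives [B (F' / F * (T + 1) / (T - 1)) = d - 2 sum 1 / (1 - lambda)], the sum being over the fixed points
    inside; if none is weakly repelling, each term has real part at least [1 / 2], so the real part of the
    whole is at most 0.  But [F' / F] is the limit of [F' F^(m-1) / (F^m - rho^m)], whose residues are
    positive and located where [|F| = rho], and there [(T + 1) / (T - 1)] has positive real part bounded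
    below: a contradiction.

    When the critical values of [f] are bounded, [F' <> 0] wherever [0 < |F| < e].  On the pieces of
    [{|F| <= rho}], [rho < e], Ahlfors' comparison of the metric
    [|dz| / (|z - b| ln (|z - b| / M))] with the pull-back by [F] of the metric
    [|dw| / (|w| ln (rho / |w|))] then gives [|f'| > 1] at every fixed point with [M * rho > 1]. *)
Require Import Defs.
From HB Require Import structures.
From mathcomp Require Import all_boot all_order all_algebra.
From mathcomp Require Import complex.
From mathcomp Require Import all_classical all_reals all_analysis.
From mathcomp Require Import ring lra.
Set Implicit Arguments. Unset Strict Implicit. Unset Printing Implicit Defensive.
Import Order.TTheory GRing.Theory Num.Theory.
Import numFieldNormedType.Exports.
Local Open Scope classical_set_scope.
Local Open Scope ring_scope.
Local Notation Re := complex.Re.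
Local Notation Im := complex.Im.

(** * The modulus and complex differentiability *)
Section Modulus.
Variable R : realType.
Local Notation C := R[i].

(** On a smooth level curve [|F| = rho] the form [d arg F] is positive, and pairing it with
    [(T + 1) / (T - 1)] would give the contradiction directly. The curve may be singular, so its
    measure is replaced by finitely many points, the roots of [F ^ m = rho ^ m], equally spaced in
    [arg F]; only grid contours are integrated over. No limit in [m] is taken: the errors are
    bounded independently of [m], while the main term grows like [m].

    The hypothesis bounds components of the boundary, not pieces of [{|F| <= rho}]. The passage
    rests on two facts: quasi-components of compact sets are connected, and crossing a clopen part
    of the boundary is a two-valued cocycle, which on a rectangle is a coboundary.

    The two metrics of the last part are hyperbolic, on the punctured neighbourhood [|z - b| > M] of
    infinity and on the punctured disk [0 < |w| < rho]. Laplacians are replaced by products of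
    values at [p + h], [p - h], [p + i h], [p - i h]. *)

Definition md (z : C) : R := Normc.normc z.

Lemma le_of_eq (x y : R) : x = y -> x <= y. Proof. by move=> ->. Qed.

Lemma mdE (z : C) : `|z| = (md z)%:C%C.
Proof. by rewrite normc_def /md; case: z. Qed.
Lemma md0 : md 0 = 0. Proof. exact: Normc.normc0. Qed.
Lemma md1 : md 1 = 1. Proof. exact: Normc.normc1. Qed.
Lemma mdM z w : md (z * w) = md z * md w. Proof. exact: Normc.normcM. Qed.
Lemma mdV z : md z^-1 = (md z)^-1. Proof. exact: Normc.normcV. Qed.
Lemma mdf z w : md (z / w) = md z / md w. Proof. by rewrite mdM mdV. Qed.
Lemma mdN z : md (- z) = md z. Proof. exact: normcN. Qed.
Lemma mdD z w : md (z + w) <= md z + md w. Proof. exact: le_normcD. Qed.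
Lemma mdB z w : md (z - w) <= md z + md w. Proof. by rewrite -(mdN w) mdD. Qed.
Lemma mdC z w : md (z - w) = md (w - z). Proof. by rewrite -mdN opprB. Qed.
Lemma mdX z n : md (z ^+ n) = md z ^+ n.
Proof. by elim: n => [|n ih]; rewrite ?expr0 ?md1 // !exprS mdM ih. Qed.
Lemma md_ge0 z : 0 <= md z. Proof. by case: z => a b; rewrite sqrtr_ge0. Qed.
Lemma md_eq0 z : (md z == 0) = (z == 0).
Proof. by apply/eqP/eqP => [/Normc.eq0_normc|->]//; rewrite md0. Qed.
Lemma md_gt0 z : (0 < md z) = (z != 0).
Proof. by rewrite lt_neqAle md_ge0 eq_sym md_eq0 andbT. Qed.
Lemma mdr (x : R) : md x%:C%C = `|x|.
Proof. by rewrite /md /= expr0n addr0 sqrtr_sqr. Qed.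
Lemma mdnat n : md n%:R = n%:R :> R.
Proof. by rewrite -(rmorph_nat (real_complex R)) mdr normr_nat. Qed.
Lemma mdTr z w u : md (z - w) <= md (z - u) + md (u - w).
Proof. by rewrite -[z - w](subrKA u) addrC addrC mdD. Qed.
Lemma mdDr z w : md z - md w <= md (z + w).
Proof. by rewrite lerBlDr -{1}(addrK w z) mdB. Qed.
Lemma mdBr z w : md z - md w <= md (z - w).
Proof. by rewrite -(mdN w) mdDr. Qed.
Lemma md_sqr z : md z ^+ 2 = Re z ^+ 2 + Im z ^+ 2.
Proof. by case: z => a b; rewrite sqr_sqrtr // addr_ge0 // sqr_ge0. Qed.
Lemma Re_md z : `|Re z| <= md z.
Proof.
rewrite -(ler_pXn2r (n:=2)) ?nnegrE ?md_ge0 //.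
by rewrite md_sqr real_normK ?num_real // lerDl sqr_ge0.
Qed.
Lemma Im_md z : `|Im z| <= md z.
Proof.
rewrite -(ler_pXn2r (n:=2)) ?nnegrE ?md_ge0 //.
by rewrite md_sqr real_normK ?num_real // lerDr sqr_ge0.
Qed.
Lemma mdi : md 'i%C = 1.
Proof. by rewrite /md /= expr0n add0r expr1n sqrtr1. Qed.
Lemma md_ReIm z : md z <= `|Re z| + `|Im z|.
Proof.
rewrite [in leLHS](complexE z); apply: le_trans (mdD _ _) _.
by rewrite mdM mdi mul1r !mdr.
Qed.
Lemma ReD z w : Re (z + w) = Re z + Re w :> R. Proof. by case: z w => ? ? []. Qed.
Lemma ImD z w : Im (z + w) = Im z + Im w :> R. Proof. by case: z w => ? ? []. Qed.
Lemma ReN z : Re (- z) = - Re z :> R. Proof. by case: z. Qed.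
Lemma ImN z : Im (- z) = - Im z :> R. Proof. by case: z. Qed.
Lemma ReB z w : Re (z - w) = Re z - Re w :> R. Proof. by rewrite ReD ReN. Qed.
Lemma ImB z w : Im (z - w) = Im z - Im w :> R. Proof. by rewrite ImD ImN. Qed.
Lemma complex_eq (z w : C) : Re z = Re w -> Im z = Im w -> z = w.
Proof. by case: z w => ? ? [] ? ? /= -> ->. Qed.

(** Neighbourhoods with a real radius, whereas balls of [R[i]^o] have radii in [R[i]]; [nbhs_nearby]
    links the two. *)
Definition nearby (z : C) (P : C -> Prop) :=
  exists2 r : R, 0 < r & forall w, md (w - z) < r -> P w.

Lemma nearby_and z P Q : nearby z P -> nearby z Q -> nearby z (fun w => P w /\ Q w).
Proof.
move=> [r r0 hr] [s s0 hs]; exists (Num.min r s); first by rewrite lt_min r0.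
by move=> w; rewrite lt_min => /andP[/hr ? /hs].
Qed.
Lemma nearbyW z (P Q : C -> Prop) : (forall w, P w -> Q w) -> nearby z P -> nearby z Q.
Proof. by move=> PQ [r r0 hr]; exists r => // w /hr /PQ. Qed.
Lemma nearby_self z P : nearby z P -> P z.
Proof. by move=> [r r0]; apply; rewrite subrr md0. Qed.
Lemma nearbyT z (P : C -> Prop) : (forall w, P w) -> nearby z P.
Proof. by move=> h; exists 1. Qed.
Lemma nearby_lt z (e : R) : 0 < e -> nearby z (fun w => md (w - z) < e).
Proof. by exists e. Qed.
Lemma nearby_nearby z P : nearby z P -> nearby z (fun w => nearby w P).
Proof.
move=> [r r0 hr]; exists r => // w wr; exists (r - md (w - z)); rewrite ?subr_gt0 //.
by move=> v vw; apply: hr; apply: le_lt_trans (mdTr _ _ w) _; lra.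
Qed.
Lemma nearby_neq z a : z != a -> nearby z (fun w => w != a).
Proof.
move=> za; exists (md (z - a)); first by rewrite md_gt0 subr_eq0.
by move=> w h; apply/eqP => wa; move: h; rewrite wa mdC ltxx.
Qed.

Definition ccont (f : C -> C) z :=
  forall e : R, 0 < e -> nearby z (fun w => md (f w - f z) < e).

(** The bound is not strict, so it also holds at [w = z] and no punctured neighbourhood is
    needed. *)
Definition cdiff (f : C -> C) z d :=
  forall e : R, 0 < e -> nearby z (fun w => md (f w - f z - d * (w - z)) <= e * md (w - z)).

Implicit Types (f g : C -> C) (z w d c : C).

Lemma ccont_ext f g z : nearby z (fun w => f w = g w) -> ccont f z -> ccont g z.
Proof.
move=> fg cf e e0; have gz := nearby_self fg.
by apply: nearbyW (nearby_and fg (cf _ e0)) => w [<-]; rewrite -gz.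
Qed.
Lemma cdiff_ext f g z d : nearby z (fun w => f w = g w) -> cdiff f z d -> cdiff g z d.
Proof.
move=> fg cf e e0; have gz := nearby_self fg.
by apply: nearbyW (nearby_and fg (cf _ e0)) => w [<-]; rewrite -gz.
Qed.
Lemma ltc_md (w e : R[i]) : 0 < e -> (`|w| < e) = (md w < Re e).
Proof. by rewrite mdE !ltcE /= => /andP[/eqP -> _]; rewrite eqxx. Qed.

Lemma posc (e : R[i]) : 0 < e -> 0 < Re e /\ e = (Re e)%:C%C.
Proof. by case: e => x y; rewrite ltcE /= => /andP[/eqP -> ->]. Qed.

Lemma rc_gt0 (e : R) : (0 < e%:C%C :> R[i]) = (0 < e).
Proof. by rewrite ltcE /= eqxx. Qed.

Lemma nbhs_nearby (z : C^o) (A : set C^o) : nbhs z A <-> nearby z A.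
Proof.
split=> [/nbhs_ballP[e /= e0 h]|[r r0 h]].
  have [e1 e2] := posc e0; exists (Re e) => // w wz; apply: h.
  by rewrite -ball_normE /= ltc_md // mdC.
apply/nbhs_ballP; exists r%:C%C; first by rewrite /= rc_gt0.
by move=> w; rewrite -ball_normE /= ltc_md ?rc_gt0 //= mdC; exact: h.
Qed.

Lemma quotient_cvg (g : C^o -> C^o) (z d : C^o) :
  ((fun h : (R[i] : numFieldType) => h^-1 *: ((g \o shift z) (h *: (1 : C^o)) - g z)) @ (0 : (R[i] : numFieldType))^' --> d) <-> cdiff g z d.
Proof.
have E h : h != 0 -> h^-1 *: ((g \o shift z) (h *: (1 : C^o)) - g z) - d = (g (h + z) - g z - d * h) / h.
  move=> h0; rewrite /= [h%:A](mulr1) /GRing.scale /=; field; exact: h0.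
split=> [h e e0|h A].
  have : nbhs d (fun w => md (w - d) < e) by apply/nbhs_nearby; exists e.
  move=> /h; rewrite /= => /nbhs_nearby[r r0 hr]; exists r => // w wr.
  have [->|wz] := eqVneq w z; first by rewrite !subrr mulr0 subrr md0 mulr0.
  have wz0 : w - z != 0 by rewrite subr_eq0.
  have := hr (w - z); rewrite subr0 => /(_ wr wz0)/=.
  rewrite E // mdf ltr_pdivrMr ?md_gt0 // subrK => /ltW; exact.
move=> /nbhs_nearby[e e0 he]; have e2 : 0 < e / 2 by lra.
have [r r0 hr] := h _ e2; apply/nbhs_nearby; exists r => // w; rewrite subr0 => wr w0.
apply: he; rewrite E // mdf ltr_pdivrMr ?md_gt0 //.
have := hr (w + z); rewrite addrK => /(_ wr) h1; apply: le_lt_trans h1 _.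
by rewrite ltr_pM2r ?md_gt0 //; lra.
Qed.

Lemma derivable_cdiff (g : C^o -> C^o) z : derivable g z 1 <-> exists d, cdiff g z d.
Proof.
split=> [h|[d /quotient_cvg h]]; last exact: cvgP h.
by eexists; apply/quotient_cvg; exact: h.
Qed.

Lemma derive1_cdiff (g : C^o -> C^o) z d : cdiff g z d -> derive1 g z = d.
Proof. by move=> /quotient_cvg h; rewrite derive1E; apply: cvg_lim h; exact: norm_hausdorff. Qed.

Lemma cdiff_is_derive f z d : cdiff f z d <-> is_derive (z : C^o) 1 (f : C^o -> C^o) d.
Proof.
split=> [h|[h <-]]; last first.
  by have [d' dd] := (derivable_cdiff (f : C^o -> C^o) z).1 h; rewrite -derive1E (derive1_cdiff dd).
by split; [apply/derivable_cdiff; exists d | rewrite -derive1E; exact: derive1_cdiff].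
Qed.
Lemma ccontE f z : ccont f z <-> (f : C^o -> C^o) @ (z : C^o) --> (f z : C^o).
Proof.
split=> [h A /nbhs_nearby[e e0 he]|h e e0].
  by apply/nbhs_nearby; apply: nearbyW (h e e0) => w /he.
have : nbhs (f z : C^o) (fun w => md (w - f z) < e) by apply/nbhs_nearby; exists e.
by move=> /h /nbhs_nearby.
Qed.

Lemma cdiff_cont f z d : cdiff f z d -> ccont f z.
Proof.
move=> /cdiff_is_derive [/derivable1_diffP df _]; apply/ccontE; exact: differentiable_continuous.
Qed.
Lemma cdiff_cst c z : cdiff (fun=> c) z 0.
Proof. by move=> e e0; apply: nearbyT => w; rewrite subrr mul0r subrr md0 mulr_ge0 ?md_ge0 ?ltW. Qed.
Lemma cdiff_id z : cdiff (fun w => w) z 1.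
Proof. by move=> e e0; apply: nearbyT => w; rewrite mul1r subrr md0 mulr_ge0 ?md_ge0 ?ltW. Qed.
Lemma cdiffD f g z d d' : cdiff f z d -> cdiff g z d' -> cdiff (fun w => f w + g w) z (d + d').
Proof. by move=> /cdiff_is_derive hf /cdiff_is_derive hg; apply/cdiff_is_derive; exact: (is_deriveD hf hg). Qed.
Lemma cdiffB f g z d d' : cdiff f z d -> cdiff g z d' -> cdiff (fun w => f w - g w) z (d - d').
Proof. by move=> /cdiff_is_derive hf /cdiff_is_derive hg; apply/cdiff_is_derive; exact: (is_deriveB hf hg). Qed.
Lemma cdiffM f g z d d' : cdiff f z d -> cdiff g z d' ->
  cdiff (fun w => f w * g w) z (d * g z + f z * d').
Proof.
move=> /cdiff_is_derive hf /cdiff_is_derive hg; rewrite addrC [d * _]mulrC.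
exact: ((cdiff_is_derive _ _ _).2 (is_deriveM hf hg)).
Qed.
Lemma cdiffV f z d : cdiff f z d -> f z != 0 -> cdiff (fun w => (f w)^-1) z (- d / f z ^+ 2).
Proof.
move=> /cdiff_is_derive [df <-] f0; apply/cdiff_is_derive; split; first exact: derivableV.
by rewrite (deriveV f0 df) /GRing.scale /= mulrC mulrN mulNr.
Qed.
Lemma ccontD f g z : ccont f z -> ccont g z -> ccont (fun w => f w + g w) z.
Proof. by move=> /ccontE hf /ccontE hg; apply/ccontE; exact: cvgD hf hg. Qed.
Lemma ccontB f g z : ccont f z -> ccont g z -> ccont (fun w => f w - g w) z.
Proof. by move=> /ccontE hf /ccontE hg; apply/ccontE; exact: cvgB hf hg. Qed.
Lemma ccontM f g z : ccont f z -> ccont g z -> ccont (fun w => f w * g w) z.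
Proof. by move=> /ccontE hf /ccontE hg; apply/ccontE; exact: cvgM hf hg. Qed.
Lemma ccontV f z : ccont f z -> f z != 0 -> ccont (fun w => (f w)^-1) z.
Proof. by move=> /ccontE hf f0; apply/ccontE; exact: cvgV f0 hf. Qed.
Lemma ccont_cst c z : ccont (fun=> c) z. Proof. exact: cdiff_cont (cdiff_cst c z). Qed.
Lemma ccont_id z : ccont (fun w => w) z. Proof. exact: cdiff_cont (cdiff_id z). Qed.
Lemma ccontN0 f z : ccont f z -> f z != 0 -> nearby z (fun w => f w != 0 /\ md (f z) / 2 <= md (f w)).
Proof.
rewrite -md_gt0 => cf f0; have h : 0 < md (f z) / 2 by lra.
apply: nearbyW (cf _ h) => w; rewrite mdC => hw.
have h2 := mdBr (f z) (f z - f w); rewrite opprB addrCA subrr addr0 in h2.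
by rewrite -md_gt0; split; lra.
Qed.
Lemma ccontX f n z : ccont f z -> ccont (fun w => f w ^+ n) z.
Proof.
move=> cf; elim: n => [|n ih]; first exact: ccont_cst.
have := ccontM cf ih; apply: ccont_ext; apply: nearbyT => w; by rewrite exprS.
Qed.
Lemma cdiffX f n z d : cdiff f z d -> cdiff (fun w => f w ^+ n.+1) z (n.+1%:R * f z ^+ n * d).
Proof.
move=> df; elim: n => [|n ih]; first by rewrite expr0 mulr1 mul1r.
have := cdiffM df ih.
rewrite (_ : d * _ + _ = n.+2%:R * f z ^+ n.+1 * d); last by rewrite [n.+2%:R]mulrSr !exprS; ring.
apply: cdiff_ext; apply: nearbyT => w; by rewrite -exprS.
Qed.
Lemma cdiff_uniq f z d d' : cdiff f z d -> cdiff f z d' -> d = d'.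
Proof. by move=> /derive1_cdiff <- /derive1_cdiff <-. Qed.
Lemma ccont_nearby_lt (f : C -> C) z (c : R) : ccont f z -> md (f z) < c -> nearby z (fun w => md (f w) < c).
Proof.
move=> cf h; have e0 : 0 < c - md (f z) by lra.
apply: nearbyW (cf _ e0) => w hw; have := mdD (f w - f z) (f z); rewrite subrK => ?; lra.
Qed.
Lemma ccont_nearby_gt (f : C -> C) z (c : R) : ccont f z -> c < md (f z) -> nearby z (fun w => c < md (f w)).
Proof.
move=> cf h; have e0 : 0 < md (f z) - c by lra.
apply: nearbyW (cf _ e0) => w hw; have := mdD (f z - f w) (f w); rewrite subrK mdC => ?; lra.
Qed.
End Modulus.
Arguments md : simpl never.

(** * Bisection of rectangles: connectedness and compactness in the plane *)

Section Cousin.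
Variable R : realType.
Local Notation C := R[i].
Implicit Types (z w : C) (S : C -> Prop).

Lemma halving (X r : R) : 0 < r -> exists n : nat, X / 2 ^+ n < r.
Proof.
move=> r0; exists (Num.truncn (X / r)).+1; rewrite ltr_pdivrMr ?exprn_gt0 //.
rewrite mulrC -ltr_pdivrMr //; apply: lt_trans (truncnS_gt _) _.
by rewrite -natrX ltr_nat ltn_expl.
Qed.

Definition inrect (a b c d : R) z := (a <= Re z <= b) && (c <= Im z <= d).

Lemma inrectW a b c d a' b' c' d' z : a <= a' -> b' <= b -> c <= c' -> d' <= d ->
  inrect a' b' c' d' z -> inrect a b c d z.
Proof.
move=> aa bb cc dd /andP[/andP[z1 z2] /andP[z3 z4]].
by rewrite /inrect (le_trans aa z1) (le_trans z2 bb) (le_trans cc z3) (le_trans z4 dd).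
Qed.

Lemma rect_diam a b c d z w : inrect a b c d z -> inrect a b c d w ->
  md (w - z) <= (b - a) + (d - c).
Proof.
move=> /andP[/andP[? ?] /andP[? ?]] /andP[/andP[? ?] /andP[? ?]].
by apply: le_trans (md_ReIm _) _; rewrite ReB ImB; apply: lerD; rewrite ler_norml lerNl opprB !lerB.
Qed.

Section Bisection.
Variable P : R -> R -> R -> R -> Prop.
Hypothesis quarters : forall a b c d, a <= b -> c <= d ->
  let m := (a + b) / 2 in let n := (c + d) / 2 in
  P a m c n -> P m b c n -> P a m n d -> P m b n d -> P a b c d.

Let st := ((R * R) * (R * R))%type.
Let good (s : st) := s.1.1 <= s.1.2 /\ s.2.1 <= s.2.2.
Let bad (s : st) := ~ P s.1.1 s.1.2 s.2.1 s.2.2.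
Let half (p q : R * R) := p.1 <= q.1 /\ q.2 <= p.2 /\ q.2 - q.1 = (p.2 - p.1) / 2.

(** The existential stands in front of the hypotheses so that [choice] yields a total successor map;
    [((0, 0), (0, 0))] is a dummy. *)
Let step s : exists s', good s -> bad s -> half s.1 s'.1 /\ half s.2 s'.2 /\ bad s'.
Proof.
case: s => -[a b] [c d]; rewrite /good /bad /half /=.
have [ab|] := boolP (a <= b); last by exists ((0, 0), (0, 0)) => -[].
have [cd|] := boolP (c <= d); last by exists ((0, 0), (0, 0)) => -[].
have [h1|h1] := pselect (P a ((a + b) / 2) c ((c + d) / 2)); last first.
  by exists ((a, (a + b) / 2), (c, (c + d) / 2)) => /= _ _; split; [|split=> //]; repeat split; lra.
have [h2|h2] := pselect (P ((a + b) / 2) b c ((c + d) / 2)); last first.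
  by exists (((a + b) / 2, b), (c, (c + d) / 2)) => /= _ _; split; [|split=> //]; repeat split; lra.
have [h3|h3] := pselect (P a ((a + b) / 2) ((c + d) / 2) d); last first.
  by exists ((a, (a + b) / 2), ((c + d) / 2, d)) => /= _ _; split; [|split=> //]; repeat split; lra.
have [h4|h4] := pselect (P ((a + b) / 2) b ((c + d) / 2) d); last first.
  by exists (((a + b) / 2, b), ((c + d) / 2, d)) => /= _ _; split; [|split=> //]; repeat split; lra.
by exists ((0, 0), (0, 0)) => _ []; exact: quarters.
Qed.

Let nested (u : nat -> R * R) : (forall n, half (u n) (u n.+1)) -> (u 0%N).1 <= (u 0%N).2 ->
  exists x, forall n, (u n).1 <= x <= (u n).2 /\ (u n).2 - (u n).1 = ((u 0%N).2 - (u 0%N).1) / 2 ^+ n /\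
    (u 0%N).1 <= (u n).1 /\ (u n).2 <= (u 0%N).2.
Proof.
move=> hu u0.
have len n : (u n).2 - (u n).1 = ((u 0%N).2 - (u 0%N).1) / 2 ^+ n.
  elim: n => [|n ih]; first by rewrite expr0 divr1.
  by have [_ [_ ->]] := hu n; rewrite ih exprSr invfM mulrA.
have le n : (u n).1 <= (u n).2.
  by rewrite -subr_ge0 len divr_ge0 ?subr_ge0 // exprn_ge0.
have mono1 m n : (m <= n)%N -> (u m).1 <= (u n).1.
  elim: n => [|n ih]; first by rewrite leqn0 => /eqP ->.
  rewrite leq_eqVlt => /orP[/eqP -> //|/ih h]; apply: le_trans h _; by have [] := hu n.
have mono2 m n : (m <= n)%N -> (u n).2 <= (u m).2.
  elim: n => [|n ih]; first by rewrite leqn0 => /eqP ->.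
  rewrite leq_eqVlt => /orP[/eqP -> //|/ih h]; apply: le_trans h; by have [_ []] := hu n.
have lu m n : (u m).1 <= (u n).2.
  have [mn|nm] := leqP m n; first exact: le_trans (mono1 _ _ mn) (le n).
  exact: le_trans (le m) (mono2 _ _ (ltnW nm)).
pose E := [set x | exists n, x = (u n).1]; have E0 : E !=set0 by exists (u 0%N).1, 0%N.
exists (sup E) => n; split; last by rewrite len mono1 ?mono2.
apply/andP; split; last by apply: ge_sup => // _ [m ->].
by apply: ub_le_sup; [exists (u 0%N).2 => _ [m ->] | exists n].
Qed.

(** A bad rectangle has a bad quarter, and so on; the nested bad rectangles shrink to a point, near
    which the local hypothesis makes small ones good. This one principle gives connectedness, finite
    covers, Goursat's theorem and primitives of cocycles. *)
Lemma cousin a b c d : a <= b -> c <= d ->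
  (forall z, inrect a b c d z -> exists2 r, 0 < r & forall a' b' c' d',
    a' <= Re z <= b' -> c' <= Im z <= d' -> b' - a' < r -> d' - c' < r ->
    a <= a' -> b' <= b -> c <= c' -> d' <= d -> P a' b' c' d') ->
  P a b c d.
Proof.
move=> ab cd loc; apply: contrapT => nP.
have [nx nxP] := choice step.
pose u n := iter n nx ((a, b), (c, d)).
have uP n : good (u n) /\ bad (u n).
  elim: n => [|n [gn bn]]; first by [].
  have [[h1 [h2 h3]] [[h4 [h5 h6]] h7]] := nxP _ gn bn.
  split; last exact: h7.
  by case: gn => g1 g2; split; rewrite -subr_ge0 ?h3 ?h6 divr_ge0 // subr_ge0.
have hu1 n : half (u n).1 (u n.+1).1 by have [g b'] := uP n; have [] := nxP _ g b'.
have hu2 n : half (u n).2 (u n.+1).2 by have [g b'] := uP n; have [_ []] := nxP _ g b'.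
have [x hx] := nested (u := fun n => (u n).1) hu1 ab.
have [y hy] := nested (u := fun n => (u n).2) hu2 cd.
have [|r r0 hr] := loc (Complex x y).
  by have [h1 _] := hx 0%N; have [h2 _] := hy 0%N; apply/andP.
have [n1 hn1] := halving (b - a) r0; have [n2 hn2] := halving (d - c) r0.
pose n := maxn n1 n2.
have mono (X : R) m : 0 <= X -> (m <= n)%N -> X / 2 ^+ n <= X / 2 ^+ m.
  move=> X0 mn; rewrite ler_wpM2l // lef_pV2 ?posrE ?exprn_gt0 //.
  by rewrite ler_weXn2l // ler1n.
have [x1 [x2 [x3 x4]]] := hx n; have [y1 [y2 [y3 y4]]] := hy n.
have [_] := uP n; apply; apply: hr => //=; rewrite ?x2 ?y2.
- by apply: le_lt_trans hn1; rewrite mono ?leq_maxl ?subr_ge0.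
- by apply: le_lt_trans hn2; rewrite mono ?leq_maxr ?subr_ge0.
Qed.
End Bisection.

(** The four quarters share the midpoint [o], so constancy on each spreads to the whole. Degenerate
    rectangles are allowed: segments occur as common sides and as the parameter interval of
    [rouche]. *)
Lemma rect_const (T : Type) (k : C -> T) a b c d :
  (forall z, inrect a b c d z -> nearby z (fun w => inrect a b c d w -> k w = k z)) ->
  forall z w, inrect a b c d z -> inrect a b c d w -> k z = k w.
Proof.
move=> loc z w hz hw.
have ab : a <= b by case/andP: hz => /andP[h1 h2] _; lra.
have cd : c <= d by case/andP: hz => _ /andP[h1 h2]; lra.
have := @cousin (fun a' b' c' d' => a <= a' -> b' <= b -> c <= c' -> d' <= d ->
   forall z w, inrect a' b' c' d' z -> inrect a' b' c' d' w -> k z = k w) _ a b c d ab cd.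
apply => //; try exact: lexx; move=> {z w hz hw}.
- move=> a' b' c' d' ab' cd' m n h1 h2 h3 h4 aa bb cc dd.
  have am : a' <= m <= b' by rewrite /m; lra.
  have cn : c' <= n <= d' by rewrite /n; lra.
  case/andP: am => am mb; case/andP: cn => cn nd.
  pose o := Complex m n.
  suff H z : inrect a' b' c' d' z -> k z = k o by move=> z w /H -> /H ->.
  have mb2 : m <= b by apply: le_trans bb.
  have am2 : a <= m by apply: le_trans am.
  have nb2 : n <= d by apply: le_trans dd.
  have an2 : c <= n by apply: le_trans cn.
  move=> /andP[/andP[z1 z2] /andP[z3 z4]].
  have [zm|mz] := leP (Re z) m; have [zn|nz] := leP (Im z) n.
  + by apply: h1 => //; rewrite /inrect ?z1 ?zm ?z3 ?zn ?am ?cn ?lexx.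
  + by apply: h3 => //; rewrite /inrect ?z1 ?zm ?z4 ?(ltW nz) ?am ?nd ?lexx.
  + by apply: h2 => //; rewrite /inrect ?z2 ?(ltW mz) ?z3 ?zn ?mb ?cn ?lexx.
  + by apply: h4 => //; rewrite /inrect ?z2 ?(ltW mz) ?z4 ?(ltW nz) ?mb ?nd ?lexx.
- move=> z hz; have [r r0 hr] := loc z hz.
  exists (r / 2) => [|a' b' c' d' zx zy lb ld aa bb cc dd _ _ _ _]; first lra.
  have hz' : inrect a' b' c' d' z by rewrite /inrect zx.
  suff H w : inrect a' b' c' d' w -> k w = k z by move=> w1 w2 /H -> /H ->.
  by move=> hw; apply: hr; [have := rect_diam hz' hw; lra | exact: inrectW hw].
Qed.

Definition bdd S := exists M : R, forall z, S z -> md z <= M.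
Definition clo S := forall z, ~ S z -> nearby z (fun w => ~ S w).
Definition cpt S := bdd S /\ clo S.

(** The radius is given at every point of the plane, so boundedness suffices; for a compact [S],
    points off [S] are given a radius whose disk misses [S]. *)
Lemma finite_cover S (r : C -> R) : bdd S -> (forall z, 0 < r z) ->
  exists s : seq C, forall w, S w -> exists2 z, z \in s & md (w - z) < r z.
Proof.
move=> [M hM] r0.
pose X := 1 + `|M|.
have [s hs] : exists s : seq C, forall w, inrect (- X) X (- X) X w -> exists2 z, z \in s & md (w - z) < r z.
  apply: (@cousin (fun a b c d => exists s : seq C, forall w, inrect a b c d w ->
     exists2 z, z \in s & md (w - z) < r z)); rewrite /X.
  - move=> a b c d ab cd [s1 h1] [s2 h2] [s3 h3] [s4 h4].
    set m := (a + b) / 2 in h1 h2 h3 h4; set n := (c + d) / 2 in h1 h2 h3 h4.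
    exists (s1 ++ s2 ++ s3 ++ s4) => w /andP[/andP[w1 w2] /andP[w3 w4]].
    have [zm|mz] := leP (Re w) m; have [zn|nz] := leP (Im w) n.
    + have [|z zs hz] := h1 w; first by rewrite /inrect w1 zm w3 zn.
      by exists z => //; rewrite !mem_cat zs.
    + have [|z zs hz] := h3 w; first by rewrite /inrect w1 zm w4 ltW.
      by exists z => //; rewrite !mem_cat zs ?orbT.
    + have [|z zs hz] := h2 w; first by rewrite /inrect w2 (ltW mz) w3 zn.
      by exists z => //; rewrite !mem_cat zs ?orbT.
    + have [|z zs hz] := h4 w; first by rewrite /inrect w2 w4 !ltW.
      by exists z => //; rewrite !mem_cat zs ?orbT.
  - have := normr_ge0 M; lra.
  - have := normr_ge0 M; lra.
  - move=> z _; exists (r z / 2) => [|a' b' c' d' zx zy lb ld _ _ _ _]; first by have := r0 z; lra.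
    have hz : inrect a' b' c' d' z by rewrite /inrect zx.
    by exists [:: z] => w hw; exists z; rewrite ?inE //; have := rect_diam hz hw; lra.
exists s => w Sw; apply: hs; have := hM _ Sw; have := Re_md w; have := Im_md w.
rewrite !ler_norml => /andP[h1 h2] /andP[h3 h4] h5.
have := ler_norm M; rewrite /inrect /X => h6.
by apply/andP; split; apply/andP; split; lra.
Qed.

Lemma cpt_unif S (Q : C -> R -> Prop) : cpt S ->
  (forall z e e', Q z e -> e' <= e -> Q z e') ->
  (forall z, S z -> exists2 e : R, 0 < e & nearby z (fun w => S w -> Q w e)) ->
  exists2 e : R, 0 < e & forall z, S z -> Q z e.
Proof.
move=> [bS cS] mono loc.
have H z : exists p : R * R, [/\ 0 < p.1, 0 < p.2 &
    forall w, md (w - z) < p.1 -> S w -> Q w p.2].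
  have [Sz|nSz] := pselect (S z).
    by have [e e0 [r r0 h]] := loc _ Sz; exists (r, e).
  by have [r r0 h] := cS _ nSz; exists (r, 1); split=> // w /h.
have [p hp] := choice H.
have [|s hs] := @finite_cover S (fun z => (p z).1) bS; first by move=> z; case: (hp z).
exists (\big[Num.min/1]_(z <- s) (p z).2).
  by elim/big_ind: _ => // [x y x0 y0|z _]; [rewrite lt_min x0 | case: (hp z)].
move=> w Sw; have [z zs hw] := hs _ Sw; have [_ _ h] := hp z.
apply: mono (h _ hw Sw) _.
elim: s zs {hs} => // x s ih; rewrite inE big_cons ge_min => /orP[/eqP ->|/ih ->]; by rewrite ?lexx ?orbT.
Qed.

(** Upper semicontinuity along [S] is all that will be shown for [V] in the Ahlfors comparison.
    Without a maximum, each point has a neighbourhood on which [g] stays below the value at some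
    better point; the best of finitely many better points would have to exceed itself. *)
Lemma cpt_max S (g : C -> R) : cpt S -> (exists z, S z) ->
  (forall z e, S z -> 0 < e -> nearby z (fun w => S w -> g w < g z + e)) ->
  exists2 p, S p & forall z, S z -> g z <= g p.
Proof.
move=> [bS cS] [z0 Sz0] usc; apply: contrapT => nmax.
have H z : exists p : R * C, 0 < p.1 /\ S p.2 /\
    forall w, md (w - z) < p.1 -> S w -> g w < g p.2.
  have [Sz|nSz] := pselect (S z); last first.
    by have [r r0 h] := cS _ nSz; exists (r, z0); split=> //; split=> // w /h.
  have [z' Sz' zz'] : exists2 z', S z' & g z < g z'.
    apply: contrapT => h; apply: nmax; exists z => // w Sw; rewrite leNgt; apply/negP => gw.
    by apply: h; exists w.
  have [|r r0 h] := usc z (g z' - g z) Sz; first lra.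
  by exists (r, z'); split=> //; split=> // w /h hw /hw; rewrite addrC subrK.
have [p hp] := choice H.
have [|s hs] := @finite_cover S (fun z => (p z).1) bS; first by move=> z; case: (hp z).
have s0 : s != [::] by apply/eqP => s0; have [z] := hs _ Sz0; rewrite s0.
have [m ms hm] : exists2 m, m \in s & forall z, z \in s -> g (p z).2 <= g (p m).2.
  elim: s s0 {hs} => // x s ih _.
  have [->|s0] := eqVneq s [::]; first by exists x; rewrite ?inE // => z; rewrite inE => /eqP ->.
  have [m ms hm] := ih s0.
  have [xm|mx] := leP (g (p x).2) (g (p m).2).
    by exists m; rewrite ?inE ?ms ?orbT // => z; rewrite inE => /orP[/eqP ->|/hm].
  exists x; rewrite ?inE ?eqxx // => z; rewrite inE => /orP[/eqP ->//|/hm h].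
  exact: le_trans h (ltW mx).
have [_ [Spm _]] := hp m.
have [z zs hz] := hs _ Spm; have [_ [_ h]] := hp z.
by have := lt_le_trans (h _ hz Spm) (hm _ zs); rewrite ltxx.
Qed.

Lemma cloI S S' : clo S -> clo S' -> clo (fun z => S z /\ S' z).
Proof.
move=> cS cS' z h; have [Sz|/cS] := pselect (S z); last by apply: nearbyW => w nS [].
have [Sz'|/cS'] := pselect (S' z); last by apply: nearbyW => w nS [].
by case: h.
Qed.
Lemma cptI S S' : cpt S -> clo S' -> cpt (fun z => S z /\ S' z).
Proof. by move=> [[M hM] cS] cS'; split; [exists M => z [/hM] | exact: cloI]. Qed.

Lemma clo_le (l : C -> R) (c : R) : (forall z e, 0 < e -> nearby z (fun w => l z - e < l w)) -> clo (fun z => l z <= c).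
Proof.
move=> hl z /negP; rewrite -ltNge => h; have e0 : 0 < l z - c by lra.
by apply: nearbyW (hl z _ e0) => w hw; apply/negP; rewrite -ltNge; lra.
Qed.
Lemma clo_sublevel f (c : R) : (forall z, ccont f z) -> clo (fun z => md (f z) <= c).
Proof.
move=> cf; apply: clo_le => z e e0; apply: nearbyW (cf z e e0) => w; rewrite mdC => h.
have := mdBr (f z) (f w); lra.
Qed.
Lemma clo_superlevel f (c : R) : (forall z, ccont f z) -> clo (fun z => c <= md (f z)).
Proof.
move=> cf z /negP; rewrite -ltNge => h.
by apply: nearbyW (ccont_nearby_lt (cf z) h) => w hw; apply/negP; rewrite -ltNge.
Qed.

Lemma cpt_rect a b c d : cpt (inrect a b c d).
Proof.
split.
  exists (md (Complex a c) + ((b - a) + (d - c))) => z /[dup] hz /andP[/andP[z1 z2] /andP[z3 z4]].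
  have ha : inrect a b c d (Complex a c) by rewrite /inrect /= !lexx (le_trans z1 z2) (le_trans z3 z4).
  have := rect_diam ha hz; have := mdBr z (Complex a c); lra.
have le (l : C -> R) k : (forall z w, `|l z - l w| <= md (z - w)) -> clo (fun z => l z <= k).
  move=> hl; apply: clo_le => z e e0; exists e => // w wz; have := hl w z; rewrite ler_norml => /andP[]; lra.
have cR k := le (fun z => Re z) k (fun z w => ltac:(rewrite -ReB; exact: Re_md)).
have cR' k := le (fun z => - Re z) k (fun z w => ltac:(rewrite -opprD normrN -ReB; exact: Re_md)).
have cI k := le (fun z => Im z) k (fun z w => ltac:(rewrite -ImB; exact: Im_md)).
have cI' k := le (fun z => - Im z) k (fun z w => ltac:(rewrite -opprD normrN -ImB; exact: Im_md)).
move=> z hz; have := cloI (cloI (cR' (- a)) (cR b)) (cloI (cI' (- c)) (cI d)).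
have E w : ((- Re w <= - a /\ Re w <= b) /\ (- Im w <= - c /\ Im w <= d)) <-> inrect a b c d w.
  rewrite /inrect !lerN2; split=> [[[-> ->] [-> ->]]//|/andP[/andP[-> ->] /andP[-> ->]]//].
by move=> /(_ z)[/E//|r r0 hr]; exists r => // w /hr nw /E.
Qed.
End Cousin.

(** * Integrals along edges of rectangles *)
Section RealInt.
Variable R : realType.
Local Notation mu := (@lebesgue_measure R).

Definition rcont (f : R -> R) a b := forall x : R, a <= x <= b ->
  forall e : R, 0 < e -> exists2 r : R, 0 < r & forall y, `|y - x| < r -> `|f y - f x| < e.

Definition rint (f : R -> R) (a b : R) : R := (\int[mu]_(x in `[a, b]) f x)%R.

Lemma rcont_integrable f a b : rcont f a b -> mu.-integrable `[a, b] (EFin \o f).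
Proof.
move=> cf; apply: continuous_compact_integrable; first exact: segment_compact.
apply: continuous_in_subspaceT => x; rewrite inE /= in_itv /= => /cf h.
apply/cvgrPdist_lt => e e0; have [r r0 hr] := h e e0.
by exists r => // y; rewrite /= distrC => /hr; rewrite distrC.
Qed.

Lemma rint_cst (c a b : R) : a <= b -> rint (fun=> c) a b = c * (b - a).
Proof.
move=> ab; rewrite /rint Rintegral_cst //= lebesgue_measure_itv /= lte_fin.
case: ltP => //= ba; have -> : a = b by apply/eqP; rewrite eq_le ab.
by rewrite subrr.
Qed.
Lemma rintD f g a b : rcont f a b -> rcont g a b ->
  rint (fun x => f x + g x) a b = rint f a b + rint g a b.
Proof. by move=> /rcont_integrable hf /rcont_integrable hg; rewrite /rint RintegralD. Qed.
Lemma rintB f g a b : rcont f a b -> rcont g a b ->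
  rint (fun x => f x - g x) a b = rint f a b - rint g a b.
Proof. by move=> /rcont_integrable hf /rcont_integrable hg; rewrite /rint RintegralB. Qed.
Lemma rintZ c f a b : rcont f a b -> rint (fun x => c * f x) a b = c * rint f a b.
Proof. by move=> /rcont_integrable hf; rewrite /rint RintegralZl. Qed.
Lemma rint_le f g a b : rcont f a b -> rcont g a b -> (forall x, a <= x <= b -> f x <= g x) ->
  rint f a b <= rint g a b.
Proof.
move=> /rcont_integrable hf /rcont_integrable hg fg; exact: le_Rintegral.
Qed.
Lemma rint_ext f g a b : (forall x, a <= x <= b -> f x = g x) -> rint f a b = rint g a b.
Proof. by move=> fg; apply: eq_Rintegral => x; rewrite inE /= in_itv => /fg. Qed.
Lemma rint_split f a m b : rcont f a b -> a <= m -> m <= b -> rint f a b = rint f a m + rint f m b.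
Proof.
move=> cf am mb.
have h1 := rcont_integrable cf.
have h2 : mu.-integrable `[m, b] (EFin \o f).
  by apply: rcont_integrable => x /andP[x1 x2]; apply: cf; rewrite x2 (le_trans am).
rewrite /rint -[X in X = _](subrK (\int[mu]_(x in `[a, m]) f x)%R) addrC; congr (_ + _).
rewrite Rintegral_itvB //= ?bnd_simp // Rintegral_itv_obnd_cbnd //.
apply: integrableS h2 => //; exact: subset_itv_oc_cc.
Qed.
Lemma rcont_cst c a b : rcont (fun=> c) a b.
Proof. by move=> x _ e e0; exists 1 => // y _; rewrite subrr normr0. Qed.
Lemma rint_bound f a b M : a <= b -> rcont f a b -> (forall x, a <= x <= b -> `|f x| <= M) ->
  `|rint f a b| <= M * (b - a).
Proof.
move=> ab cf h; rewrite ler_norml; apply/andP; split.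
  rewrite -mulNr -rint_cst //; apply: rint_le => //; first exact: rcont_cst.
  by move=> x /h; rewrite ler_norml => /andP[].
rewrite -rint_cst //; apply: rint_le => //; first exact: rcont_cst.
by move=> x /h; rewrite ler_norml => /andP[].
Qed.
End RealInt.

Section ComplexInt.
Variable R : realType.
Local Notation C := R[i].

(* Paths are parametrised horizontally or vertically, so a function along an edge is a
   map [R -> C]; continuity is asked at the points of [[a, b]] only. *)
Definition pcont (g : R -> C) a b := forall x : R, a <= x <= b ->
  forall e : R, 0 < e -> exists2 r : R, 0 < r & forall y, `|y - x| < r -> md (g y - g x) < e.

Definition cint (g : R -> C) a b : C :=
  Complex (rint (fun x => Re (g x)) a b) (rint (fun x => Im (g x)) a b).

Lemma pcont_Re g a b : pcont g a b -> rcont (fun x => Re (g x)) a b.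
Proof.
move=> cg x hx e /(cg x hx) [r r0 h]; exists r => // y /h; apply: le_lt_trans.
by rewrite -ReB Re_md.
Qed.
Lemma pcont_Im g a b : pcont g a b -> rcont (fun x => Im (g x)) a b.
Proof.
move=> cg x hx e /(cg x hx) [r r0 h]; exists r => // y /h; apply: le_lt_trans.
by rewrite -ImB Im_md.
Qed.
Lemma cintD f g a b : pcont f a b -> pcont g a b ->
  cint (fun x => f x + g x) a b = cint f a b + cint g a b.
Proof.
move=> cf cg; apply: complex_eq; rewrite /= -rintD; try exact: pcont_Re; try exact: pcont_Im.
by apply: rint_ext => x _; rewrite ReD.
by apply: rint_ext => x _; rewrite ImD.
Qed.
Lemma cint_ext f g a b : (forall x, a <= x <= b -> f x = g x) -> cint f a b = cint g a b.
Proof. by move=> fg; congr Complex; apply: rint_ext => x /fg ->. Qed.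
Lemma rcontZ (c : R) f a b : rcont f a b -> rcont (fun x => c * f x) a b.
Proof.
move=> cf x hx e e0; have e0' : 0 < e / (1 + `|c|) by rewrite divr_gt0 // ltr_pwDl.
have [r r0 h] := cf x hx _ e0'; exists r => // y /h; rewrite ltr_pdivlMr ?ltr_pwDl // => h2.
rewrite -mulrBr normrM; apply: le_lt_trans h2; have := normr_ge0 (f y - f x); nra.
Qed.
Lemma cintZ c g a b : pcont g a b -> cint (fun x => c * g x) a b = c * cint g a b.
Proof.
move=> cg; have h1 := pcont_Re cg; have h2 := pcont_Im cg.
case: c => p q; apply: complex_eq; rewrite /=.
  rewrite -rintZ // -(rintZ q) // -rintB; try exact: rcontZ.
  by apply: rint_ext => x _; case: (g x).
rewrite -rintZ // -(rintZ q) // -rintD; try exact: rcontZ.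
by apply: rint_ext => x _; case: (g x).
Qed.
Lemma pcont_cst c a b : pcont (fun=> c) a b.
Proof. by move=> x _ e e0; exists 1 => // y _; rewrite subrr md0. Qed.
Lemma cint_cst c a b : a <= b -> cint (fun=> c) a b = c * (b - a)%:C%C.
Proof. by move=> ab; case: c => p q; rewrite /cint !rint_cst //=; simpc. Qed.
Lemma pcontZ c g a b : pcont g a b -> pcont (fun x => c * g x) a b.
Proof.
move=> cg x hx e e0; have e0' : 0 < e / (1 + md c) by rewrite divr_gt0 // ltr_pwDl // md_ge0.
have [r r0 h] := cg x hx _ e0'; exists r => // y /h; rewrite ltr_pdivlMr ?ltr_pwDl ?md_ge0 // => h2.
rewrite -mulrBr mdM; apply: le_lt_trans h2; have := md_ge0 (g y - g x); nra.
Qed.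
Lemma cint_split g a m b : pcont g a b -> a <= m -> m <= b -> cint g a b = cint g a m + cint g m b.
Proof.
move=> cg am mb; apply: complex_eq => /=; apply: rint_split => //.
  exact: pcont_Re.
exact: pcont_Im.
Qed.
(** The factor 2 comes from bounding real and imaginary parts separately. *)
Lemma cint_bound g a b M : a <= b -> pcont g a b -> (forall x, a <= x <= b -> md (g x) <= M) ->
  md (cint g a b) <= 2 * M * (b - a).
Proof.
move=> ab cg h; apply: le_trans (md_ReIm _) _ => /=.
have -> : 2 * M * (b - a) = M * (b - a) + M * (b - a) by ring.
apply: lerD; apply: rint_bound => //; try exact: pcont_Re; try exact: pcont_Im.
  by move=> x /h; apply: le_trans (Re_md _).
by move=> x /h; apply: le_trans (Im_md _).
Qed.
Lemma cint_Im_ge g a b m : a <= b -> pcont g a b -> (forall x, a <= x <= b -> m <= Im (g x)) ->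
  m * (b - a) <= Im (cint g a b).
Proof.
move=> ab cg h /=; rewrite -rint_cst //; apply: rint_le => //; first exact: rcont_cst.
exact: pcont_Im.
Qed.
Definition hedge (f : C -> C) y a b := cint (fun x => f (Complex x y)) a b.
Definition vedge (f : C -> C) x c d := 'i%C * cint (fun y => f (Complex x y)) c d.
Definition bint (f : C -> C) a b c d :=
  hedge f c a b + vedge f b c d - hedge f d a b - vedge f a c d.

Lemma hcont f y a b : (forall x, a <= x <= b -> ccont f (Complex x y)) ->
  pcont (fun x => f (Complex x y)) a b.
Proof.
move=> cf x /cf h e /h [r r0 hr]; exists r => // x' hx; apply: hr.
have -> : Complex x' y - Complex x y = (x' - x)%:C%C by apply: complex_eq => //=; rewrite subrr.
by rewrite mdr.
Qed.
Lemma vcont f x c d : (forall y, c <= y <= d -> ccont f (Complex x y)) ->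
  pcont (fun y => f (Complex x y)) c d.
Proof.
move=> cf y /cf h e /h [r r0 hr]; exists r => // y' hy; apply: hr.
have -> : Complex x y' - Complex x y = 'i%C * (y' - y)%:C%C.
  by apply: complex_eq => /=; rewrite ?subrr; ring.
by rewrite mdM mdi mul1r mdr.
Qed.
End ComplexInt.

(** * Goursat's theorem and Cauchy's formula *)
Section Goursat.
Variable R : realType.
Local Notation C := R[i].
Implicit Types (f g : C -> C) (z w : C).

Definition onbd (a b c d : R) z := inrect a b c d z /\
  (Re z = a \/ Re z = b \/ Im z = c \/ Im z = d).
Definition econt f a b c d := forall z, onbd a b c d z -> ccont f z.
Definition diffat f z := exists d, cdiff f z d.

Lemma diffat_cont f z : diffat f z -> ccont f z.
Proof. by move=> [d /cdiff_cont]. Qed.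
Lemma diffatD f g z : diffat f z -> diffat g z -> diffat (fun w => f w + g w) z.
Proof. by move=> [d df] [d' dg]; exists (d + d'); exact: cdiffD. Qed.
Lemma diffatB f g z : diffat f z -> diffat g z -> diffat (fun w => f w - g w) z.
Proof. by move=> [d df] [d' dg]; exists (d - d'); exact: cdiffB. Qed.
Lemma diffatM f g z : diffat f z -> diffat g z -> diffat (fun w => f w * g w) z.
Proof. by move=> [d df] [d' dg]; eexists; apply: cdiffM; eassumption. Qed.
Lemma diffatV f z : diffat f z -> f z != 0 -> diffat (fun w => (f w)^-1) z.
Proof. by move=> [d df] f0; eexists; apply: cdiffV; eassumption. Qed.
Lemma diffat_cst c z : diffat (fun=> c) z. Proof. by exists 0; exact: cdiff_cst. Qed.
Lemma diffat_id z : diffat (fun w => w) z. Proof. by exists 1; exact: cdiff_id. Qed.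
Lemma diffatX f n z : diffat f z -> diffat (fun w => f w ^+ n) z.
Proof.
move=> [d df]; case: n => [|n]; last by eexists; apply: cdiffX; eassumption.
by exists 0; apply: cdiff_ext (cdiff_cst 1 z); exact: nearbyT.
Qed.
Lemma diffat_ext f g z : nearby z (fun w => f w = g w) -> diffat f z -> diffat g z.
Proof. by move=> fg [d df]; exists d; exact: cdiff_ext df. Qed.

Section Edges.
Variables (a b c d : R).
Hypotheses (ab : a <= b) (cd : c <= d).

Lemma onbd_h f y : (y = c \/ y = d) -> econt f a b c d -> pcont (fun x => f (Complex x y)) a b.
Proof.
move=> hy cf; apply: hcont => x hx; apply: cf; split; first rewrite /inrect /=.
  by rewrite hx /=; case: hy => ->; rewrite lexx ?cd.
by right; right.
Qed.
Lemma onbd_v f x : (x = a \/ x = b) -> econt f a b c d -> pcont (fun y => f (Complex x y)) c d.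
Proof.
move=> hx cf; apply: vcont => y hy; apply: cf; split; first rewrite /inrect /=.
  by rewrite hy andbT; case: hx => ->; rewrite lexx ?ab.
by case: hx => ->; [left|right; left].
Qed.

Lemma bintD f g : econt f a b c d -> econt g a b c d ->
  bint (fun z => f z + g z) a b c d = bint f a b c d + bint g a b c d.
Proof.
move=> cf cg; rewrite /bint /hedge /vedge !cintD; try (apply: onbd_h => //; by tauto); try (apply: onbd_v => //; by tauto).
ring.
Qed.
Lemma bintZ k f : econt f a b c d -> bint (fun z => k * f z) a b c d = k * bint f a b c d.
Proof.
move=> cf; rewrite /bint /hedge /vedge !cintZ; try (apply: onbd_h => //; by tauto); try (apply: onbd_v => //; by tauto).
ring.
Qed.
Lemma bint_ext f g : (forall z, onbd a b c d z -> f z = g z) -> bint f a b c d = bint g a b c d.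
Proof.
move=> fg; rewrite /bint /hedge /vedge.
have H y : y = c \/ y = d -> cint (fun x => f (Complex x y)) a b = cint (fun x => g (Complex x y)) a b.
  move=> hy; apply: cint_ext => x hx; apply: fg; split; last by right; right.
  by rewrite /inrect /= hx /=; case: hy => ->; rewrite lexx ?cd.
have V x : x = a \/ x = b -> cint (fun y => f (Complex x y)) c d = cint (fun y => g (Complex x y)) c d.
  move=> hx; apply: cint_ext => y hy; apply: fg; split; last by case: hx => ->; [left|right; left].
  by rewrite /inrect /= hy andbT; case: hx => ->; rewrite lexx ?ab.
by rewrite !H ?V //; tauto.
Qed.
Lemma bint_bound f M : econt f a b c d -> (forall z, onbd a b c d z -> md (f z) <= M) ->
  md (bint f a b c d) <= 4 * M * ((b - a) + (d - c)).
Proof.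
move=> cf hM.
have H y : y = c \/ y = d -> md (hedge f y a b) <= 2 * M * (b - a).
  move=> hy; apply: cint_bound => //; first exact: onbd_h.
  move=> x hx; apply: hM; split; last by right; right.
  by rewrite /inrect /= hx /=; case: hy => ->; rewrite lexx ?cd.
have V x : x = a \/ x = b -> md (vedge f x c d) <= 2 * M * (d - c).
  move=> hx; rewrite mdM mdi mul1r; apply: cint_bound => //; first exact: onbd_v.
  move=> y hy; apply: hM; split; last by case: hx => ->; [left|right; left].
  by rewrite /inrect /= hy andbT; case: hx => ->; rewrite lexx ?ab.
have h1 := H c (or_introl erefl); have h2 := H d (or_intror erefl).
have h3 := V a (or_introl erefl); have h4 := V b (or_intror erefl).
rewrite /bint; apply: le_trans (mdB _ _) _; apply: le_trans (lerD (mdB _ _) (lexx _)) _.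
apply: le_trans (lerD (lerD (mdD _ _) (lexx _)) (lexx _)) _; lra.
Qed.
Lemma bint_split_h f m : a <= m -> m <= b -> econt f a b c d ->
  bint f a b c d = bint f a m c d + bint f m b c d.
Proof.
move=> am mb cf; rewrite /bint /hedge.
rewrite (@cint_split _ _ a m b) //; last by apply: onbd_h => //; tauto.
rewrite (@cint_split _ (fun x => f (Complex x d)) a m b) //; last by apply: onbd_h => //; tauto.
ring.
Qed.
Lemma bint_split_v f m : c <= m -> m <= d -> econt f a b c d ->
  bint f a b c d = bint f a b c m + bint f a b m d.
Proof.
move=> cm mdd cf; rewrite /bint /vedge.
rewrite (@cint_split _ (fun y => f (Complex b y)) c m d) //; last by apply: onbd_v => //; tauto.
rewrite (@cint_split _ (fun y => f (Complex a y)) c m d) //; last by apply: onbd_v => //; tauto.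
ring.
Qed.
(** Opposite sides are translates of each other, so [z] differs on them by a constant; the two
    resulting multiples of the area cancel. No antiderivative is used. *)
Lemma bint_affine p q : bint (fun z => p + q * z) a b c d = 0.
Proof.
have cf : econt (fun z : C => z) a b c d by move=> z _; exact: ccont_id.
have cq : econt (fun z : C => q * z) a b c d.
  by move=> z _; apply: ccontM; [exact: ccont_cst | exact: ccont_id].
rewrite (@bintD (fun=> p) (fun z => q * z)) //; last by move=> z _; exact: ccont_cst.
rewrite bintZ //.
have -> : bint (fun=> p) a b c d = 0 by rewrite /bint /hedge /vedge; ring.
have hh : hedge (fun z : C => z) d a b = hedge (fun z => z) c a b + 'i%C * (d - c)%:C%C * (b - a)%:C%C.
  rewrite /hedge -(cint_cst ('i%C * (d - c)%:C%C) ab) -cintD; last 2 first.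
  - exact: (onbd_h (or_introl erefl) cf).
  - exact: pcont_cst.
  by apply: cint_ext => x _; apply: complex_eq => /=; ring.
have vv : vedge (fun z : C => z) b c d = vedge (fun z => z) a c d + 'i%C * ((b - a)%:C%C * (d - c)%:C%C).
  rewrite /vedge -(cint_cst (b - a)%:C%C cd) -mulrDr -cintD; last 2 first.
  - exact: (onbd_v (or_introl erefl) cf).
  - exact: pcont_cst.
  by congr (_ * _); apply: cint_ext => x _; apply: complex_eq => /=; ring.
rewrite /bint hh vv; ring.
Qed.
End Edges.

Lemma md_eq0_small (x : C) (K s0 : R) : 0 < s0 -> (forall s, 0 < s -> s < s0 -> md x <= K * s) -> x = 0.
Proof.
move=> s00 h; apply/eqP; rewrite -md_eq0; apply/eqP/le_anti; rewrite md_ge0 andbT leNgt; apply/negP => x0.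
pose s := Num.min (s0 / 2) (md x / (2 * (1 + `|K|))).
have k0 : 0 < 1 + `|K| by rewrite ltr_pwDl.
have sp : 0 < s by rewrite lt_min !divr_gt0 // mulr_gt0.
have ss0 : s < s0 by rewrite gt_min; apply/orP; left; lra.
have := h s sp ss0.
have : s * (2 * (1 + `|K|)) <= md x by rewrite -ler_pdivlMr ?mulr_gt0 // ge_min lexx orbT.
have := ler_norm K; nra.
Qed.

Definition instr (a b c d : R) z := (a < Re z < b) && (c < Im z < d).

Lemma not_instr p q r s a b c d z : inrect p q r s z ->
  [|| q <= a, b <= p, s <= c | d <= r] -> ~~ instr a b c d z.
Proof.
move=> /andP[/andP[? ?] /andP[? ?]] h; apply/negP => /andP[/andP[? ?] /andP[? ?]].
by case/or4P: h => ?; lra.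
Qed.

(** [cousin] is applied to the claim that the integral is at most [e] times the squared
    half-perimeter. Halving the sides divides this bound by 4, so the bounds of four quarters add up
    to that of the whole; near a point the affine part of [f] integrates to 0. *)
Lemma goursat f a b c d : a <= b -> c <= d -> (forall z, inrect a b c d z -> diffat f z) ->
  bint f a b c d = 0.
Proof.
move=> ab cd df; apply: (@md_eq0_small _ (((b - a) + (d - c)) ^+ 2) 1 ltr01) => e e0 _.
pose Q a' b' c' d' := a <= a' -> b' <= b -> c <= c' -> d' <= d -> a' <= b' -> c' <= d' ->
  md (bint f a' b' c' d') <= ((b' - a') + (d' - c')) ^+ 2 * e.
suff : Q a b c d by apply.
have sub a' b' c' d' : a <= a' -> b' <= b -> c <= c' -> d' <= d ->
    forall z, inrect a' b' c' d' z -> diffat f z.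
  by move=> aa bb cc dd z hz; apply: df; exact: inrectW hz.
apply: (@cousin _ Q) => //; rewrite /Q.
- move=> a' b' c' d' ab' cd' h1 h2 h3 h4 aa bb cc dd _ _.
  set m := (a' + b') / 2 in h1 h2 h3 h4; set n := (c' + d') / 2 in h1 h2 h3 h4.
  have /andP[am mb] : a' <= m <= b' by rewrite !midf_le.
  have /andP[cn nd] : c' <= n <= d' by rewrite !midf_le.
  have mB : m <= b by exact: le_trans bb.
  have Am : a <= m by exact: le_trans am.
  have nD : n <= d by exact: le_trans dd.
  have Cn : c <= n by exact: le_trans cn.
  have ec : econt f a' b' c' d' by move=> z [hz _]; apply: diffat_cont; apply: sub hz.
  have e1 : econt f a' m c' d' by move=> z [hz _]; apply: diffat_cont; apply: sub hz.
  have e2 : econt f m b' c' d' by move=> z [hz _]; apply: diffat_cont; apply: sub hz.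
  rewrite (@bint_split_h a' b' c' d' _ f m) // (@bint_split_v a' m c' d' _ f n) // (@bint_split_v m b' c' d' _ f n) //.
  apply: le_trans (mdD _ _) _; apply: le_trans (lerD (mdD _ _) (mdD _ _)) _.
  have {}h1 := h1 aa mB cc nD am cn; have {}h2 := h2 Am bb cc nD mb cn.
  have {}h3 := h3 aa mB Cn dd am nd; have {}h4 := h4 Am bb Cn dd mb nd.
  apply: le_trans (lerD (lerD h1 h3) (lerD h2 h4)) _; rewrite /m /n.
  by apply: le_of_eq; field.
- move=> z hz; have [D hD] := df z hz.
  (* [bint_bound] costs a factor 4. *)
  have e4 : 0 < e / 4 by lra.
  have [r r0 hr] := hD _ e4.
  exists (r / 2) => [|a' b' c' d' zx zy lb ld aa bb cc dd _ _ _ _ ab' cd']; first lra.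
  have hz' : inrect a' b' c' d' z by rewrite /inrect zx.
  pose g w := f w - f z - D * (w - z).
  have ecf : econt f a' b' c' d' by move=> w [hw _]; apply: diffat_cont; apply: sub hw.
  have eca : econt (fun w => (f z - D * z) + D * w) a' b' c' d'.
    move=> w _; apply: ccontD; first exact: ccont_cst.
    by apply: ccontM; [exact: ccont_cst | exact: ccont_id].
  have ecg : econt g a' b' c' d'.
    move=> w hw; apply: ccontB; last by apply: ccontM;
      [exact: ccont_cst | apply: ccontB; [exact: ccont_id | exact: ccont_cst]].
    by apply: ccontB; [exact: ecf | exact: ccont_cst].
  rewrite (_ : bint f a' b' c' d' = bint (fun w => g w + ((f z - D * z) + D * w)) a' b' c' d'); last first.
    by apply: bint_ext => // w _; rewrite /g; ring.
  rewrite bintD // bint_affine // addr0.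
  rewrite (_ : _ ^+ 2 * e = 4 * (e / 4 * ((b' - a') + (d' - c'))) * ((b' - a') + (d' - c'))); last by field.
  apply: bint_bound => // w [/(rect_diam hz') hw _].
  apply: le_trans (hr w _) _; first by apply: le_lt_trans hw _; lra.
  by rewrite ler_wpM2l // ltW.
Qed.

(** Four strips around the inner rectangle are cut off in turn, each contributing 0 by [goursat].
    The exempt set is the open inner rectangle, so [f] is differentiable on its sides. *)
Lemma frame f a b c d a' b' c' d' : a <= a' -> a' <= b' -> b' <= b -> c <= c' -> c' <= d' -> d' <= d ->
  (forall z, inrect a b c d z -> ~~ instr a' b' c' d' z -> diffat f z) ->
  bint f a b c d = bint f a' b' c' d'.
Proof.
move=> aa ab bb cc cd dd df.
have ec p q r s : a <= p -> q <= b -> c <= r -> s <= d ->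
   (forall z, onbd p q r s z -> ~~ instr a' b' c' d' z) -> econt f p q r s.
  by move=> h1 h2 h3 h4 h z hz; apply: diffat_cont; apply: df (h z hz); apply: inrectW hz.1.
have go p q r s : a <= p -> q <= b -> c <= r -> s <= d -> p <= q -> r <= s ->
   (forall z, inrect p q r s z -> ~~ instr a' b' c' d' z) -> bint f p q r s = 0.
  by move=> h1 h2 h3 h4 h5 h6 h; apply: goursat => // z hz; apply: df (h z hz); apply: inrectW hz.
have le1 : a <= b' by exact: le_trans ab.
have le2 : a' <= b by exact: le_trans bb.
have le3 : c <= d' by exact: le_trans cd.
have le4 : c' <= d by exact: le_trans dd.
have le5 : a <= b by exact: le_trans bb.
have le6 : c <= d by exact: le_trans dd.
have le7 : a' <= a' by []. have le8 : c' <= c' by [].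
have le9 : b' <= b' by []. have le0 : d' <= d' by [].
have on p q r s z : onbd p q r s z -> p <= a' -> b' <= q -> r <= c' -> d' <= s -> ~~ instr a' b' c' d' z.
  move=> [_ h] ? ? ? ?; apply/negP => /andP[/andP[? ?] /andP[? ?]].
  by clear df ec go; case: h => [|[|[|]]] ?; lra.
have off p q r s (h : [|| q <= a', b' <= p, s <= c' | d' <= r]) z (hz : inrect p q r s z) := not_instr hz h.
have ecc p q r s (h1 : a <= p) (h2 : q <= b) (h3 : c <= r) (h4 : s <= d) (k1 : p <= a') (k2 : b' <= q) (k3 : r <= c') (k4 : d' <= s) :
    econt f p q r s := ec p q r s h1 h2 h3 h4 (fun z hz => on p q r s z hz k1 k2 k3 k4).
rewrite (bint_split_h le6 aa le2 (ecc a b c d (lexx a) (lexx b) (lexx c) (lexx d) aa bb cc dd)).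
rewrite (go a a' c d (lexx a) le2 (lexx c) (lexx d) aa le6) ?add0r; last by apply: off; rewrite le7.
rewrite (bint_split_h le6 ab bb (ecc a' b c d aa (lexx b) (lexx c) (lexx d) le7 bb cc dd)).
rewrite (go b' b c d le1 (lexx b) (lexx c) (lexx d) bb le6) ?addr0; last by apply: off; rewrite le9 orbT.
rewrite (bint_split_v ab cc le4 (ecc a' b' c d aa bb (lexx c) (lexx d) le7 le9 cc dd)).
rewrite (go a' b' c c' aa bb (lexx c) le4 ab cc) ?add0r; last by apply: off; rewrite le8 !orbT.
rewrite (bint_split_v ab cd dd (ecc a' b' c' d aa bb cc (lexx d) le7 le9 le8 dd)).
by rewrite (go a' b' d' d aa bb le3 (lexx d) ab dd) ?addr0 //; apply: off; rewrite le0 !orbT.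
Qed.
End Goursat.

Section Cauchy.
Variable R : realType.
Local Notation C := R[i].
Implicit Types (f g : C -> C) (z w : C).

Definition sqb f (p : C) (s : R) := bint f (Re p - s) (Re p + s) (Im p - s) (Im p + s).
(** The number [2 * pi * i]. Its value is never computed: independence of the square and
    non-vanishing are enough. *)
Definition kap : C := sqb (fun z => z^-1) 0 1.

Lemma onbd_far p s z : onbd (Re p - s) (Re p + s) (Im p - s) (Im p + s) z -> s <= md (z - p).
Proof.
move=> [_ h]; have h1 := Re_md (z - p); have h2 := Im_md (z - p); move: h1 h2; rewrite ReB ImB.
have := ler_norm (Re z - Re p); have := ler_norm (Im z - Im p).
have := lerNnormlW (lexx `|Re z - Re p|); have := lerNnormlW (lexx `|Im z - Im p|).
by case: h => [|[|[|]]] ->; lra.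
Qed.
Lemma sq_near p s z : inrect (Re p - s) (Re p + s) (Im p - s) (Im p + s) z -> md (z - p) <= 2 * s.
Proof.
move=> /andP[/andP[? ?] /andP[? ?]]; apply: le_trans (md_ReIm _) _; rewrite ReB ImB mulr2n mulrDl mul1r.
by apply: lerD; rewrite ler_norml; apply/andP; split; lra.
Qed.
Lemma instr_not0 p s z : 0 < s -> ~~ instr (Re p - s) (Re p + s) (Im p - s) (Im p + s) z -> z != p.
Proof. by move=> s0; apply: contraNneq => ->; rewrite /instr; apply/andP; split; apply/andP; split; lra. Qed.
Lemma instr_not a b c d p z : instr a b c d p -> onbd a b c d z -> z != p.
Proof.
move=> /andP[/andP[? ?] /andP[? ?]] [_ h]; apply/eqP => zp; subst z.
by case: h => [|[|[|]]] ?; lra.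
Qed.
Lemma sq_instr p s z : md (z - p) < s -> instr (Re p - s) (Re p + s) (Im p - s) (Im p + s) z.
Proof.
move=> zs; have := le_lt_trans (Re_md _) zs; have := le_lt_trans (Im_md _) zs.
by rewrite ReB ImB /instr !ltr_distl => -> ->.
Qed.
Lemma diff_inv p z : z != p -> diffat (fun z => (z - p)^-1) z.
Proof.
move=> zp; apply: diffatV; last by rewrite subr_eq0.
by apply: diffatB; [exact: diffat_id | exact: diffat_cst].
Qed.

Lemma sqb_frame f a b c d p s : 0 < s -> a <= Re p - s -> Re p + s <= b -> c <= Im p - s -> Im p + s <= d ->
  (forall z, inrect a b c d z -> z != p -> diffat f z) -> bint f a b c d = sqb f p s.
Proof.
move=> s0 h1 h2 h3 h4 df; apply: frame => //; try lra.
by move=> z hz /(instr_not0 s0) /(df z hz).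
Qed.

Lemma sqb_bound f p s M : 0 <= s -> econt f (Re p - s) (Re p + s) (Im p - s) (Im p + s) ->
  (forall z, onbd (Re p - s) (Re p + s) (Im p - s) (Im p + s) z -> md (f z) <= M) ->
  md (sqb f p s) <= 16 * M * s.
Proof.
move=> s0 cf hM; apply: le_trans (bint_bound _ _ cf hM) _; try lra.
Qed.

Lemma inv_close a b c d p q T : 0 < T -> a <= b -> c <= d -> b - a <= 5 * T -> d - c <= 5 * T ->
  instr a b c d p -> instr a b c d q ->
  (forall z, onbd a b c d z -> T <= md (z - p) /\ T <= md (z - q)) ->
  md (bint (fun z => (z - p)^-1) a b c d - bint (fun z => (z - q)^-1) a b c d) <= 40 * md (p - q) / T.
Proof.
move=> T0 ab cd w1 w2 ip iq far.
have cp : econt (fun z => (z - p)^-1) a b c d by move=> z /(instr_not ip) /diff_inv /diffat_cont.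
have cq : econt (fun z => (z - q)^-1) a b c d by move=> z /(instr_not iq) /diff_inv /diffat_cont.
have cq' : econt (fun z => -1 * (z - q)^-1) a b c d.
  by move=> z hz; apply: ccontM; [exact: ccont_cst | exact: cq].
rewrite -[X in _ - X]mul1r -mulNr -bintZ // -bintD //.
have m0 : 0 <= md (p - q) / (T * T) by rewrite divr_ge0 ?md_ge0 // mulr_ge0 // ltW.
rewrite (_ : 40 * md (p - q) / T = 4 * (md (p - q) / (T * T)) * (5 * T + 5 * T)); last by field; rewrite gt_eqF.
apply: le_trans (bint_bound ab cd _ (M := md (p - q) / (T * T)) _) _.
- by move=> z hz; apply: ccontD; [exact: cp | exact: cq'].
- move=> z hz; have zp := instr_not ip hz; have zq := instr_not iq hz; have [h1 h2] := far z hz.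
  have -> : (z - p)^-1 + -1 * (z - q)^-1 = (p - q) / ((z - p) * (z - q)).
    by field; rewrite !subr_eq0 zp zq.
  rewrite mdf mdM ler_wpM2l ?md_ge0 // lef_pV2 ?posrE ?mulr_gt0 ?md_gt0 ?subr_eq0 //.
  by apply: ler_pM => //; exact: ltW.
- by apply: ler_wpM2l; [rewrite mulr_ge0 | exact: lerD].
Qed.

(** Neither integral changes when its square is replaced by one large common square of size
    comparable to [T], where their difference is [O(1 / T)] by [inv_close]. *)
Lemma inv_indep p q S : 0 < S -> md (p - q) <= S / 4 -> sqb (fun z => (z - p)^-1) p S = sqb (fun z => (z - q)^-1) q S.
Proof.
move=> S0 pqS.
have hR := le_trans (Re_md _) pqS; have hI := le_trans (Im_md _) pqS.
move: hR hI; rewrite ReB ImB !ler_norml => /andP[r1 r2] /andP[i1 i2].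
apply/eqP; rewrite -subr_eq0; apply/eqP.
have key T : S <= T -> md (sqb (fun z => (z - p)^-1) p S - sqb (fun z => (z - q)^-1) q S) <= 40 * md (p - q) / T.
  move=> ST; have T0 : 0 < T by lra.
  rewrite -(@sqb_frame _ (Re p - 2 * T) (Re p + 2 * T) (Im p - 2 * T) (Im p + 2 * T) p) //; try lra; last by move=> z _ /diff_inv.
  rewrite -(@sqb_frame _ (Re p - 2 * T) (Re p + 2 * T) (Im p - 2 * T) (Im p + 2 * T) q) //; try lra; last by move=> z _ /diff_inv.
  apply: inv_close => //; try lra.
  - by apply: sq_instr; rewrite subrr md0; lra.
  - by apply: sq_instr; rewrite mdC; lra.
  - by move=> z /onbd_far h; have := mdTr z p q; rewrite (mdC q p); split; lra.
apply: (@md_eq0_small _ _ (40 * md (p - q)) (1 / S)) => [|t t0 tS]; first by rewrite divr_gt0.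
have := key t^-1; rewrite invrK; apply.
by rewrite -[S]invrK lef_pV2 ?posrE ?invr_gt0 // ltW // -div1r.
Qed.

Lemma kapE p S : 0 < S -> sqb (fun z => (z - p)^-1) p S = kap.
Proof.
move=> S0; pose T := 1 + S + 4 * md (p - 0).
have T0 : 0 < T by have := md_ge0 (p - 0); rewrite /T; lra.
have -> : sqb (fun z => (z - p)^-1) p S = sqb (fun z => (z - p)^-1) p T.
  apply/esym/sqb_frame => //; rewrite /T; have := md_ge0 (p - 0); try lra.
  by move=> _ z _ zp; exact: diff_inv.
rewrite (@inv_indep p 0) //; last by rewrite /T; lra.
have -> : kap = sqb (fun z => (z - 0)^-1) 0 1.
  by apply: bint_ext => [||z _]; rewrite ?subr0 //=; lra.
apply: sqb_frame => //=; rewrite /T; have := md_ge0 (p - 0); try lra.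
by move=> _ z _ zp; exact: diff_inv.
Qed.

Lemma kap_instr a b c d p : instr a b c d p -> bint (fun z => (z - p)^-1) a b c d = kap.
Proof.
move=> /andP[/andP[h1 h2] /andP[h3 h4]].
pose s := Num.min (Num.min (Re p - a) (b - Re p)) (Num.min (Im p - c) (d - Im p)).
have s0 : 0 < s by rewrite !lt_min !subr_gt0 h1 h2 h3.
have : s <= s by []. rewrite {2}/s !le_min => /andP[/andP[? ?] /andP[? ?]].
rewrite -(kapE p s0); apply: sqb_frame => //; try lra.
by move=> z _ zp; exact: diff_inv.
Qed.

(** Multiplication by [i] permutes the sides of the square, so only the horizontal sides remain,
    each counted twice. With their orientation they contribute an integrand of imaginary part
    [1 / (x ^+ 2 + 1) >= 1 / 2]. *)
Lemma kap_neq0 : kap != 0.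
Proof.
have nz (x y : R) : y != 0 -> Complex x y != 0 by move=> h; rewrite eq_complex /= negb_and h orbT.
have n1 : (1 : R) != 0 by exact: oner_neq0.
have n2 : (-1 : R) != 0 by rewrite oppr_eq0.
have ch (y : R) : y != 0 -> pcont (fun x => (Complex x y)^-1) (-1) 1.
  by move=> y0; apply: (@hcont _ (fun z => z^-1)) => x _; apply: ccontV; [exact: ccont_id | exact: nz].
have vh (x : R) : x != 0 -> x ^+ 2 = 1 -> vedge (fun z => z^-1) x (-1) 1 = hedge (fun z => z^-1) (- x) (-1) 1.
  move=> x0 x2; rewrite /vedge /hedge -cintZ.
    apply: cint_ext => y _; have c1 := nz y (- x) ltac:(by rewrite oppr_eq0).
    have c2 : Complex x y != 0 by rewrite eq_complex /= negb_and x0.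
    apply: (mulIf c1); rewrite mulVf // -mulrA mulrCA -[RHS](mulVf c2); congr (_ * _).
    by apply: complex_eq => /=; ring.
  by apply: (@vcont _ (fun z => z^-1)) => y _; apply: ccontV; [exact: ccont_id | rewrite eq_complex /= negb_and x0].
have kE : kap = 2 * (hedge (fun z => z^-1) (-1) (-1) 1 + -1 * hedge (fun z => z^-1) 1 (-1) 1).
  rewrite /kap /sqb /bint /= !sub0r !add0r !vh ?opprK //; [ring | by rewrite sqrrN expr1n | by rewrite expr1n].
have E (y : R) : y != 0 -> y ^+ 2 = 1 -> 1 <= Im ((- y)%:C%C * hedge (fun z => z^-1) y (-1) 1).
  move=> y0 y2; rewrite /hedge -cintZ; last exact: ch.
  rewrite [leLHS](_ : _ = 2^-1 * (1 - -1)); last by field.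
  apply: cint_Im_ge => [||x hx]; [lra | by apply: pcontZ; exact: ch|].
  rewrite (_ : Im _ = 1 / (x ^+ 2 + 1)); first by rewrite ler_pdivlMr; nra.
  by rewrite /= mul0r addr0 y2 mulrNN mulrA -expr2 y2.
apply/eqP => k0; have k1 : Im kap = 0 by rewrite k0.
have h1 := E 1 n1 (expr1n _ _); have h2 := E (-1) n2 (etrans (sqrrN _) (expr1n _ _)).
rewrite opprK mul1r in h2; rewrite (_ : (-1)%:C%C = -1 :> C) in h1; last by rewrite rmorphN.
have : Im kap = Im (hedge (fun z : C => z^-1) (-1) (-1) 1) * 2 + Im (-1 * hedge (fun z : C => z^-1) 1 (-1) 1) * 2.
  by rewrite kE mulr_natl mulr2n !ImD; ring.
move: h1 h2; rewrite k1; lra.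
Qed.

(** The difference quotient [g] is bounded near [p], so its integral over a square of half-side [s]
    about [p] is [O(s)]; yet it does not depend on [s]. *)
Lemma cauchy_formula f a b c d p : instr a b c d p -> (forall z, inrect a b c d z -> diffat f z) ->
  bint (fun z => f z / (z - p)) a b c d = kap * f p.
Proof.
move=> hp df.
have [ab cd] : a <= b /\ c <= d by case/andP: hp => /andP[? ?] /andP[? ?]; lra.
have hp' : inrect a b c d p by case/andP: hp => /andP[? ?] /andP[? ?]; rewrite /inrect !ltW.
have cq k : econt (fun z => k / (z - p)) a b c d.
  by move=> z /(instr_not hp) /diff_inv /diffat_cont h; apply: ccontM => //; exact: ccont_cst.
pose g z := (f z - f p) / (z - p).
have dg z : inrect a b c d z -> z != p -> diffat g z.
  move=> hz zp; apply: diffatM; last exact: diff_inv.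
  by apply: diffatB; [exact: df | exact: diffat_cst].
have -> : bint (fun z => f z / (z - p)) a b c d = bint g a b c d + f p * kap.
  rewrite -(kap_instr hp) -bintZ //; last first.
    by move=> z /(instr_not hp) /diff_inv /diffat_cont.
  rewrite -bintD //; first by apply: bint_ext => // z _; rewrite /g; ring.
  by move=> z hz; apply: diffat_cont; apply: dg (instr_not hp hz); case: hz.
suff -> : bint g a b c d = 0 by rewrite add0r mulrC.
have [D hD] := df p hp'; have [r r0 hr] := hD 1 ltr01.
pose s0 := Num.min (r / 2) (Num.min (Num.min (Re p - a) (b - Re p)) (Num.min (Im p - c) (d - Im p))).
have s00 : 0 < s0.
  by case/andP: hp => /andP[? ?] /andP[? ?]; rewrite !lt_min !subr_gt0 divr_gt0 //; do !(apply/andP; split).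
apply: (@md_eq0_small _ _ (16 * (1 + md D)) s0) => // s sp.
rewrite !lt_min => /andP[s1 /andP[/andP[s2 s3] /andP[s4 s5]]].
have -> : bint g a b c d = sqb g p s by apply: sqb_frame => //; lra.
have hin z : onbd (Re p - s) (Re p + s) (Im p - s) (Im p + s) z -> inrect a b c d z /\ z != p.
  move=> hz; split; last first.
    have := onbd_far hz; rewrite -subr_eq0 -md_gt0; lra.
  by apply: inrectW hz.1; lra.
apply: sqb_bound => //; first lra.
  by move=> z /hin [hz zp]; apply: diffat_cont; exact: dg.
move=> z hz; have [_ zp] := hin _ hz; rewrite -subr_eq0 -md_gt0 in zp.
rewrite /g mdf ler_pdivrMr //.
have zr : md (z - p) < r by have := sq_near hz.1; lra.
have -> : f z - f p = (f z - f p - D * (z - p)) + D * (z - p) by ring.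
by apply: le_trans (mdD _ _) _; rewrite mdM mulrDl; apply: lerD => //; exact: hr.
Qed.

Definition hol f z := nearby z (diffat f).

Lemma hol_sq f a : hol f a -> exists2 s : R, 0 < s &
  forall z, inrect (Re a - s) (Re a + s) (Im a - s) (Im a + s) z -> diffat f z.
Proof.
by move=> [r r0 h]; exists (r / 3) => [|z /sq_near hz]; [|apply: h]; lra.
Qed.

(** Cauchy's formula with [1 / (w - z) = 1 / (w - a) + (z - a) / ((w - a) * (w - z))] iterated;
    [Rm n] is the remainder. The bound is geometric in [n] with a fixed [K], so no series has to be
    summed. [2 * s] is the half-side [S] of the square. *)
Lemma taylor f a : hol f a -> exists (c : nat -> C) (K s : R), [/\ 0 <= K, 0 < s &
  forall n z, md (z - a) <= s -> md (f z - \sum_(k < n) c k * (z - a) ^+ k) <= K * (md (z - a) / (2 * s)) ^+ n].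
Proof.
move=> /hol_sq [S S0 df].
set x1 := Re a - S in df *; set x2 := Re a + S in df *; set y1 := Im a - S in df *; set y2 := Im a + S in df *.
have x12 : x1 <= x2 by rewrite /x1 /x2; lra.
have y12 : y1 <= y2 by rewrite /y1 /y2; lra.
have cf : econt f x1 x2 y1 y2 by move=> z [hz _]; apply: diffat_cont; exact: df.
have [||m _ hm] := @cpt_max _ _ (fun z => md (f z)) (cpt_rect x1 x2 y1 y2).
- by exists (Complex x1 y1); rewrite /inrect /= !lexx x12 y12.
- move=> z e hz e0; have h : md (f z) < md (f z) + e by lra.
  by apply: nearbyW (ccont_nearby_lt (diffat_cont (df _ hz)) h) => w.
pose M := 1 + md (f m); have M0 : 0 < M by rewrite ltr_pwDl // md_ge0.
have hM z : onbd x1 x2 y1 y2 z -> md (f z) <= M by move=> [/hm h _]; rewrite /M; lra.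
pose c k := kap^-1 * bint (fun w => f w / (w - a) ^+ k.+1) x1 x2 y1 y2.
pose Rm n z := kap^-1 * bint (fun w => f w / ((w - a) ^+ n * (w - z))) x1 x2 y1 y2.
have far z : onbd x1 x2 y1 y2 z -> S <= md (z - a) by exact: onbd_far.
have ha w : onbd x1 x2 y1 y2 w -> w - a != 0 by move=> /far h; rewrite -md_gt0; lra.
have hz z w : md (z - a) <= S / 2 -> onbd x1 x2 y1 y2 w -> S / 2 <= md (w - z).
  by move=> zs /far h; have := mdTr w a z; lra.
have hz0 z w : md (z - a) <= S / 2 -> onbd x1 x2 y1 y2 w -> w - z != 0.
  by move=> zs /(hz _ _ zs) h; rewrite -md_gt0; lra.
have clin p w : ccont (fun w => w - p) w by apply: ccontB; [exact: ccont_id|exact: ccont_cst].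
have cR n z : md (z - a) <= S / 2 -> econt (fun w => f w / ((w - a) ^+ n * (w - z))) x1 x2 y1 y2.
  move=> zs w hw; apply: ccontM; first exact: cf.
  apply: ccontV; first by apply: ccontM => //; exact: ccontX.
  by rewrite mulf_neq0 ?(hz0 _ _ zs hw) // expf_neq0 // ha.
have cc k : econt (fun w => f w / (w - a) ^+ k) x1 x2 y1 y2.
  move=> w hw; apply: ccontM; first exact: cf.
  by apply: ccontV; [exact: ccontX | rewrite expf_neq0 // ha].
have rec n z : md (z - a) <= S / 2 -> Rm n z = c n + (z - a) * Rm n.+1 z.
  move=> zs; rewrite /Rm /c mulrCA -mulrDr -(bintZ x12 y12 (z - a) (cR n.+1 z zs)).
  rewrite -bintD //; last by move=> w hw; apply: ccontM; [exact: ccont_cst | exact: cR].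
  congr (_ * _); apply: bint_ext => // w hw; have wa := ha w hw; have wz := hz0 _ _ zs hw.
  have wan : (w - a) ^+ n != 0 by rewrite expf_neq0.
  by rewrite exprS; field; rewrite wa wz wan.
have R0 z : md (z - a) <= S / 2 -> f z = Rm 0%N z.
  move=> zs; rewrite /Rm (_ : bint _ _ _ _ _ = kap * f z); first by rewrite mulKf // kap_neq0.
  rewrite -(@cauchy_formula f x1 x2 y1 y2) //.
    by apply: bint_ext => // w hw; rewrite expr0 mul1r.
  by apply: sq_instr; lra.
have expd n z : md (z - a) <= S / 2 -> f z - \sum_(k < n) c k * (z - a) ^+ k = (z - a) ^+ n * Rm n z.
  move=> zs; elim: n => [|n ih]; first by rewrite big_ord0 subr0 expr0 mul1r R0.
  by rewrite big_ord_recr /= opprD addrA ih (rec n z zs) exprSr; ring.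
pose K := md kap^-1 * (16 * (M / (S / 2)) * S).
have k0 : 0 < md kap^-1 by rewrite md_gt0 invr_eq0 kap_neq0.
exists c, K, (S / 2); split; first by rewrite /K ltW // !mulr_gt0 // invr_gt0 divr_gt0.
  by rewrite divr_gt0.
move=> n z zs; rewrite expd // mdM mdX.
have -> : 2 * (S / 2) = S by field.
rewrite expr_div_n mulrCA ler_wpM2l ?exprn_ge0 ?md_ge0 //.
rewrite [leRHS](_ : _ = md kap^-1 * (16 * (M / (S / 2)) * S / S ^+ n)); last by rewrite /K !mulrA.
rewrite /Rm mdM ler_wpM2l ?md_ge0 //.
have Sn : 0 < S ^+ n by rewrite exprn_gt0.
have -> : 16 * (M / (S / 2)) * S / S ^+ n = 16 * (M / (S ^+ n * (S / 2))) * S.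
  by field; rewrite !gt_eqF.
rewrite -[bint _ _ _ _ _]/(sqb _ a S); apply: sqb_bound; [exact: ltW | exact: cR |] => w hw.
rewrite mdf; apply: ler_pM; rewrite ?md_ge0 ?invr_ge0 ?md_ge0 //; first exact: hM.
have S2 : 0 < S / 2 by rewrite divr_gt0.
rewrite lef_pV2 ?posrE ?(mulr_gt0 Sn S2) ?md_gt0 ?mulf_neq0 ?expf_neq0 ?ha ?(hz0 _ _ zs hw) // mdM mdX.
apply: ler_pM; rewrite ?exprn_ge0 ?divr_ge0 ?(ltW S0) //; last exact: hz.
by apply: lerXn2r; rewrite ?nnegrE ?md_ge0 ?(ltW S0) // far.
Qed.
End Cauchy.

(** * Local structure of holomorphic functions *)
Section Local.
Variable R : realType.
Local Notation C := R[i].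
Implicit Types (f g : C -> C) (z w a : C).

Lemma hol_diff f z : hol f z -> diffat f z. Proof. exact: nearby_self. Qed.
Lemma hol_cont f z : hol f z -> ccont f z. Proof. by move/hol_diff/diffat_cont. Qed.
Lemma hol_cst c z : hol (fun=> c) z. Proof. by apply: nearbyT => w; exact: diffat_cst. Qed.
Lemma hol_id z : hol (fun w => w) z. Proof. by apply: nearbyT => w; exact: diffat_id. Qed.
Lemma holB f g z : hol f z -> hol g z -> hol (fun w => f w - g w) z.
Proof. by move=> hf hg; apply: nearbyW (nearby_and hf hg) => w []; exact: diffatB. Qed.
Lemma holM f g z : hol f z -> hol g z -> hol (fun w => f w * g w) z.
Proof. by move=> hf hg; apply: nearbyW (nearby_and hf hg) => w []; exact: diffatM. Qed.
Lemma holV f z : hol f z -> f z != 0 -> hol (fun w => (f w)^-1) z.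
Proof.
move=> hf f0; apply: nearbyW (nearby_and hf (ccontN0 (hol_cont hf) f0)) => w [dw [w0 _]].
exact: diffatV.
Qed.
(** The basic tool for zeros. The identity is global, so dividing an entire function gives an entire
    one. At [a] itself differentiability of the quotient comes from the third order [taylor]
    bound. *)
Lemma hol_div f a : hol f a -> exists g, (forall z, f z = f a + (z - a) * g z) /\
  forall z, hol f z -> hol g z.
Proof.
move=> hf; have [c [K [s [K0 s0 hT]]]] := taylor hf.
have c0 : c 0%N = f a.
  have h : md (a - a) <= s by rewrite subrr md0 ltW.
  have := hT 1%N a h; rewrite big_ord1 subrr md0 mul0r expr1 mulr0 expr0 mulr1 => h1.
  by apply/eqP; rewrite eq_sym -subr_eq0 -md_eq0 eq_le h1 md_ge0.
pose g z := if z == a then c 1%N else (f z - f a) / (z - a).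
have gE z : f z = f a + (z - a) * g z.
  rewrite /g; case: eqVneq => [->|za]; first by rewrite subrr mul0r addr0.
  by rewrite mulrC divfK ?subr_eq0 // addrC subrK.
have ga : g a = c 1%N by rewrite /g eqxx.
have dg : diffat g a.
  exists (c 2%N) => e e0; pose k := K / (2 * s) ^+ 3.
  have k0 : 0 <= k by rewrite divr_ge0 // exprn_ge0 // mulr_ge0 // ltW.
  exists (Num.min s (e / (1 + k))) => [|z].
    by rewrite lt_min s0 divr_gt0 // ltr_pwDl.
  rewrite lt_min ltr_pdivlMr ?ltr_pwDl // => /andP[zs ze].
  have [->|za] := eqVneq z a; first by rewrite !subrr mulr0 subr0 md0 mulr0.
  have m0 : 0 < md (z - a) by rewrite md_gt0 subr_eq0.
  have := hT 3%N z (ltW zs); rewrite !big_ord_recr big_ord0 /= add0r expr0 expr1 mulr1 c0 gE.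
  rewrite (_ : _ - _ = (z - a) * (g z - g a - c 2%N * (z - a))); last by rewrite ga; ring.
  rewrite mdM expr_div_n mulrCA -/k (exprS _ 2) -mulrA ler_pM2l // => h.
  apply: le_trans h _; rewrite expr2 -mulrA mulrC ler_wpM2r ?md_ge0 //.
  by nra.
exists g; split=> // z hz.
have [za|za] := eqVneq z a; last first.
  apply: nearbyW (nearby_and hz (nearby_neq za)) => w [dw wa].
  apply: (@diffat_ext _ (fun w => (f w - f a) / (w - a))).
    by apply: nearbyW (nearby_neq wa) => u ua; rewrite /g (negbTE ua).
  apply: diffatM; last exact: diff_inv.
  by apply: diffatB => //; exact: diffat_cst.
rewrite za in hz *; apply: nearbyW hz => w dw; have [->//|wa] := eqVneq w a.
apply: (@diffat_ext _ (fun w => (f w - f a) / (w - a))).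
  by apply: nearbyW (nearby_neq wa) => u ua; rewrite /g (negbTE ua).
apply: diffatM; last exact: diff_inv.
by apply: diffatB => //; exact: diffat_cst.
Qed.

(** Division by [z - a] either stops, which gives the order of the zero, or goes on for ever. Then
    all Taylor coefficients vanish, and the remainder, at most [K / 2 ^ n] within distance [s],
    forces [f = 0] there. *)
Lemma hol_order f a : hol f a -> nearby a (fun z => f z = 0) \/
  exists k g, [/\ forall z, f z = (z - a) ^+ k * g z, g a != 0 & forall z, hol f z -> hol g z].
Proof.
move=> hf.
pose P k := exists g, (forall z, f z = (z - a) ^+ k * g z) /\ (forall z, hol f z -> hol g z).
have [[k [[g [fg hg]] nP]]|allP] := pselect (exists k, P k /\ ~ P k.+1).
  right; exists k, g; split=> //; apply/eqP => g0; apply: nP.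
  have [q [gq hq]] := hol_div (hg _ hf).
  exists q; split; last by move=> z /hg /hq.
  by move=> z; rewrite fg gq g0 add0r exprSr mulrA.
left; have {}allP k : P k.
  elim: k => [|k ih]; first by exists f; split=> // z; rewrite expr0 mul1r.
  by apply: contrapT => h; apply: allP; exists k.
have [c [K [s [K0 s0 hT]]]] := taylor hf.
(* At distance [t], [f] is [O(t ^ (k + 1))], while its Taylor expansion starts with [c k] times the
   [k]-th power, the lower coefficients vanishing by induction. *)
have c0 k : c k = 0.
  elim/ltn_ind: k => k ih; have [g [fg hg]] := allP k.+1.
  have [r r0 hr] := hol_cont (hg _ hf) ltr01.
  pose B := K / (2 * s) ^+ k.+1 + (1 + md (g a)).
  apply: (@md_eq0_small _ _ B (Num.min s r)) => [|t t0]; first by rewrite lt_min s0.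
  rewrite lt_min => /andP[ts tr].
  have za : md (a + t%:C%C - a) = t by rewrite addrC addKr mdr ger0_norm // ltW.
  have := hT k.+1 (a + t%:C%C); rewrite za => /(_ (ltW ts)).
  rewrite big_ord_recr /= big1 ?add0r => [|i _]; last by rewrite ih ?mul0r.
  have := hr (a + t%:C%C); rewrite za => /(_ tr) h1 h2.
  have gb : md (g (a + t%:C%C)) <= 1 + md (g a).
    by have := mdBr (g (a + t%:C%C)) (g a); lra.
  rewrite -(ler_pM2r (exprn_gt0 k t0)).
  have -> : md (c k) * t ^+ k = md (c k * (a + t%:C%C - a) ^+ k) by rewrite mdM mdX za.
  have := mdTr (c k * (a + t%:C%C - a) ^+ k) 0 (f (a + t%:C%C)); rewrite !subr0.
  rewrite mdC => h3; apply: le_trans h3 _.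
  have -> : B * t * t ^+ k = K * (t / (2 * s)) ^+ k.+1 + t ^+ k.+1 * (1 + md (g a)).
    by rewrite /B expr_div_n (exprS t); ring.
  by apply: lerD => //; rewrite fg mdM mdX za ler_wpM2l // exprn_ge0 // ltW.
exists s => // z zs; apply: (@md_eq0_small _ _ K 1 ltr01) => e e0 _.
have [n hn] := halving 1 e0.
have := hT n z (ltW zs); rewrite big1 ?subr0 => [|i _]; last by rewrite c0 mul0r.
move=> h; apply: le_trans h _; rewrite ler_wpM2l //; apply: le_trans (ltW hn).
rewrite div1r -exprVn; apply: lerXn2r; rewrite ?nnegrE ?divr_ge0 ?md_ge0 ?invr_ge0 ?mulr_ge0 ?(ltW s0) //.
by rewrite ler_pdivrMr ?mulr_gt0 // mulKf // ltW.
Qed.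

(** If [f z - f a = (z - a) ^+ k * g z] with [g a != 0], then in the direction [om] with
    [om ^+ k = f a / g a] the value is about [f a * (1 + t ^+ k)], larger in modulus. As [g] varies
    by less than half of [|g a|], half of the gain survives. *)
Lemma local_max_const f a : hol f a -> nearby a (fun z => md (f z) <= md (f a)) ->
  nearby a (fun z => f z = f a).
Proof.
move=> hf hm; have [fa0|fa0] := eqVneq (f a) 0.
  apply: nearbyW hm => z; rewrite fa0 md0 => h; apply/eqP.
  by rewrite -md_eq0 eq_le h md_ge0.
have [h|[k [g [fg ga hg]]]] := hol_order (holB hf (hol_cst (f a) a)).
  by apply: nearbyW h => z /eqP; rewrite subr_eq0 => /eqP.
exfalso.
have k0 : (0 < k)%N.
  rewrite lt0n; apply/eqP => k0; have := fg a.
  by rewrite subrr k0 expr0 mul1r => /esym/eqP; rewrite (negbTE ga).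
pose om : C := k.-root (f a / g a).
have omk : om ^+ k = f a / g a by rewrite rootCK.
have hga : hol g a by apply: hg; exact: holB hf (hol_cst _ _).
have ga2 : 0 < md (g a) / 2 by rewrite divr_gt0 // md_gt0.
have [r r0 hr] := nearby_and hm (hol_cont hga ga2).
pose t := r / (2 * (1 + md om)).
have o0 : 0 < 1 + md om by rewrite ltr_pwDl // md_ge0.
have t0 : 0 < t by rewrite divr_gt0 // mulr_gt0.
have [|h1 h2] := hr (a + t%:C%C * om).
  rewrite addrC addKr mdM mdr ger0_norm ?ltW //.
  have h : t * (2 * (1 + md om)) = r by rewrite /t divfK // gt_eqF // mulr_gt0.
  by have := md_ge0 om; nra.
have E := fg (a + t%:C%C * om).
have {}E : f (a + t%:C%C * om) = f a * (1 + (t ^+ k)%:C%C) + f a * (t ^+ k)%:C%C * ((g (a + t%:C%C * om) - g a) / g a).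
  rewrite -[LHS](subrK (f a)) E addrC; have -> : a + t%:C%C * om - a = t%:C%C * om by ring.
  by rewrite exprMn omk rmorphXn /=; field.
have fp : 0 < md (f a) by rewrite md_gt0.
have tk : 0 < t ^+ k by rewrite exprn_gt0.
have m1 : md (1 + (t ^+ k)%:C%C : C) = 1 + t ^+ k.
  by rewrite -[1]/(1%:C%C) -rmorphD mdr ger0_norm // addr_ge0 // ltW.
have h3 : md ((g (a + t%:C%C * om) - g a) / g a) <= 1 / 2.
  by rewrite mdf ler_pdivrMr ?md_gt0 //; lra.
have := mdDr (f a * (1 + (t ^+ k)%:C%C)) (f a * (t ^+ k)%:C%C * ((g (a + t%:C%C * om) - g a) / g a)).
rewrite -E !mdM m1 mdr ger0_norm ?(ltW tk) // => h4.
have : md (f a) * t ^+ k * md ((g (a + t%:C%C * om) - g a) / g a) <= md (f a) * t ^+ k * (1 / 2).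
  by rewrite ler_wpM2l // mulr_ge0 // ltW.
by rewrite mdM; set X := md (g _ - _) * md _ in h4 *; nra.
Qed.

(* At the rightmost point of [S] the function is locally constant, which pushes [S] further right. *)
Lemma no_local_max f (S : C -> Prop) : cpt S -> (exists z, S z) -> (forall p, S p -> hol f p) ->
  (forall p, S p -> nearby p (fun z => md (f z) <= md (f p))) ->
  (forall p, S p -> nearby p (fun z => md (f z) = md (f p) -> S z)) -> False.
Proof.
move=> cS neS hf hm hS.
have [|p Sp hp] := cpt_max (g := @complex.Re R) cS neS.
  move=> z e _ e0; apply: nearbyW (nearby_lt z e0) => w hw _.
  by have := Re_md (w - z); rewrite ReB => h; have := ler_norm (Re w - Re z); lra.
have [r r0 hr] := nearby_and (local_max_const (hf _ Sp) (hm _ Sp)) (hS _ Sp).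
have [|h1 h2] := hr (p + (r / 2)%:C%C).
  by rewrite addrC addKr mdr ger0_norm; lra.
have := hp _ (h2 _); rewrite h1 => /(_ erefl); rewrite ReD /=; lra.
Qed.
End Local.

(** * Entire functions: maximum principle, derivatives, Liouville, zeros *)

Section Entire.
Variable R : realType.
Local Notation C := R[i].
Implicit Types (f g : C -> C) (z w a : C).

(** Neither boundary nor connectedness enters: near each of its points, [S] must contain the points
    where [|f|] is at least as large. The maximum points of [|f|] on [S] then fall under
    [no_local_max]. *)
Lemma max_principle (f : C -> C) (S : C -> Prop) : cpt S -> (exists z, S z) -> (forall p, S p -> hol f p) ->
  (forall p, S p -> nearby p (fun z => md (f p) <= md (f z) -> S z)) -> False.
Proof.
move=> cS neS hf hS; have [bS clS] := cS.
have [|p Sp pmax] := @cpt_max R S (fun z => md (f z)) cS neS.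
  move=> z e Sz e0; have h : md (f z) < md (f z) + e by lra.
  by apply: nearbyW (ccont_nearby_lt (hol_cont (hf _ Sz)) h) => w.
have up q : S q -> md (f q) = md (f p) -> nearby q (fun z => md (f z) <= md (f q)).
  move=> Sq ->; apply: nearbyW (hS _ Sq) => w hw.
  by have [h|/ltW h] := leP (md (f q)) (md (f w)); [exact: pmax (hw h) | apply: le_trans h (pmax _ Sq)].
apply: (@no_local_max R f (fun z => S z /\ md (f z) = md (f p))).
- split; first by case: bS => M hM; exists M => z [/hM].
  move=> z h; have [Sz|/clS] := pselect (S z); last by apply: nearbyW => w nS [].
  have lt : md (f z) < md (f p).
    by rewrite lt_neqAle pmax // andbT; apply/eqP => e; apply: h.
  by apply: nearbyW (ccont_nearby_lt (hol_cont (hf _ Sz)) lt) => w hw [_ e]; rewrite e ltxx in hw.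
- by exists p.
- by move=> q [/hf].
- by move=> q [Sq e]; exact: up.
- move=> q [Sq e]; apply: nearbyW (hS _ Sq) => w hw ew; split; last by rewrite ew.
  by apply: hw; rewrite ew.
Qed.

Definition entire f := forall z, diffat f z.
Lemma entire_hol f z : entire f -> hol f z. Proof. by move=> ef; exact: nearbyT. Qed.
Lemma hol_entire f : (forall z, hol f z) -> entire f. Proof. by move=> h z; exact: hol_diff. Qed.
Lemma entire_cont f z : entire f -> ccont f z. Proof. by move=> /(_ z)/diffat_cont. Qed.
Lemma entire_div f a : entire f -> exists2 g, entire g & forall z, f z = f a + (z - a) * g z.
Proof.
move=> ef; have [g [fg hg]] := hol_div (entire_hol a ef); exists g => //.
by apply: hol_entire => z; apply: hg; exact: entire_hol.
Qed.

Lemma cpt_disk a (M : R) : cpt (fun z : C => md (z - a) <= M).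
Proof.
split; first by exists (M + md a) => z zM; have := mdBr z a; lra.
by apply: clo_sublevel => z; apply: ccontB; [exact: ccont_id | exact: ccont_cst].
Qed.

Lemma deriv_div f g c z a d d' : (forall w, f w = c + (w - a) * g w) -> cdiff f z d -> cdiff g z d' ->
  d = g z + (z - a) * d'.
Proof.
move=> fg hf hg; apply: (cdiff_uniq hf).
have := cdiffD (cdiff_cst c z) (cdiffM (cdiffB (cdiff_id z) (cdiff_cst a z)) hg).
by rewrite add0r subr0 mul1r; apply: cdiff_ext; apply: nearbyT => w; rewrite -fg.
Qed.

(* Maximum principle for the difference quotients [(h w - h z) / (w - z)], which take the value [dh z] at [z]. *)
Lemma deriv_bounded h dh a : entire h -> (forall z, cdiff h z (dh z)) ->
  exists2 K, 0 < K & nearby a (fun z => md (dh z) <= K).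
Proof.
move=> eh dhE.
have [||m _ hm] := @cpt_max R _ (fun z => md (h z)) (cpt_disk a 1).
- by exists a; rewrite subrr md0.
- move=> z e _ e0; have hz : md (h z) < md (h z) + e by lra.
  by apply: nearbyW (ccont_nearby_lt (entire_cont z eh) hz) => w.
set M := md (h m) in hm; have M0 : 0 <= M := md_ge0 _.
(* For [|z - a| < 1 / 2] and [|w - a| = 1] the quotient is at most [2 * M / (1 / 2)]. *)
exists (4 * M + 1); first lra; exists (1 / 2) => [|z za]; first lra.
have [q eq hq] := entire_div z eh.
have cw b w : ccont (fun w => w - b) w by apply: ccontB; [exact: ccont_id | exact: ccont_cst].
have -> : dh z = q z.
  by have [dq dqE] := eq z; rewrite (deriv_div hq (dhE z) dqE) subrr mul0r addr0.
rewrite leNgt; apply/negP => big.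
apply: (@max_principle q (fun w => md (w - a) <= 1 /\ md (q z) <= md (q w))).
- apply: cptI; first exact: cpt_disk.
  by apply: clo_superlevel => w; exact: entire_cont.
- by exists z; split=> //; lra.
- by move=> p _; exact: entire_hol.
- move=> p [p1 pq]; have pa : md (p - a) < 1.
    rewrite lt_neqAle p1 andbT; apply/eqP => pa; have := mdTr p a z; rewrite pa => h1.
    have : md (p - z) * md (q p) <= 2 * M.
      rewrite -mdM (_ : (p - z) * q p = h p - h z); last by rewrite (hq p); ring.
      by apply: le_trans (mdB _ _) _; have := hm p p1; have := hm z; lra.
    have : 1 / 2 * md (q p) <= md (p - z) * md (q p) by rewrite ler_wpM2r ?md_ge0 //; lra.
    lra.
  by apply: nearbyW (ccont_nearby_lt (cw a p) pa) => w /ltW wa pw; split=> //; exact: le_trans pw.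
Qed.

(** From [dh z = g z + (z - a) * dg z], where [dg] is bounded near [a]. *)
Lemma deriv_cont h dh a : entire h -> (forall z, cdiff h z (dh z)) -> ccont dh a.
Proof.
move=> eh dhE e e0; have [g eg hg] := entire_div a eh; have [dg dgE] := choice eg.
have dE z := deriv_div hg (dhE z) (dgE z).
have [K K0 hK] := deriv_bounded a eg dgE.
have e2 : 0 < e / 2 by lra.
have r0 : 0 < e / 2 / K by rewrite divr_gt0.
apply: nearbyW (nearby_and (nearby_and hK (@nearby_lt R a _ r0)) (entire_cont a eg e2)) => z [[h1 h2] h3].
rewrite !dE subrr mul0r addr0 addrAC; apply: le_lt_trans (mdD _ _) _; rewrite mdM.
have : md (z - a) * md (dg z) <= md (z - a) * K by rewrite ler_wpM2l ?md_ge0.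
by rewrite ltr_pdivlMr // in h2; lra.
Qed.

(** In [df z = g z + (z - a) * dg z] both summands have derivative [dg a] at [a], the second because
    [dg] is continuous; hence the witness [dg a + dg a]. *)
Lemma entire_deriv f : entire f -> exists2 df, entire df & forall z, cdiff f z (df z).
Proof.
move=> ef; have [df dfE] := choice ef; exists df => // a.
have [g eg hg] := entire_div a ef; have [dg dgE] := choice eg.
have dE z := deriv_div hg (dfE z) (dgE z).
exists (dg a + dg a) => e e0; have e2 : 0 < e / 2 by lra.
apply: nearbyW (nearby_and (dgE a _ e2) (@deriv_cont g dg a eg dgE _ e2)) => z [h1 h2].
rewrite !dE subrr mul0r addr0 (_ : _ - _ - _ = (g z - g a - dg a * (z - a)) + (dg z - dg a) * (z - a)); last by ring.
apply: le_trans (mdD _ _) _; rewrite mdM.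
have : md (dg z - dg a) * md (z - a) <= e / 2 * md (z - a) by rewrite ler_wpM2r ?md_ge0 // ltW.
lra.
Qed.

Lemma cpt_ball (M : R) : cpt (fun z : C => md z <= M).
Proof. by split; [exists M | apply: clo_sublevel => z; exact: ccont_id]. Qed.

(** If [f a != 0], smallness far out makes [|f|] attain a global maximum, and only on a compact set;
    [no_local_max] excludes this. *)
Lemma liouville0 f : entire f ->
  (forall e : R, 0 < e -> exists M : R, forall z, M < md z -> md (f z) < e) -> forall z, f z = 0.
Proof.
move=> ef h a; apply/eqP; apply/negPn/negP => fa; rewrite -md_gt0 in fa.
have [M hM] := h _ fa.
have [||p Sp hp] := cpt_max (g := fun z => md (f z)) (cpt_ball (Num.max M (md a))).
- by exists a; rewrite le_max lexx orbT.
- move=> z e _ e0; apply: nearbyW (entire_cont z ef e0) => w hw _.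
  by have := mdBr (f w) (f z); lra.
have ha : md (f a) <= md (f p) by apply: hp; rewrite le_max lexx orbT.
have gm z : md (f z) <= md (f p).
  have [/hp//|] := leP (md z) (Num.max M (md a)).
  rewrite gt_max => /andP[/hM hz _]; exact: le_trans (ltW hz) ha.
apply: (@no_local_max _ f (fun z => md (f z) = md (f p))).
- split.
    exists M => z hz; rewrite leNgt; apply/negP => /hM; rewrite hz; lra.
  move=> z; have := gm z; rewrite le_eqVlt => /orP[/eqP //|hz] _.
  by apply: nearbyW (ccont_nearby_lt (entire_cont z ef) hz) => w hw he; rewrite he ltxx in hw.
- by exists p.
- by move=> q _; exact: entire_hol.
- by move=> q hq; apply: nearbyT => z; rewrite hq.
- by move=> q hq; apply: nearbyT => z; rewrite hq.
Qed.

Lemma poly_growth f n (K : R) : entire f -> (forall z, 1 <= md z -> md (f z) <= K * md z ^+ n) ->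
  exists p : {poly C}, forall z, f z = p.[z].
Proof.
elim: n f K => [|n ih] f K ef hK; have [g eg fg] := entire_div 0 ef.
  have g0 : forall z, g z = 0.
    apply: liouville0 => // e e0; exists (Num.max 1 ((K + md (f 0)) / e)) => z.
    rewrite gt_max ltr_pdivrMr // => /andP[z1 ze].
    have := hK z (ltW z1); rewrite expr0 mulr1 => h.
    have : md (z * g z) <= K + md (f 0).
      have -> : z * g z = f z - f 0 by rewrite (fg z) subr0; ring.
      by apply: le_trans (mdB _ _) _; lra.
    rewrite mdM => h2; have z0 : 0 < md z by lra.
    by rewrite -(ltr_pM2l z0); apply: le_lt_trans h2 _.
  by exists (f 0)%:P => z; rewrite fg g0 mulr0 addr0 hornerC.
have [|p hp] := ih g (K + md (f 0)) eg.
  move=> z z1; have z0 : 0 < md z by lra.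
  rewrite -(ler_pM2l z0) -mdM.
  have -> : z * g z = f z - f 0 by rewrite (fg z) subr0; ring.
  apply: le_trans (mdB _ _) _; have := hK z z1; rewrite exprS => h.
  have : md (f 0) <= md (f 0) * (md z * md z ^+ n).
    by rewrite -exprS ler_peMr ?md_ge0 // exprn_ege1.
  by nra.
by exists ((f 0)%:P + 'X * p) => z; rewrite fg hp subr0 hornerD hornerM hornerX hornerC.
Qed.

(** Identity theorem: [Z], which tells whether [f] vanishes near a point, is locally constant, hence
    constant on a rectangle containing [a] and a point where [f] is not 0. *)
Lemma entire_order f a : entire f -> (exists z, f z != 0) ->
  exists k g, [/\ forall z, f z = (z - a) ^+ k * g z, entire g & g a != 0].
Proof.
move=> ef [b fb]; have [h|[k [g [fg ga hg]]]] := hol_order (entire_hol a ef); last first.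
  by exists k, g; split=> //; apply: hol_entire => z; apply: hg; exact: entire_hol.
exfalso.
pose Z z := `[< nearby z (fun w => f w = 0) >].
have loc z : nearby z (fun w => Z w = Z z).
  have [hz|[k [g [fg ga hg]]]] := hol_order (entire_hol z ef).
    apply: nearbyW (nearby_nearby hz) => w hw.
    by rewrite /Z !asboolT.
  have gz := ccontN0 (hol_cont (hg _ (entire_hol z ef))) ga.
  have Zz : Z z = false.
    apply: asboolF => hz; have [r r0 hr] := nearby_and hz gz.
    have [|h1 [h2 _]] := hr (z + (r / 2)%:C%C).
      by rewrite addrC addKr mdr ger0_norm; lra.
    move: h1; rewrite fg addrC addKr => /eqP; rewrite mulf_eq0 (negbTE h2) orbF expf_eq0 => /andP[_].
    by rewrite -md_eq0 mdr normr_eq0 => /eqP h3; lra.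
  rewrite Zz; apply: nearbyW gz => w [gw _]; apply/negbTE/negP => /asboolP hw.
  have [wz|wz] := eqVneq w z; first by move: Zz; rewrite /Z asboolT // -wz.
  have := nearby_self hw; rewrite fg => /eqP; rewrite mulf_eq0 (negbTE gw) orbF expf_eq0 subr_eq0 (negbTE wz) andbF.
  by [].
have inb w : md w <= md a + md b -> inrect (- (md a + md b)) (md a + md b) (- (md a + md b)) (md a + md b) w.
  move=> hw; have := le_trans (Re_md w) hw; have := le_trans (Im_md w) hw.
  by rewrite /inrect !ler_norml => -> ->.
have : Z a = Z b.
  apply: (@rect_const _ _ Z (- (md a + md b)) (md a + md b) (- (md a + md b)) (md a + md b)).
  - by move=> z _; apply: nearbyW (loc z).
  - by apply: inb; rewrite lerDl md_ge0.
  - by apply: inb; rewrite lerDr md_ge0.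
rewrite /Z (asboolT h) => /esym /asboolP /nearby_self /eqP; by rewrite (negbTE fb).
Qed.

(** Zeros are isolated, so finitely many disks, each with at most its centre as a zero, cover [X].
    The centres in [X] are divided out to full order; [t] lists zeros with multiplicity. *)
Lemma entire_factor f (X : C -> Prop) : entire f -> (exists z, f z != 0) -> bdd X ->
  exists (t : seq C) u, [/\ entire u, forall z, f z = (\prod_(a <- t) (z - a)) * u z,
    forall z, X z -> u z != 0 & forall a, a \in t -> X a /\ f a = 0].
Proof.
move=> ef fn0 bX.
have H a : exists r : R, 0 < r /\ forall z, md (z - a) < r -> f z = 0 -> z = a.
  have [k [g [fg eg ga]]] := entire_order a ef fn0.
  have [r r0 hr] := ccontN0 (entire_cont a eg) ga.
  exists r; split=> // z /hr [gz _]; rewrite fg => /eqP.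
  by rewrite mulf_eq0 (negbTE gz) orbF expf_eq0 subr_eq0 => /andP[_ /eqP].
have [r hr] := choice H.
have [|s hs] := @finite_cover _ X r bX; first by move=> z; case: (hr z).
pose s' := [seq a <- s | `[< X a >]].
have hs' z : X z -> f z = 0 -> z \in s'.
  move=> Xz fz; have [a as_ ha] := hs _ Xz; have [_ /(_ z ha fz) za] := hr a.
  by rewrite mem_filter za as_ andbT; apply/asboolP; rewrite -za.
have sX a : a \in s' -> X a by rewrite mem_filter => /andP[/asboolP].
suff [t [u [eu fu us ht]]] : exists (t : seq C) u, [/\ entire u, forall z, f z = (\prod_(a <- t) (z - a)) * u z,
    forall a, a \in s' -> u a != 0 & forall a, a \in t -> X a /\ f a = 0].
  exists t, u; split=> // z Xz; apply/eqP => uz.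
  by have := us z (hs' z Xz _); rewrite fu uz mulr0 => /(_ erefl); rewrite eqxx.
elim: s' sX {hs' hs} => [_|a s' ih sX].
  by exists [::], f; split=> // z; rewrite big_nil mul1r.
have [|t [u [eu fu us ht]]] := ih; first by move=> b hb; apply: sX; rewrite inE hb orbT.
have un0 : exists z, u z != 0.
  case: fn0 => z fz; exists z; apply: contraNneq fz => uz; by rewrite fu uz mulr0.
have [k [v [uv ev va]]] := entire_order a eu un0.
exists (nseq k a ++ t), v; split=> //.
- move=> z; rewrite big_cat /= big_nseq iter_mulr_1 fu uv; ring.
- move=> b; rewrite inE => /orP[/eqP ->//|/us]; rewrite uv; apply: contraNneq => ->; by rewrite mulr0.
- move=> b; rewrite mem_cat mem_nseq => /orP[/andP[k0 /eqP ->]|/ht//]; split; first by apply: sX; rewrite inE eqxx.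
  by rewrite fu uv subrr expr0n (gtn_eqF k0) mul0r mulr0.
Qed.
End Entire.

(** * Contours and residues *)
Section Contour.
Variable R : realType.
Local Notation C := R[i].
Implicit Types (f g : C -> C) (z w a : C).

Lemma md_sum (T : finType) (F : T -> C) (M : R) : (forall t, md (F t) <= M) -> md (\sum_t F t) <= M * #|T|%:R.
Proof.
move=> h; rewrite cardT -sum1_size big_enum natr_sum mulr_sumr /=.
elim/big_ind2: _ => [|x X y Y hx hy|t _]; first by rewrite md0.
  by apply: le_trans (mdD _ _) _; exact: lerD.
by rewrite mulr1.
Qed.

Lemma clo_fin (T : finType) (P : T -> C -> Prop) : (forall t, clo (P t)) -> clo (fun z => exists t, P t z).
Proof.
move=> cP z hz.
suff H (s : seq T) : nearby z (fun w => forall t, t \in s -> ~ P t w).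
  by apply: nearbyW (H (enum T)) => w hw [t]; apply: hw; rewrite mem_enum.
elim: s => [|t s ih]; first exact: nearbyT.
have nt : ~ P t z by move=> h; apply: hz; exists t.
apply: nearbyW (nearby_and ih (cP t z nt)) => w [h1 h2] u; rewrite inE => /orP[/eqP ->//|]; exact: h1.
Qed.

(* [B] is the normalised integral over the boundary of a union [N] of grid squares around [L];
   [Gam] is that boundary. *)
Record contour_for (L : C -> Prop) (eta : R) (N Gam : C -> Prop) (B : (C -> C) -> C) := ContourFor {
  ctL : forall z, L z -> N z;
  ctN : forall z, N z -> exists2 w, L w & md (z - w) < eta;
  ctG : forall z, Gam z -> N z /\ ~ L z;
  ctGcpt : cpt Gam;
  ctD : forall f g, (forall z, Gam z -> ccont f z) -> (forall z, Gam z -> ccont g z) ->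
     B (fun z => f z + g z) = B f + B g;
  ctZ : forall c f, (forall z, Gam z -> ccont f z) -> B (fun z => c * f z) = c * B f;
  ctbound : exists2 K : R, 0 <= K & forall f M, 0 <= M -> (forall z, Gam z -> ccont f z) ->
     (forall z, Gam z -> md (f z) <= M) -> md (B f) <= K * M;
  ctcauchy : forall f, (forall z, N z -> diffat f z) -> B f = 0;
  ctpole : forall a, N a -> ~ Gam a -> B (fun z => (z - a)^-1) = 1 }.

Section Grid.
Variables (L : C -> Prop) (eta M dl x0 : R) (n : nat).

Definition gX (i : nat) : R := x0 + i%:R * dl.
Definition gsq i j z := inrect (gX i) (gX i.+1) (gX j) (gX j.+1) z.
Definition gsel i j : bool := `[< exists z, gsq i j z /\ L z >].
Definition gN z := exists i j, gsel i j /\ gsq i j z.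
Definition gH f i j := hedge f (gX j) (gX i) (gX i.+1).
Definition gV f i j := vedge f (gX i) (gX j) (gX j.+1).
Definition gsg i j : C := (gsel i j)%:R.
(** An edge is weighted by the difference of the indicators of the two squares it separates. Edges
    between two selected squares get weight 0, so the integrand need not even be continuous
    there. *)
Definition gterm f (t : bool * ('I_n * 'I_n)) : C :=
  if t.1 then (gsg t.2.1 t.2.2.+1 - gsg t.2.1 t.2.2) * gH f t.2.1 t.2.2.+1
  else (gsg t.2.1 t.2.2 - gsg t.2.1.+1 t.2.2) * gV f t.2.1.+1 t.2.2.
Definition gP (t : bool * ('I_n * 'I_n)) z :=
  if t.1 then gsel t.2.1 t.2.2.+1 != gsel t.2.1 t.2.2 /\ inrect (gX t.2.1) (gX t.2.1.+1) (gX t.2.2.+1) (gX t.2.2.+1) z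
  else gsel t.2.1.+1 t.2.2 != gsel t.2.1 t.2.2 /\ inrect (gX t.2.1.+1) (gX t.2.1.+1) (gX t.2.2) (gX t.2.2.+1) z.
Definition gGam z := exists t, gP t z.
Definition gB f := (@kap R)^-1 * \sum_t gterm f t.

Hypotheses (cL : cpt L) (M0 : 0 <= M) (hM : forall z, L z -> md z <= M).
Hypotheses (dl0 : 0 < dl) (dle : 2 * dl < eta) (x0E : x0 = - M - 2 * dl) (Xn : M + 3 * dl < gX n).

Let XS i : gX i.+1 = gX i + dl. Proof. by rewrite /gX mulrSr mulrDl mul1r addrA. Qed.
Let Xle i : gX i <= gX i.+1. Proof. by rewrite XS lerDl ltW. Qed.
Let Xmono i j : (i <= j)%N -> gX i <= gX j.
Proof. by move=> ij; rewrite /gX lerD2l ler_wpM2r ?ler_nat // ltW. Qed.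
Let X0 : gX 0%N = x0. Proof. by rewrite /gX mul0r addr0. Qed.

(** The grid keeps a margin of unselected squares, which makes the end terms in [abel] vanish. *)
Let sel_range i j : gsel i j -> (0 < i < n)%N && (0 < j < n)%N.
Proof.
move=> /asboolP [z [/andP[/andP[z1 z2] /andP[z3 z4]] /hM hz]].
have := le_trans (Re_md _) hz; have := le_trans (Im_md _) hz.
rewrite !ler_norml => /andP[i1 i2] /andP[r1 r2].
have hn := Xn; have h0 := dl0; have hx := x0E; have hm0 := M0.
have pos k (w : R) : - M <= w -> w <= gX k.+1 -> (0 < k)%N.
  by case: k => // h1; rewrite XS X0 => h2; lra.
have lt k (w : R) : w <= M -> gX k <= w -> (k < n)%N.
  by move=> h1 h2; rewrite ltnNge; apply/negP => /Xmono; lra.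
by rewrite (pos _ _ r1 z2) (pos _ _ i1 z4) (lt _ _ r2 z1) (lt _ _ i2 z3).
Qed.
Let sel_out i j : (i == 0%N) || (j == 0%N) || (n <= i)%N || (n <= j)%N -> gsel i j = false.
Proof.
move=> h; apply/negP => /sel_range /andP[/andP[i0 iN] /andP[j0 jN]].
by move: h; rewrite !eqn0Ngt i0 j0 /= leqNgt iN leqNgt jN.
Qed.

Let LN z : L z -> gN z.
Proof.
move=> Lz; have hz := hM Lz; have := le_trans (Re_md _) hz; have := le_trans (Im_md _) hz.
rewrite !ler_norml => /andP[i1 i2] /andP[r1 r2].
have idx (w : R) : - M <= w -> exists i, gX i <= w <= gX i.+1.
  move=> h; have w0 : 0 <= (w - x0) / dl.
    by rewrite divr_ge0 ?(ltW dl0) //; have := x0E; have := dl0; lra.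
  have /andP[h1 h2] := truncn_itv w0; exists (Num.truncn ((w - x0) / dl)).
  move: h1 h2; rewrite ler_pdivlMr // ltr_pdivrMr // => h1 h2.
  by rewrite /gX; apply/andP; split; lra.
have [i hi] := idx _ r1; have [j hj] := idx _ i1.
exists i, j; have h : gsq i j z by rewrite /gsq /inrect hi hj.
by split=> //; apply/asboolP; exists z.
Qed.

Let Nnear z : gN z -> exists2 w, L w & md (z - w) < eta.
Proof.
move=> [i [j [/asboolP[w [hw Lw]] hz]]]; exists w => //.
apply: le_lt_trans (rect_diam hw hz) _; rewrite !XS; have := dle; lra.
Qed.

Let abel (s h : nat -> C) m : s 0%N = 0 -> s m = 0 ->
  \sum_(j < m) s j * (h j - h j.+1) = \sum_(j < m) (s j.+1 - s j) * h j.+1.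
Proof.
move=> s0 sm; apply/eqP; rewrite -subr_eq0 -sumrB; apply/eqP.
rewrite (eq_bigr (fun j : 'I_m => - (s j.+1 * h j.+1 - s j * h j))) => [|j _]; last by ring.
rewrite sumrN -(big_mkord xpredT (fun j => s j.+1 * h j.+1 - s j * h j)) telescope_sumr //.
by rewrite sm s0 !mul0r subrr oppr0.
Qed.

(** Summation by parts in each direction. The sum over squares gives Cauchy's theorem and the
    residues; the sum over edges gives linearity and bounds from continuity on [gGam] alone. *)
Let BE f : gB f = (@kap R)^-1 * \sum_(i < n) \sum_(j < n) gsg i j * bint f (gX i) (gX i.+1) (gX j) (gX j.+1).
Proof.
congr (_ * _); have so i j := @sel_out i j.
rewrite -(pair_bigA _ (fun b (p : 'I_n * 'I_n) => gterm f (b, p))) /= big_bool /=.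
rewrite -(pair_bigA _ (fun i j : 'I_n => gterm f (true, (i, j)))) /=.
rewrite -(pair_bigA _ (fun i j : 'I_n => gterm f (false, (i, j)))) /=.
rewrite /gterm /=.
have e1 (i : 'I_n) : \sum_(j < n) (gsg i j.+1 - gsg i j) * gH f i j.+1 = \sum_(j < n) gsg i j * (gH f i j - gH f i j.+1).
  by rewrite (abel (s := fun j => gsg i j) (gH f i)) // /gsg so ?leqnn ?orbT.
have e2 (j : 'I_n) : \sum_(i < n) (gsg i j - gsg i.+1 j) * gV f i.+1 j = \sum_(i < n) gsg i j * (gV f i.+1 j - gV f i j).
  apply: oppr_inj; rewrite -!sumrN.
  rewrite (eq_bigr (fun i : 'I_n => (gsg i.+1 j - gsg i j) * gV f i.+1 j)) => [|i _]; last by ring.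
  rewrite -(abel (s := fun i => gsg i j) (fun i => gV f i j)) //; try by rewrite /gsg so ?leqnn ?orbT.
  by apply: eq_bigr => i _; ring.
rewrite (eq_bigr _ (fun i _ => e1 i)) [X in _ + X]exchange_big /= (eq_bigr _ (fun i _ => e2 i)).
rewrite [X in _ + X]exchange_big /= -big_split /=; apply: eq_bigr => i _.
rewrite -big_split /=; apply: eq_bigr => j _.
by rewrite -mulrDr; congr (_ * _); rewrite /bint /gH /gV; ring.
Qed.

Let termc f (t : bool * ('I_n * 'I_n)) : (forall z, gGam z -> ccont f z) ->
  if t.1 then (gsg t.2.1 t.2.2.+1 - gsg t.2.1 t.2.2 = 0) \/ pcont (fun x => f (Complex x (gX t.2.2.+1))) (gX t.2.1) (gX t.2.1.+1)
  else (gsg t.2.1 t.2.2 - gsg t.2.1.+1 t.2.2 = 0) \/ pcont (fun y => f (Complex (gX t.2.1.+1) y)) (gX t.2.2) (gX t.2.2.+1).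
Proof.
case: t => b [i j] cf; case: b => /=.
  case: (eqVneq (gsel i j.+1) (gsel i j)) => [e|e]; [left; by rewrite /gsg e subrr|right].
  apply: hcont => x hx; apply: cf; exists (true, (i, j)); split=> //=.
  by rewrite /inrect /= hx lexx.
case: (eqVneq (gsel i.+1 j) (gsel i j)) => [e|e]; [left; by rewrite /gsg e subrr|right].
apply: vcont => x hx; apply: cf; exists (false, (i, j)); split=> //=.
by rewrite /inrect /= hx lexx.
Qed.

Let GN z : gGam z -> gN z /\ ~ L z.
Proof.
have aux i j i' j' w : gsel i j != gsel i' j' -> gsq i j w -> gsq i' j' w -> gN w /\ ~ L w.
  move=> ne h1 h2; split.
    have : gsel i j || gsel i' j' by move: ne; case: (gsel i j); case: (gsel i' j').
    by move=> /orP[?|?]; [exists i, j | exists i', j'].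
  move=> Lz; have s1 : gsel i j by apply/asboolP; exists w.
  have s2 : gsel i' j' by apply/asboolP; exists w.
  by rewrite s1 s2 in ne.
move=> [[[] [i j]] [/= ne /andP[/andP[z1 z2] /andP[z3 z4]]]].
  by apply: aux ne _ _; rewrite /gsq /inrect z1 z2 /= ?z3 ?z4 ?(le_trans z4 (Xle _)) ?(le_trans (Xle _) z3).
by apply: aux ne _ _; rewrite /gsq /inrect z3 z4 andbT ?z1 ?z2 ?(le_trans z2 (Xle _)) ?(le_trans (Xle _) z1).
Qed.

Let Gcpt : cpt gGam.
Proof.
split; last first.
  apply: clo_fin => -[[] [i j]]; rewrite /gP /=.
    move=> z hz; have [e|e] := pselect (gsel i j.+1 != gsel i j); last by apply: nearbyT => w [/e].
    have [_ cl] := cpt_rect (gX i) (gX i.+1) (gX j.+1) (gX j.+1).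
    by apply: nearbyW (cl z (fun h => hz (conj e h))) => w hw [].
  move=> z hz; have [e|e] := pselect (gsel i.+1 j != gsel i j); last by apply: nearbyT => w [/e].
  have [_ cl] := cpt_rect (gX i.+1) (gX i.+1) (gX j) (gX j.+1).
  by apply: nearbyW (cl z (fun h => hz (conj e h))) => w hw [].
have [[K hK] _] := cpt_rect (gX 0) (gX n.+1) (gX 0) (gX n.+1).
exists K => z [[[] [i j]] [_ /= /andP[/andP[z1 z2] /andP[z3 z4]]]]; apply: hK.
  by rewrite /inrect (le_trans _ z1) ?(le_trans z2) ?(le_trans _ z3) ?(le_trans z4) // Xmono // ltnS ltnW.
by rewrite /inrect (le_trans _ z1) ?(le_trans z2) ?(le_trans _ z3) ?(le_trans z4) // Xmono // ltnS ltnW.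
Qed.

Let gBD f g : (forall z, gGam z -> ccont f z) -> (forall z, gGam z -> ccont g z) ->
  gB (fun z => f z + g z) = gB f + gB g.
Proof.
move=> cf cg; rewrite /gB -mulrDr -big_split /=; congr (_ * _); apply: eq_bigr => t _.
have := termc t cf; have := termc t cg; rewrite /gterm /gH /gV /hedge /vedge; case: t.1.
  by case=> [-> _|c1]; [rewrite !mul0r addr0 | case=> [->|c2]; [rewrite !mul0r addr0 | rewrite cintD // mulrDr]].
by case=> [-> _|c1]; [rewrite !mul0r addr0 | case=> [->|c2]; [rewrite !mul0r addr0 | rewrite cintD // !mulrDr]].
Qed.

Let gBZ c f : (forall z, gGam z -> ccont f z) -> gB (fun z => c * f z) = c * gB f.
Proof.
move=> cf; rewrite /gB [RHS]mulrCA; congr (_ * _); rewrite mulr_sumr; apply: eq_bigr => t _.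
have := termc t cf; rewrite /gterm /gH /gV /hedge /vedge; case: t.1.
  by case=> [->|c1]; [rewrite !mul0r mulr0 | rewrite cintZ // mulrCA].
by case=> [->|c1]; [rewrite !mul0r mulr0 | rewrite cintZ // !(mulrCA c)].
Qed.

Let gBbound : exists2 K : R, 0 <= K & forall f M', 0 <= M' -> (forall z, gGam z -> ccont f z) ->
   (forall z, gGam z -> md (f z) <= M') -> md (gB f) <= K * M'.
Proof.
exists (md (@kap R)^-1 * (2 * dl * #|{: bool * ('I_n * 'I_n)}|%:R)).
  by rewrite mulr_ge0 ?md_ge0 // mulr_ge0 ?ler0n // mulr_ge0 // ltW //.
move=> f K K0 cf hf; rewrite /gB mdM -mulrA ler_wpM2l ?md_ge0 //.
rewrite -mulrA mulrAC; rewrite [leRHS](_ : _ = 2 * dl * K * #|{: bool * ('I_n * 'I_n)}|%:R); last by ring.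
have sgb (b c : bool) : md (b%:R - c%:R : C) <= 1.
  by case: b; case: c; rewrite /= ?subrr ?subr0 ?sub0r ?mdN ?md0 ?md1.
have p0 : 0 <= 2 * dl * K by rewrite !mulr_ge0 // ltW //.
apply: md_sum => t; have := termc t cf; rewrite /gterm; case E: t.1.
  case=> [->|c1]; first by rewrite mul0r md0.
  case: (eqVneq (gsel t.2.1 t.2.2.+1) (gsel t.2.1 t.2.2)) => [e|e].
    by rewrite /gsg e subrr mul0r md0.
  rewrite mdM -[leRHS]mul1r; apply: ler_pM; rewrite ?md_ge0 ?sgb //.
  apply: le_trans (cint_bound (M := K) (Xle _) c1 _) _; last by rewrite XS; lra.
  move=> x hx; apply: hf; exists t; rewrite /gP E; split=> //.
  by rewrite /inrect /= hx lexx.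
case=> [->|c1]; first by rewrite mul0r md0.
case: (eqVneq (gsel t.2.1.+1 t.2.2) (gsel t.2.1 t.2.2)) => [e|e].
  by rewrite /gsg e subrr mul0r md0.
rewrite mdM -[leRHS]mul1r; apply: ler_pM; rewrite ?md_ge0 ?sgb // /gV mdM mdi mul1r.
apply: le_trans (cint_bound (M := K) (Xle _) c1 _) _; last by rewrite XS; lra.
move=> x hx; apply: hf; exists t; rewrite /gP E; split=> //.
by rewrite /inrect /= hx lexx.
Qed.

Let gBcauchy f : (forall z, gN z -> diffat f z) -> gB f = 0.
Proof.
move=> df; rewrite BE big1 ?mulr0 // => i _; rewrite big1 // => j _.
rewrite /gsg; case E: (gsel i j); last by rewrite mul0r.
by rewrite goursat ?mulr0 // => z hz; apply: df; exists i, j.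
Qed.

Let gBin a i j : gsel i j -> instr (gX i) (gX i.+1) (gX j) (gX j.+1) a -> gB (fun z => (z - a)^-1) = 1.
Proof.
move=> sij ha; have /andP[/andP[i0 iN] /andP[j0 jN]] := sel_range sij.
have uniq k k' (x : R) : gX k < x -> x < gX k.+1 -> gX k' <= x -> x <= gX k'.+1 -> k' = k.
  move=> h1 h2 h3 h4; apply/eqP; rewrite eqn_leq; apply/andP; split; rewrite leqNgt; apply/negP => /Xmono h; lra.
have /andP[/andP[r1 r2] /andP[r3 r4]] := ha.
have out i' j' : (i' != i) || (j' != j) -> gsg i' j' * bint (fun z => (z - a)^-1) (gX i') (gX i'.+1) (gX j') (gX j'.+1) = 0.
  move=> ne; rewrite goursat ?mulr0 // => z hz; apply: diff_inv; apply/eqP => za.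
  move: hz; rewrite za => /andP[/andP[q1 q2] /andP[q3 q4]].
  by move: ne; rewrite (uniq _ _ _ r1 r2 q1 q2) (uniq _ _ _ r3 r4 q3 q4) !eqxx.
rewrite BE (bigD1 (Ordinal iN)) //= [X in _ * (_ + X)]big1 ?addr0 => [|i' ne]; last first.
  by rewrite big1 // => j' _; apply: out; rewrite -(inj_eq val_inj) /= in ne; rewrite ne.
rewrite (bigD1 (Ordinal jN)) //= [X in _ * (_ + X)]big1 ?addr0 => [|j' ne]; last first.
  by apply: out; rewrite -(inj_eq val_inj) /= in ne; rewrite ne orbT.
by rewrite /gsg sij mul1r kap_instr // mulVf // kap_neq0.
Qed.

(** A point on a side shared by selected squares is interior to none of them. Moving it slightly
    towards the centre of its square makes it interior, and off [gGam] the integral depends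
    continuously on the point. *)
Let gBpole a : gN a -> ~ gGam a -> gB (fun z => (z - a)^-1) = 1.
Proof.
move=> [i [j [sij /andP[/andP[a1 a2] /andP[a3 a4]]]]] nG.
have [K K0 hK] := gBbound.
have [_ /(_ a nG) [r r0 hr]] := Gcpt.
have d0 := dl0; rewrite !XS in a2 a4.
pose c := Complex (gX i + dl / 2) (gX j + dl / 2).
pose m := 1 + md (c - a); have m0 : 0 < m by rewrite ltr_pwDl // md_ge0.
have far z : gGam z -> r <= md (z - a) by move=> Gz; rewrite leNgt; apply/negP => /hr.
apply/eqP; rewrite -subr_eq0; apply/eqP.
apply: (@md_eq0_small _ _ (K * (m / (r * (r / 2)))) (Num.min 1 (r / (2 * m)))).
  by rewrite lt_min ltr01 divr_gt0 // mulr_gt0.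
move=> t t0; rewrite lt_min ltr_pdivlMr ?mulr_gt0 // => /andP[t1 tr].
pose a' := a + t%:C%C * (c - a).
have aa' : md (a' - a) <= t * m.
  rewrite /a' addrC addKr mdM mdr ger0_norm ?(ltW t0) // ler_wpM2l ?(ltW t0) // /m lerDr; exact: ler01.
have ReE : Re a' = Re a + t * (gX i + dl / 2 - Re a) by rewrite /a' /c; case: (a) => p q /=; ring.
have ImE : Im a' = Im a + t * (gX j + dl / 2 - Im a) by rewrite /a' /c; case: (a) => p q /=; ring.
have far' z : gGam z -> r / 2 <= md (z - a').
  move=> /far h; have := mdTr z a a'; have := aa'; lra.
have nz z : gGam z -> z - a != 0 by move=> /far h; rewrite -md_gt0; lra.
have nz' z : gGam z -> z - a' != 0 by move=> /far' h; rewrite -md_gt0; lra.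
have cI b z : z - b != 0 -> ccont (fun z => (z - b)^-1) z by rewrite subr_eq0 => /diff_inv/diffat_cont.
have <- : gB (fun z => (z - a')^-1) = 1.
  apply: gBin sij _; rewrite /instr !XS ReE ImE.
  by move: a1 a2 a3 a4; set x := Re a; set y := Im a; set p := gX i; set q := gX j => *; apply/andP; split; apply/andP; split; nra.
rewrite -[X in _ - X]mul1r -mulNr -gBZ => [|z /nz' /cI //].
rewrite -gBD => [|z /nz /cI //|z /nz' /cI h]; last by apply: ccontM h; exact: ccont_cst.
have -> : K * (m / (r * (r / 2))) * t = K * (t * m / (r * (r / 2))) by ring.
apply: hK.
- by rewrite divr_ge0 // mulr_ge0 // ltW // divr_gt0.
- by move=> z Gz; apply: ccontD; [exact: cI (nz _ Gz) | apply: ccontM; [exact: ccont_cst | exact: cI (nz' _ Gz)]].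
move=> z Gz; have z1 := nz z Gz; have z2 := nz' z Gz.
have -> : (z - a)^-1 + -1 * (z - a')^-1 = - (a' - a) / ((z - a) * (z - a')) by field; rewrite z1 z2.
rewrite mdf mdN mdM; apply: ler_pM; rewrite ?md_ge0 ?invr_ge0 ?mulr_ge0 ?md_ge0 //.
rewrite lef_pV2 ?posrE ?mulr_gt0 ?md_gt0 ?invr_gt0 //.
by apply: ler_pM; rewrite ?far ?far' // ?ltW // divr_gt0.
Qed.

Lemma grid_contour : contour_for L eta gN gGam gB.
Proof. by split. Qed.
End Grid.

Theorem contour_exists (L : C -> Prop) (eta : R) : cpt L -> 0 < eta ->
  exists N Gam B, contour_for L eta N Gam B.
Proof.
move=> cL eta0; have [[M' hM'] _] := cL.
pose M := `|M'|; have hM z : L z -> md z <= M by move=> /hM' h; exact: le_trans h (ler_norm _).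
(* Two points of a square of side [eta / 4] are less than [eta] apart; [x0] and [n] leave the margin
   required by [sel_range]. *)
pose dl : R := eta / 4; pose x0 : R := - M - 2 * dl.
have dl0 : 0 < dl by rewrite divr_gt0.
pose n : nat := (Num.truncn ((2 * M + 5 * dl) / dl)).+1.
exists (gN L dl x0), (gGam L dl x0 n), (gB L dl x0 n).
have dlE : 4 * dl = eta by rewrite /dl; field.
clearbody dl.
apply: (grid_contour (M := M)) => //.
- exact: normr_ge0.
- by lra.
have := truncnS_gt ((2 * M + 5 * dl) / dl); rewrite ltr_pdivrMr // -/n => h.
by rewrite /gX /x0; lra.
Qed.
End Contour.

Section Derivative.
Variable R : realType.
Local Notation C := R[i].
Implicit Types (f g : C -> C) (z w a : C).

Lemma prod_factor_diffat (s : seq C) z : diffat (fun w => \prod_(b <- s) (w - b)) z.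
Proof.
elim: s => [|c s ihs].
  by apply: (diffat_ext _ (diffat_cst 1 z)); apply: nearbyT => w; rewrite big_nil.
apply: (@diffat_ext _ (fun w => (w - c) * \prod_(b <- s) (w - b))).
  by apply: nearbyT => w; rewrite big_cons.
by apply: diffatM => //; apply: diffatB; [exact: diffat_id | exact: diffat_cst].
Qed.

Lemma prod_root (s : seq C) b : b \in s -> \prod_(a <- s) (b - a) = 0.
Proof.
by move=> bs; apply/eqP; rewrite prodf_seq_eq0; apply/hasP; exists b => //=; rewrite subrr.
Qed.

Lemma logder (t : seq C) (u f : C -> C) z d d' : (forall z, f z = (\prod_(a <- t) (z - a)) * u z) ->
  cdiff u z d -> cdiff f z d' -> f z != 0 -> d' / f z = \sum_(a <- t) (z - a)^-1 + d / u z.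
Proof.
elim: t f d' => [|a t ih] f d' fE du df fz.
  rewrite big_nil add0r; have fu w : f w = u w by rewrite fE big_nil mul1r.
  by rewrite fu (cdiff_uniq (cdiff_ext (@nearbyT R z _ fu) df) du).
pose g w := \prod_(b <- t) (w - b) * u w.
have fg w : f w = 0 + (w - a) * g w by rewrite fE big_cons mulrA add0r.
have : z - a != 0 /\ g z != 0 by apply/andP; move: fz; rewrite fg add0r mulf_eq0 negb_or.
move=> [za gz].
have [dg hg] : diffat g z by apply: diffatM; [exact: prod_factor_diffat | exists d].
rewrite (deriv_div fg df hg) big_cons -addrA -(ih g dg) // fg add0r; field; by rewrite za gz.
Qed.

(** A repeated [a] would be a zero of the cofactor [g], and the derivative of [f = (z - a) * g] at
    [a] would be 0. *)
Lemma simple_roots (s : seq C) (u f df : C -> C) : (forall z, f z = (\prod_(a <- s) (z - a)) * u z) ->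
  entire u -> (forall a, a \in s -> cdiff f a (df a) /\ df a != 0) -> uniq s.
Proof.
elim: s f df => // a s ih f df fE eu hs /=.
pose g w := \prod_(b <- s) (w - b) * u w.
have fg w : f w = 0 + (w - a) * g w by rewrite fE big_cons mulrA add0r.
have dg z : diffat g z by apply: diffatM; [exact: prod_factor_diffat | exact: eu].
have gz0 b : b \in s -> g b = 0.
  by move=> bs; rewrite /g prod_root // mul0r.
have an : a \notin s.
  apply/negP => as_; have [hf] := hs a (mem_head _ _); have [e' he'] := dg a.
  by rewrite (deriv_div fg hf he') gz0 // subrr mul0r addr0 eqxx.
rewrite an /=; have [dg' hdg'] := choice dg.
apply: (ih g dg') => // b bs; split; first exact: hdg'.
have [|hf nz] := hs b; first by rewrite inE bs orbT.
apply: contraNneq nz => d0; by rewrite (deriv_div fg hf (hdg' b)) gz0 // d0 mulr0 addr0.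
Qed.
End Derivative.

Section Residues.
Variable R : realType.
Local Notation C := R[i].
Implicit Types (f g h : C -> C) (z w a : C).
Variables (L : C -> Prop) (eta : R) (N Gam : C -> Prop) (B : (C -> C) -> C).
Hypothesis ct : contour_for L eta N Gam B.

Let GN z : Gam z -> N z. Proof. by move=> /(ctG ct) []. Qed.

Definition contG f := forall z, Gam z -> ccont f z.
Definition holN h := forall z, N z -> hol h z.

Lemma holN_contG h : holN h -> contG h.
Proof. by move=> hh z /GN /hh /hol_cont. Qed.
Lemma contGM f g : contG f -> contG g -> contG (fun z => f z * g z).
Proof. by move=> cf cg z Gz; apply: ccontM; [exact: cf|exact: cg]. Qed.
Lemma contGD f g : contG f -> contG g -> contG (fun z => f z + g z).
Proof. by move=> cf cg z Gz; apply: ccontD; [exact: cf|exact: cg]. Qed.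
Lemma contG_cst c : contG (fun=> c). Proof. by move=> z _; exact: ccont_cst. Qed.
Lemma contGB f g : contG f -> contG g -> contG (fun z => f z - g z).
Proof. by move=> cf cg z Gz; apply: ccontB; [exact: cf|exact: cg]. Qed.
Lemma contGV f : contG f -> (forall z, Gam z -> f z != 0) -> contG (fun z => (f z)^-1).
Proof. by move=> cf f0 z Gz; apply: ccontV; [exact: cf|exact: f0]. Qed.
Lemma contG_pole a : ~ Gam a -> contG (fun z => (z - a)^-1).
Proof.
move=> na z Gz; apply: diffat_cont; apply: diff_inv; apply/eqP => za; by apply: na; rewrite -za.
Qed.
Lemma entire_contG f : entire f -> contG f. Proof. by move=> ef z _; exact: entire_cont. Qed.
Lemma B_hol h : holN h -> B h = 0.
Proof. by move=> hh; apply: (ctcauchy ct) => z /hh /hol_diff. Qed.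
(** [B] is known only through its properties; the bound with [M = 0] shows that it depends on the
    values on [Gam] alone. *)
Lemma B_ext f g : contG f -> contG g -> (forall z, Gam z -> f z = g z) -> B f = B g.
Proof.
move=> cf cg fg; have [K K0 hK] := ctbound ct.
apply/eqP; rewrite -subr_eq0 -md_eq0 eq_le md_ge0 andbT.
rewrite -[X in _ - X]mul1r -mulNr -(ctZ ct) // -(ctD ct) //; last by apply: contGM => //; exact: contG_cst.
apply: le_trans (hK _ 0 _ _ _) _ => //; last by rewrite mulr0.
  by apply: contGD => //; apply: contGM => //; exact: contG_cst.
by move=> z /fg ->; rewrite mulN1r subrr md0.
Qed.
Lemma B_lin2 f g c : contG f -> contG g -> B (fun z => f z + c * g z) = B f + c * B g.
Proof.
by move=> cf cg; rewrite (ctD ct) ?(ctZ ct) //; apply: contGM => //; exact: contG_cst.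
Qed.
Lemma B_sum (t : seq C) (F : C -> C -> C) : (forall a, a \in t -> contG (F a)) ->
  contG (fun z => \sum_(a <- t) F a z) /\ B (fun z => \sum_(a <- t) F a z) = \sum_(a <- t) B (F a).
Proof.
elim: t => [_|a t ih cF].
  have c0 : contG (fun z => \sum_(a <- [::]) F a z).
    by move=> z _; apply: ccont_ext (ccont_cst 0 z); apply: nearbyT => w; rewrite big_nil.
  split=> //; rewrite big_nil -[RHS](B_hol (h := fun=> 0)) => [|z _]; last exact: hol_cst.
  by apply: B_ext => // [|z _]; [exact: contG_cst | rewrite big_nil].
have [|c1 e1] := ih; first by move=> b bt; apply: cF; rewrite inE bt orbT.
have ca : contG (F a) by apply: cF; rewrite mem_head.
have cc : contG (fun z => \sum_(b <- a :: t) F b z).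
  move=> z Gz; apply: ccont_ext (ccontD (ca z Gz) (c1 z Gz)).
  by apply: nearbyT => w; rewrite big_cons.
split=> //; rewrite big_cons -e1 -(ctD ct) //; apply: B_ext => //; first exact: contGD.
by move=> z _; rewrite big_cons.
Qed.

Definition inner a := N a /\ ~ Gam a.

(** Residue theorem for simple poles, by induction: subtracting [h a / Q a / (z - a)] leaves a
    numerator [k] vanishing at [a], so [z - a] cancels and [h1 / Q] has one pole less. *)
Lemma B_simple (s : seq C) u Psi D h : (forall z, Psi z = (\prod_(a <- s) (z - a)) * u z) ->
  entire u -> (forall z, N z -> u z != 0) -> uniq s -> (forall a, a \in s -> inner a) ->
  (forall z, cdiff Psi z (D z)) -> holN h -> contG (fun z => h z / Psi z) ->
  B (fun z => h z / Psi z) = \sum_(a <- s) h a / D a.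
Proof.
elim: s Psi D h => [|a s ih] Psi D h PE eu u0 us si hD hh ch.
  rewrite big_nil -[RHS](B_hol (h := fun z => h z / u z)); last first.
    by move=> z Nz; apply: holM; [exact: hh | apply: holV; [exact: entire_hol | exact: u0]].
  apply: B_ext => // [z Gz|z Gz]; last by rewrite PE big_nil mul1r.
  by apply: ccont_ext (ch z Gz); apply: nearbyT => w; rewrite PE big_nil mul1r.
pose Q w := \prod_(b <- s) (w - b) * u w.
have PQ w : Psi w = 0 + (w - a) * Q w by rewrite PE big_cons mulrA add0r.
have eQ : entire Q by move=> z; apply: diffatM; [exact: prod_factor_diffat | exact: eu].
have [DQ eDQ hDQ] := entire_deriv eQ.
have der z := deriv_div PQ (hD z) (hDQ z).
have Q0 b : b \in s -> Q b = 0.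
  by move=> bs; rewrite /Q prod_root // mul0r.
move: us => /= /andP[an us].
have [Na nGa] : inner a by apply: si; rewrite mem_head.
have prodn0 (t : seq C) z : z \notin t -> \prod_(b <- t) (z - b) != 0.
  elim: t => [|c t iht]; first by rewrite big_nil oner_neq0.
  by rewrite inE negb_or big_cons => /andP[zc /iht h0]; rewrite mulf_neq0 // subr_eq0.
have Qa : Q a != 0 by rewrite mulf_neq0 ?u0 ?prodn0.
pose k z := h z - h a / Q a * Q z.
have hk : holN k.
  by move=> z Nz; apply: holB; [exact: hh | apply: holM; [exact: hol_cst | exact: entire_hol]].
have [h1 [kE hol1]] := hol_div (hk a Na).
have ka : k a = 0 by rewrite /k divfK // subrr.
have hh1 : holN h1 by move=> z /hk /hol1.
have nG z : Gam z -> z - a != 0.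
  by move=> Gz; rewrite subr_eq0; apply/eqP => za; apply: nGa; rewrite -za.
have QG z : Gam z -> Q z != 0.
  move=> Gz; apply: mulf_neq0; last exact: u0 (GN Gz).
  by apply: prodn0; apply/negP => zs; have [] := si z; rewrite ?inE ?zs ?orbT // => _; apply.
have ch1 : contG (fun z => h1 z / Q z).
  by apply: contGM; [exact: holN_contG | apply: contGV => //; exact: entire_contG].
have si' b : b \in s -> inner b by move=> bs; apply: si; rewrite inE bs orbT.
have e1 := ih Q DQ h1 (fun z => erefl) eu u0 us si' hDQ hh1 ch1.
rewrite (_ : B _ = B (fun z => h1 z / Q z + h a / Q a * (z - a)^-1)); last first.
  apply: B_ext => //.
    by apply: contGD => //; apply: contGM; [exact: contG_cst | exact: contG_pole].
  move=> z Gz; rewrite PQ add0r; have z1 := nG z Gz; have z2 := QG z Gz.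
  have := kE z; rewrite ka add0r /k => /(canRL (subrK _)) ->; field; by rewrite z1 z2 Qa.
rewrite B_lin2 //; last exact: contG_pole.
rewrite (ctpole ct Na nGa) mulr1 e1.
rewrite big_cons der subrr mul0r addr0 addrC; congr (_ + _).
apply: eq_big_seq => b bs.
have ba : b - a != 0 by rewrite subr_eq0; apply: contraNneq an => <-.
have := kE b; rewrite ka add0r /k (Q0 b bs) mulr0 subr0 => ->.
rewrite der (Q0 b bs) add0r.
(* For [DQ b = 0] both sides are 0, the inverse of 0 being 0. *)
have [->|d0] := eqVneq (DQ b) 0; first by rewrite mulr0 invr0 !mulr0.
by field; rewrite ba d0.
Qed.

Record rootsN Phi (t : seq C) (v : C -> C) : Prop := RootsN {
  rnE : forall z, Phi z = (\prod_(a <- t) (z - a)) * v z;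
  rnent : entire v;
  rn0 : forall z, N z -> v z != 0;
  rnin : forall a, a \in t -> inner a /\ Phi a = 0 }.

Hypothesis bN : bdd N.

Lemma roots_exist Phi : entire Phi -> (exists z, Phi z != 0) -> (forall z, Gam z -> Phi z != 0) ->
  exists t v, rootsN Phi t v.
Proof.
move=> eP nz PG; have [t [v [ev Pv v0 ht]]] := entire_factor eP nz bN.
exists t, v; split=> // a /ht [Na Pa]; split=> //; split=> // Ga.
by have := PG a Ga; rewrite Pa eqxx.
Qed.

Lemma contG_log Phi D : entire Phi -> entire D -> (forall z, Gam z -> Phi z != 0) -> contG (fun z => D z / Phi z).
Proof.
by move=> eP eD nz; apply: contGM; [exact: entire_contG | apply: contGV => //; exact: entire_contG].
Qed.

Lemma holN_log v dv : entire v -> entire dv -> (forall z, N z -> v z != 0) -> holN (fun z => dv z / v z).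
Proof.
move=> ev edv v0 z Nz; apply: holM; first exact: entire_hol.
by apply: holV; [exact: entire_hol | exact: v0].
Qed.

Lemma B_count Phi D t v : rootsN Phi t v -> entire Phi -> entire D -> (forall z, cdiff Phi z (D z)) ->
  (forall z, Gam z -> Phi z != 0) -> B (fun z => D z / Phi z) = (size t)%:R.
Proof.
move=> [PE ev v0 tin] eP eD hD nz; have [dv edv hdv] := entire_deriv ev.
have [c1 e1] := @B_sum t (fun a z => (z - a)^-1) (fun a at_ => contG_pole (tin a at_).1.2).
have hl := holN_log ev edv v0.
rewrite (_ : B _ = B (fun z => \sum_(a <- t) (z - a)^-1 + dv z / v z)); last first.
  apply: B_ext; first exact: contG_log.
    by apply: contGD => //; exact: holN_contG.
  by move=> z Gz; apply: (logder PE (hdv z) (hD z)); exact: nz.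
rewrite (ctD ct) //; last exact: holN_contG.
rewrite (B_hol hl) addr0 e1 (eq_big_seq (fun=> 1)) => [|a /tin [[Na nGa] _]]; last exact: (ctpole ct).
by rewrite big_const_seq count_predT iter_addr_0.
Qed.

(** [D / Phi] is a sum of terms [1 / (z - a)] plus a holomorphic part, so only simple poles occur
    even if roots of [Phi] are multiple. At each root of [T1] the contributions reassemble to the
    value of [D / Phi]. *)
Lemma B_mixed Phi D t v T1 dT s u : rootsN Phi t v -> entire Phi -> entire D -> (forall z, cdiff Phi z (D z)) ->
  (forall z, Gam z -> Phi z != 0) ->
  rootsN T1 s u -> entire T1 -> (forall z, cdiff T1 z (dT z)) -> (forall z, Gam z -> T1 z != 0) -> uniq s ->
  (forall a, a \in s -> Phi a != 0 /\ dT a != 0) -> (forall a, a \in t -> T1 a != 0) ->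
  B (fun z => D z / Phi z / T1 z) = \sum_(a <- t) (T1 a)^-1 + \sum_(c <- s) D c / Phi c / dT c.
Proof.
move=> [PE ev v0 tin] eP eD hD nz [TE eu u0 sin] eT hT nT us hs ht.
have [dv edv hdv] := entire_deriv ev.
have cT : contG (fun z => (T1 z)^-1) by apply: contGV => //; exact: entire_contG.
have cF a : a \in t -> contG (fun z => ((z - a) * T1 z)^-1).
  move=> at_; have [[_ nG] _] := tin a at_.
  apply: contGV => [|z Gz].
    by apply: contGM; [apply: contGB; [exact: entire_contG (fun z => diffat_id z) | exact: contG_cst] | exact: entire_contG].
  by rewrite mulf_neq0 ?nT // subr_eq0; apply/eqP => za; apply: nG; rewrite -za.
have [c1 e1] := @B_sum t (fun a z => ((z - a) * T1 z)^-1) cF.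
have hl := holN_log ev edv v0.
have cl : contG (fun z => dv z / v z / T1 z) by apply: contGM => //; exact: holN_contG.
rewrite (_ : B _ = B (fun z => \sum_(a <- t) ((z - a) * T1 z)^-1 + dv z / v z / T1 z)); last first.
  apply: B_ext; first by apply: contGM => //; exact: contG_log.
    exact: contGD.
  move=> z Gz; rewrite (logder PE (hdv z) (hD z) (nz z Gz)) mulrDl mulr_suml; congr (_ + _).
  by apply: eq_bigr => a _; rewrite invfM.
rewrite (ctD ct) // e1 (B_simple TE eu u0 us (fun a as_ => (sin a as_).1) hT hl cl).
rewrite (eq_big_seq (fun a => (T1 a)^-1 + \sum_(c <- s) ((c - a) * dT c)^-1)); last first.
  move=> a at_; have [ia Pa] := tin a at_.
  have an : a \notin s by apply/negP => /sin [_ /eqP]; rewrite (negbTE (ht a at_)).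
  have E := @B_simple (a :: s) u (fun z => (z - a) * T1 z) (fun z => T1 z + (z - a) * dT z) (fun=> 1).
  have -> : B (fun z => ((z - a) * T1 z)^-1) = B (fun z => 1 / ((z - a) * T1 z)).
    apply: B_ext; [exact: cF| |by move=> z _; rewrite mul1r].
    by apply: contGM; [exact: contG_cst | exact: cF].
  rewrite E //.
  - rewrite big_cons subrr mul0r addr0 mul1r; congr (_ + _).
    by apply: eq_big_seq => c cs; have [_ ->] := sin c cs; rewrite add0r mul1r.
  - by move=> z; rewrite big_cons -mulrA TE.
  - by rewrite /= an us.
  - by move=> c; rewrite inE => /orP[/eqP ->//|/sin[]].
  - move=> z; have := cdiffM (cdiffB (cdiff_id z) (cdiff_cst a z)) (hT z).
    by rewrite subr0 mul1r.
  - by move=> z _; exact: hol_cst.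
  - by apply: contGM; [exact: contG_cst | exact: cF].
rewrite big_split /= -addrA; congr (_ + _); rewrite exchange_big /= -big_split /=.
apply: eq_big_seq => c cs; have [Pc dc] := hs c cs.
rewrite (logder PE (hdv c) (hD c) Pc) mulrDl mulr_suml; congr (_ + _).
by apply: eq_bigr => a _; rewrite invfM.
Qed.
End Residues.

(** * Weakly repelling fixed points *)
Section WeaklyRepelling.
Variable R : realType.
Local Notation C := R[i].
Implicit Types (f g h : C -> C) (z w a : C).

Lemma bernoulli_le (x : R) m : 1 <= x -> 1 + m%:R * (x - 1) <= x ^+ m.
Proof.
move=> x1; elim: m => [|m ih]; first by rewrite mul0r addr0 expr0.
rewrite exprS mulrSr; have m0 : (0 : R) <= m%:R by [].
have : x * (1 + m%:R * (x - 1)) <= x * x ^+ m by rewrite ler_wpM2l //; lra.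
have : 0 <= m%:R * (x - 1) ^+ 2 by rewrite mulr_ge0 // sqr_ge0.
nra.
Qed.

Lemma natr_md_inj (n m : nat) : md (n%:R - m%:R : C) < 1 -> n = m.
Proof.
wlog nm : n m / (m <= n)%N => [h|].
  have [/h//|/ltnW mn hlt] := leqP m n; by apply/esym/h => //; rewrite mdC.
rewrite -natrB // mdnat -[1]/(1%:R) ltr_nat ltnS leqn0 subn_eq0 => mn.
by apply/eqP; rewrite eqn_leq nm mn.
Qed.

Lemma Re_sum_ge (t : seq C) (F : C -> C) (c : R) : (forall a, a \in t -> c <= Re (F a)) ->
  c * (size t)%:R <= Re (\sum_(a <- t) F a).
Proof.
elim: t => [|a t ih] h; first by rewrite big_nil mulr0.
rewrite big_cons ReD /= mulrSr mulrDr mulr1 addrC; apply: lerD; first by apply: h; rewrite mem_head.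
by apply: ih => b bt; apply: h; rewrite inE bt orbT.
Qed.

Lemma md_sum_seq (t : seq C) (F : C -> C) (G : C -> R) : (forall a, a \in t -> md (F a) <= G a) ->
  md (\sum_(a <- t) F a) <= \sum_(a <- t) G a.
Proof.
elim: t => [|a t ih] h; first by rewrite !big_nil md0.
rewrite !big_cons; apply: le_trans (mdD _ _) _; apply: lerD; first by apply: h; rewrite mem_head.
by apply: ih => b bt; apply: h; rewrite inE bt orbT.
Qed.

(** The real part is [(1 - Re x) / |1 - x| ^ 2], and [|1 - x| ^ 2 <= 2 * (1 - Re x)]. *)
Lemma Re_inv_half (x : C) : x != 1 -> md x <= 1 -> 1 / 2 <= Re (1 - x)^-1.
Proof.
move=> x1 hx; have h : 0 < md (1 - x) by rewrite md_gt0 subr_eq0 eq_sym.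
have h2 := md_sqr (1 - x); have h3 := md_sqr x.
have h4 : md x ^+ 2 <= 1 by rewrite expr_le1 // md_ge0.
have p2 : 0 < md (1 - x) ^+ 2 by rewrite exprn_gt0.
have -> : Re (1 - x)^-1 = (1 - Re x) / md (1 - x) ^+ 2.
  by rewrite h2; case: (x) => p q /=.
rewrite ler_pdivlMr // h2; move: h2 h3 h4; case: (x) => p q /=; nra.
Qed.

(** The argument of [Re] is [(x + 1) / (x - 1)], with real part [(|x| ^ 2 - 1) / |x - 1| ^ 2 >= (|x|
    - 1) / (|x| + 1)]. *)
Lemma Re_moebius (x : C) (q : R) : 1 < q -> q <= md x -> (q - 1) / (q + 1) <= Re (1 + ((x - 1)^-1 + (x - 1)^-1)).
Proof.
move=> q1 hx; have h3 := md_sqr x; have h2 := md_sqr (x - 1).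
have hlt : 0 < md (x - 1) by have := mdBr x 1; rewrite md1; lra.
have p2 : 0 < md (x - 1) ^+ 2 by rewrite exprn_gt0.
have -> : Re (1 + ((x - 1)^-1 + (x - 1)^-1)) = (md x ^+ 2 - 1) / md (x - 1) ^+ 2.
  have n0 : (Re x - 1) ^+ 2 + Im x ^+ 2 != 0.
    by rewrite (_ : _ + _ = md (x - 1) ^+ 2) ?gt_eqF // h2; case: (x) => p r /=; rewrite subr0.
  by rewrite h2 h3; move: n0; case: (x) => p r /= n0; rewrite subr0; field.
have hm : md (x - 1) <= md x + 1 by have := mdB x 1; rewrite md1.
rewrite ler_pdivrMr; last lra.
rewrite mulrAC ler_pdivlMr //.
have : md (x - 1) ^+ 2 <= (md x + 1) ^+ 2 by rewrite lerXn2r ?nnegrE ?md_ge0 //; have := md_ge0 x; lra.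
set X := md x in hx h3 hm *; set Y := md (x - 1) ^+ 2 in p2 *; move=> hY.
have : (q - 1) * Y <= (q - 1) * (X + 1) ^+ 2 by rewrite ler_wpM2l //; lra.
nra.
Qed.

Section Statement.
Variables (L : C -> Prop) (eta : R) (N Gam : C -> Prop) (B : (C -> C) -> C).
Hypothesis ct : contour_for L eta N Gam B.
Hypothesis bN : bdd N.

Lemma contG_bounded f : contG Gam f -> exists2 A : R, 0 <= A & forall z, Gam z -> md (f z) <= A.
Proof.
move=> cf; have [z e e' h ee|z Gz|e e0 he] := @cpt_unif _ Gam (fun z e => e * md (f z) <= 1) (ctGcpt ct).
- by apply: le_trans h; rewrite ler_wpM2r // md_ge0.
- have f1 : 0 < md (f z) + 1 by rewrite ltr_wpDl // md_ge0.
  exists (md (f z) + 1)^-1; first by rewrite invr_gt0.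
  apply: nearbyW (cf z Gz _ ltr01) => w hw _; rewrite mulrC ler_pdivrMr // mul1r.
  by have := mdBr (f w) (f z); lra.
exists e^-1; first by rewrite invr_ge0 ltW.
by move=> z /he; rewrite mulrC -ler_pdivlMr // div1r.
Qed.

(** [K] is a parameter instead of being drawn from [ctbound], so that one constant serves every [m]
    later. *)
Lemma B_close f g (A : R) : contG Gam f -> contG Gam g -> (forall z, Gam z -> md (f z - g z) <= A) -> 0 <= A ->
  forall K : R, 0 <= K -> (forall f M, 0 <= M -> (forall z, Gam z -> ccont f z) -> (forall z, Gam z -> md (f z) <= M) -> md (B f) <= K * M) ->
  md (B f - B g) <= K * A.
Proof.
move=> cf cg h A0 K K0 hK; rewrite -[X in _ - X]mul1r -mulNr -(B_lin2 ct) //.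
apply: hK => // [|z /h].
  by apply: contGD => //; apply: contGM => //; exact: contG_cst.
by rewrite mulN1r.
Qed.

(** As [x] runs from 0 to 1, the count [B (T' / (T - x))] is an integer and Lipschitz in [x],
    because [|T - x| >= q - 1] on [Gam]; hence it is constant. *)
Lemma rouche T dT (q : R) s u t v : entire T -> entire dT -> (forall z, cdiff T z (dT z)) -> 1 < q ->
  (forall z, Gam z -> q <= md (T z)) -> (exists z, T z = 0) -> (exists z, T z != 0) ->
  rootsN N Gam (fun z => T z - 1) s u -> rootsN N Gam T t v -> size s = size t.
Proof.
move=> eT edT hT q1 hq [z0 T0] [z1 T1] rs rt.
pose Tx (x : R) z := T z - x%:C%C.
have eTx x : entire (Tx x) by move=> z; apply: diffatB => //; exact: diffat_cst.
have hTx x z : cdiff (Tx x) z (dT z) by have := cdiffB (hT z) (cdiff_cst x%:C%C z); rewrite subr0.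
have low x z : 0 <= x <= 1 -> Gam z -> q - 1 <= md (Tx x z).
  move=> /andP[x0 x1] /hq h; have := mdBr (T z) x%:C%C; rewrite mdr ger0_norm // => h2; rewrite /Tx; lra.
have nz x z : 0 <= x <= 1 -> Gam z -> Tx x z != 0.
  by move=> hx /(low x z hx) h; rewrite -md_gt0; lra.
have cx x : 0 <= x <= 1 -> contG Gam (fun z => dT z / Tx x z).
  by move=> hx; apply: contG_log => // z; exact: nz.
have [A A0 hA] := contG_bounded (entire_contG edT).
have [K K0 hK] := ctbound ct.
have lip x y : 0 <= x <= 1 -> 0 <= y <= 1 ->
    md (B (fun z => dT z / Tx x z) - B (fun z => dT z / Tx y z)) <= K * (A / (q - 1) ^+ 2 * `|x - y|).
  move=> hx hy; have q2 : 0 < (q - 1) ^+ 2 by rewrite exprn_gt0 // subr_gt0.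
  have A2 : 0 <= A / (q - 1) ^+ 2 by rewrite divr_ge0 // ltW.
  apply: B_close => //; try exact: cx; last by rewrite mulr_ge0.
  move=> z Gz; have n1 := nz x z hx Gz; have n2 := nz y z hy Gz.
  have -> : dT z / Tx x z - dT z / Tx y z = dT z / (Tx x z * Tx y z) * (x - y)%:C%C.
    rewrite rmorphB /= (_ : x%:C%C - y%:C%C = Tx y z - Tx x z); last by rewrite /Tx; ring.
    by field; rewrite n1 n2.
  rewrite mdM mdr ler_wpM2r // mdf; apply: ler_pM; rewrite ?md_ge0 ?invr_ge0 ?md_ge0 ?hA //.
  have l1 := low x z hx Gz; have l2 := low y z hy Gz.
  have p0 : 0 < q - 1 by lra.
  have p1 : 0 < md (Tx x z) by lra.
  have p2 : 0 < md (Tx y z) by lra.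
  by rewrite mdM expr2 lef_pV2 ?posrE ?(mulr_gt0 p0 p0) ?(mulr_gt0 p1 p2) //; apply: ler_pM => //; lra.
have A2 : 0 <= K * (A / (q - 1) ^+ 2) by rewrite mulr_ge0 // divr_ge0 // exprn_ge0 // subr_ge0 ltW.
have cnt x : 0 <= x <= 1 -> exists k : nat, B (fun z => dT z / Tx x z) = k%:R.
  move=> hx; have [|z Gz|tt [vv rr]] := @roots_exist _ N Gam bN (Tx x) (eTx x).
  - have [x0|x0] := eqVneq x 0; first by exists z1; rewrite /Tx x0 subr0.
    by exists z0; rewrite /Tx T0 sub0r oppr_eq0; apply: contraNneq x0 => /complexI ->.
  - exact: nz.
  by exists (size tt); apply: (B_count ct rr) => // z; exact: nz.
have const x y : inrect 0 1 0 0 x -> inrect 0 1 0 0 y ->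
    B (fun z => dT z / Tx (Re x) z) = B (fun z => dT z / Tx (Re y) z).
  move=> hx hy; apply: (rect_const (k := fun x => B (fun z => dT z / Tx (Re x) z)) _ hx hy) => p /andP[hu _].
  (* Within this radius two counts differ by less than 1. *)
  have r0 : 0 < (1 + K * (A / (q - 1) ^+ 2))^-1 by rewrite invr_gt0 ltr_pwDl.
  exists (1 + K * (A / (q - 1) ^+ 2))^-1 => // w wu /andP[hw _].
  have [k1 e1] := cnt _ hw; have [k2 e2] := cnt _ hu.
  rewrite e1 e2; congr (_%:R); apply: natr_md_inj; rewrite -e1 -e2.
  apply: le_lt_trans (lip _ _ hw hu) _; rewrite mulrA.
  have wu' : `|Re w - Re p| < (1 + K * (A / (q - 1) ^+ 2))^-1 by rewrite -ReB; exact: le_lt_trans (Re_md _) wu.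
  apply: le_lt_trans (ler_wpM2l A2 (ltW wu')) _; rewrite ltr_pdivrMr ?ltr_pwDl // mul1r; lra.
have h0 : (0 : R) <= (0 : R) <= (1 : R) by rewrite lexx ler01.
have h1 : (0 : R) <= (1 : R) <= (1 : R) by rewrite lexx ler01.
have rs' : rootsN N Gam (Tx 1) s u by [].
have rt' : rootsN N Gam (Tx 0) t v.
  by case: rt => tE ev v0 tin; split=> // [z|a /tin[ia Ta]]; rewrite /Tx subr0.
have := const (Complex 1 0) (Complex 0 0); rewrite /inrect /= !lexx ler01 => /(_ isT isT).
rewrite (B_count ct rs' (eTx 1) edT (hTx 1) (fun z => nz 1 z h1)) (B_count ct rt' (eTx 0) edT (hTx 0) (fun z => nz 0 z h0)).
by move=> e; apply: natr_md_inj; rewrite e subrr md0.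
Qed.

(* Compare [B (F' / F * (T + 1) / (T - 1))] with the averages over the roots of [F ^ m = rho ^ m], where
   [(T + 1) / (T - 1)] has positive real part; its value is [d - 2 sum 1 / (1 - lambda)]. *)
Lemma weakly_repelling_solution F dF (b : C) (rho q : R) : entire F -> entire dF -> (forall z, cdiff F z (dF z)) ->
  (exists z, F z != 0) -> 0 < rho -> 1 < q ->
  (forall z, N z -> L z \/ rho < md (F z)) -> (forall z, N z -> q <= rho * md (z - b)) ->
  (exists2 z, L z & F z = 0) ->
  exists z, [/\ L z, (z - b) * F z = 1 & - (z - b) ^+ 2 * dF z = 1 \/ 1 < md ((z - b) ^+ 2 * dF z)].
Proof.
have ar1 (r y k P : R) : 0 < r -> r - y <= P -> y * (1 + k) <= r -> r * k * y <= P * r.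
  by move=> r0 h h2; rewrite [P * r]mulrC -mulrA ler_pM2l // mulrC; lra.
(* Here [y] counts the roots of [F ^ k = rho ^ k], [W] and [V] are the real parts of the integral
   and of the residues at the solutions of [T = 1], and [a], [e], [E] bound the errors. *)
have ar2 (c y k d X a W e V E : R) : 0 <= c -> c * y <= y + (W - V + (W - V)) -> - a <= y - k * d -> y - k * d <= a ->
    W - k * X <= e -> - E <= V -> c * (k * d - a) - (E + E) <= k * d + a + (k * (X + X) + (e + e)).
  move=> c0 h1 h2 h3 h4 h5; have : c * (k * d - a) <= c * y by rewrite ler_wpM2l //; lra.
  rewrite mulrDr; lra.
have ar3 (c k d X a e E : R) : c * (k * d - a) - (E + E) <= k * d + a + (k * (X + X) + (e + e)) ->
    k * (d + (X + X)) <= 0 -> k * (c * d) <= c * a + (E + E) + a + (e + e) by lra.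
move=> eF edF hF nzF rho0 q1 NL Nq [ze Lze Fze]; apply: contrapT => contra.
have q0 : 0 < q - 1 by rewrite subr_gt0.
have qp : 0 < q by exact: lt_trans q1.
pose c0 := (q - 1) / (q + 1); have c00 : 0 < c0 by rewrite divr_gt0 // addr_gt0.
have GN z : Gam z -> N z by move=> /(ctG ct) [].
have NbN z : N z -> z - b != 0.
  by move=> /Nq h; rewrite -md_gt0 -(pmulr_rgt0 _ rho0); lra.
have Frho z : Gam z -> rho < md (F z).
  by move=> Gz; have [Nz nL] := ctG ct Gz; have [/nL|] := NL z Nz.
have F0 z : Gam z -> F z != 0 by move=> /Frho h; rewrite -md_gt0; lra.
pose T z := (z - b) * F z; pose dT z := F z + (z - b) * dF z.
have elin : entire (fun z => z - b) by move=> z; apply: diffatB; [exact: diffat_id | exact: diffat_cst].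
have eT : entire T by move=> z; exact: diffatM.
have edT : entire dT by move=> z; apply: diffatD => //; exact: diffatM.
have hT z : cdiff T z (dT z).
  by have := cdiffM (cdiffB (cdiff_id z) (cdiff_cst b z)) (hF z); rewrite subr0 mul1r.
pose T1 z := T z - 1.
have eT1 : entire T1 by move=> z; apply: diffatB => //; exact: diffat_cst.
have hT1 z : cdiff T1 z (dT z) by have := cdiffB (hT z) (cdiff_cst 1 z); rewrite subr0.
have mT z : N z -> rho <= md (F z) -> q <= md (T z).
  by move=> /Nq h hF1; rewrite mdM; have := md_ge0 (z - b); nra.
have T1n z : q <= md (T z) -> T1 z != 0.
  move=> h; rewrite -md_gt0; have := mdBr (T z) 1; rewrite md1 /T1; lra.
have GT z : Gam z -> q <= md (T z) by move=> Gz; apply: mT; [exact: GN | exact/ltW/Frho].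
have T1G z : Gam z -> T1 z != 0 by move=> /GT /T1n.
have Tz0 : T ze = 0 by rewrite /T Fze mulr0.
have nzT : exists z, T z != 0.
  have [z Fz] := nzF; have [zb|zb] := eqVneq z b; last by exists z; rewrite mulf_neq0 // subr_eq0.
  have [r r0 hr] := ccontN0 (entire_cont z eF) Fz.
  exists (z + (r / 2)%:C%C); have h : md (z + (r / 2)%:C%C - z) = r / 2 by rewrite addrC addKr mdr ger0_norm; lra.
  have [|Fn _] := hr (z + (r / 2)%:C%C); first by rewrite h; lra.
  by rewrite mulf_neq0 // -zb -md_gt0 h; lra.
have [s [u rs]] : exists s u, rootsN N Gam T1 s u.
  by apply: (roots_exist bN eT1) => //; exists ze; rewrite /T1 Tz0 sub0r oppr_eq0 oner_eq0.
(* At a solution [|F c| = 1 / |c - b| <= rho / q < rho], so it lies in [L] and not merely in [N]. *)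
have sP c : c \in s -> [/\ N c, T c = 1, md (F c) * q <= rho, L c & c - b != 0].
  move=> cs; have [[Nc nG] /eqP] := rnin rs cs; rewrite subr_eq0 => /eqP Tc.
  have h : md (c - b) * md (F c) = 1 by rewrite -mdM -/(T c) Tc md1.
  have hq := Nq c Nc; have f0 := md_ge0 (F c).
  have l1 : md (F c) * q <= rho.
    have h2 : md (F c) * q <= md (F c) * (rho * md (c - b)) by rewrite ler_wpM2l.
    by apply: le_trans h2 _; rewrite mulrCA [md (F c) * _]mulrC h mulr1.
  split=> //; last exact: NbN.
  by have [//|hl] := NL c Nc; nra.
(* The right-hand side is [1 - lambda]; so [lambda != 1] makes [c] a simple root of [T - 1]. *)
have dTE c : c \in s -> (c - b) * dT c = 1 - (- (c - b) ^+ 2 * dF c).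
  by move=> /sP [_ Tc _ _ _]; rewrite -{1}Tc /T /dT; ring.
have lamP c : c \in s -> - (c - b) ^+ 2 * dF c != 1 /\ md (- (c - b) ^+ 2 * dF c) <= 1.
  move=> cs; have [Nc Tc _ Lc _] := sP c cs; split.
    by apply/eqP => h; apply: contra; exists c; split=> //; left.
  by rewrite mulNr mdN leNgt; apply/negP => h; apply: contra; exists c; split=> //; right.
have dT0 c : c \in s -> dT c != 0.
  move=> cs; have [h _] := lamP c cs; apply: contraNneq h => d0.
  by have /eqP := dTE c cs; rewrite d0 mulr0 eq_sym subr_eq0 => /eqP <-.
have us : uniq s.
  apply: (simple_roots (rnE rs) (rnent rs)) => c cs; split; first exact: hT1.
  exact: dT0.
have [tF [v rF]] := roots_exist bN eF nzF F0.
have rT : rootsN N Gam T tF (fun z => (z - b) * v z).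
  case: rF => FE ev v0 tin; split=> //.
  - by move=> z; rewrite /T FE; ring.
  - by move=> z; exact: diffatM.
  - by move=> z Nz; rewrite mulf_neq0 ?NbN ?v0.
  - by move=> a /tin [ia Fa]; split=> //; rewrite /T Fa mulr0.
have sizes : size s = size tF.
  by apply: (rouche eT edT hT q1 GT _ nzT rs rT); exists ze.
set d := size tF in sizes.
have d0 : (0 < d)%N.
  rewrite /d; case: (tF) rF => // -[FE _ v0 _]; exfalso.
  have Nze := ctL ct Lze; have := v0 _ Nze; have := FE ze.
  by rewrite Fze big_nil mul1r => <-; rewrite eqxx.
have Tn0 z : Gam z -> T z != 0 by move=> Gz; rewrite mulf_neq0 ?F0 //; exact: NbN (GN _ Gz).
have BF := B_count ct rF eF edF hF F0.
have BT := B_count ct rT eT edT hT Tn0.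
have BT1 := B_count ct rs eT1 edT hT1 T1G.
have hib : holN N (fun z => (z - b)^-1).
  by move=> z Nz; apply: holV; [exact: entire_hol | exact: NbN].
have cT1 : contG Gam (fun z => (T1 z)^-1) by apply: contGV => //; exact: entire_contG.
have cib : contG Gam (fun z => (z - b)^-1) by exact: (holN_contG ct hib).
have BS := B_simple ct (rnE rs) (rnent rs) (rn0 rs) us (fun c cs => (rnin rs cs).1) hT1 hib (contGM cib cT1).
have cFF : contG Gam (fun z => dF z / F z) by exact: contG_log.
have cTT : contG Gam (fun z => dT z / T z) by exact: contG_log.
have cTT1 : contG Gam (fun z => dT z / T1 z) by exact: contG_log.
set X := B (fun z => dF z / F z / T1 z).
have XE : X = - \sum_(c <- s) (c - b)^-1 / dT c.
  have cN f : contG Gam f -> contG Gam (fun z => -1 * f z) by move=> cf; apply: contGM => //; exact: contG_cst.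
  have cS : contG Gam (fun z => (z - b)^-1 / T1 z) by exact: contGM.
  have cD : contG Gam (fun z => dT z / T1 z + -1 * (dT z / T z)) by apply: contGD => //; exact: cN.
  (* Partial fractions from [T' / T = F' / F + 1 / (z - b)]; by [rouche] the first two integrals
     cancel. *)
  have -> : X = B (fun z => dT z / T1 z) + -1 * B (fun z => dT z / T z) + -1 * B (fun z => (z - b)^-1 / T1 z).
    rewrite -(B_lin2 ct _ cTT1 cTT) -(B_lin2 ct _ cD cS); apply: (B_ext ct); first exact: contGM.
      by apply: contGD => //; exact: cN.
    move=> z Gz; have n1 := F0 z Gz; have n2 := T1G z Gz; have n3 := NbN z (GN z Gz).
    have T1E : T1 z = (z - b) * F z - 1 by [].
    move: n2; rewrite T1E /T /dT => n2; field; by rewrite n1 n2 n3.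
  by rewrite BT1 BT BS sizes -/d; ring.
have ReX : d%:R + (Re X + Re X) <= 0.
  have : 1 / 2 * (size s)%:R <= Re (\sum_(c <- s) (c - b)^-1 / dT c).
    apply: Re_sum_ge => c cs; have [l1 l2] := lamP c cs.
    by rewrite -invfM dTE // Re_inv_half.
  by rewrite XE ReN sizes; lra.
have [K K0 hK] := ctbound ct.
have [e e0 he] : exists2 e : R, 0 < e & forall z, Gam z -> rho + e <= md (F z).
  have := @cpt_unif _ Gam (fun z e => rho + e <= md (F z)) (ctGcpt ct); apply.
    by move=> z e e' h ee; lra.
  move=> z Gz; exists ((md (F z) - rho) / 2); first by have := Frho z Gz; lra.
  have h0 : 0 < (md (F z) - rho) / 2 by have := Frho z Gz; lra.
  by apply: nearbyW (entire_cont z eF h0) => w hw _; rewrite mdC in hw; have := mdBr (F z) (F w); lra.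
pose x := 1 + e / rho.
have x1 : 1 < x by rewrite /x ltrDl divr_gt0.
have [A A0 hA] := contG_bounded cFF.
have [A' A'0 hA'] := contG_bounded cT1.
pose Phi m z := F z ^+ m - (rho ^+ m)%:C%C.
pose D m z := m%:R * F z ^+ m.-1 * dF z.
have ePhi m : entire (Phi m) by move=> z; apply: diffatB; [exact: diffatX | exact: diffat_cst].
have eD m : entire (D m).
  by move=> z; apply: diffatM => //; apply: diffatM; [exact: diffat_cst | exact: diffatX].
have hD m z : cdiff (Phi m.+1) z (D m.+1 z).
  by have := cdiffB (cdiffX m (hF z)) (cdiff_cst (rho ^+ m.+1)%:C%C z); rewrite subr0.
have mr m : md (rho ^+ m)%:C%C = rho ^+ m by rewrite mdr ger0_norm // exprn_ge0 // ltW.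
have rm m : 0 < rho ^+ m by rewrite exprn_gt0.
(* On [Gam], [|F| >= x * rho]; Bernoulli's inequality is applied to the power of [x]. *)
have PhiG m z : Gam z -> rho ^+ m.+1 * (m.+1%:R * (x - 1)) <= md (Phi m.+1 z).
  move=> Gz; have := mdBr (F z ^+ m.+1) (rho ^+ m.+1)%:C%C; rewrite mdX mr => h.
  apply: le_trans h; rewrite lerBrDr -[X in _ + X]mulr1 -mulrDr addrC.
  apply: le_trans (ler_wpM2l (ltW (rm _)) (bernoulli_le m.+1 (ltW x1))) _.
  rewrite -exprMn; apply: lerXn2r; rewrite ?nnegrE ?md_ge0 //.
    by rewrite mulr_ge0 ?(ltW rho0) // ltW // (lt_trans ltr01).
  by rewrite /x mulrDr mulr1 mulrCA divff ?gt_eqF // mulr1 he.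
have x10 : 0 < x - 1 by rewrite subr_gt0.
have mpos m : (0 : R) < m.+1%:R by rewrite ltr0n.
have PhiG0 m z : Gam z -> Phi m.+1 z != 0.
  move=> /(PhiG m) h; rewrite -md_gt0; apply: lt_le_trans h.
  by rewrite !mulr_gt0.
pose E1 := A / (x - 1); have E10 : 0 <= E1 by rewrite divr_ge0 // ltW.
(* The error is [F' / F] times [m * rho ^ m / (F ^ m - rho ^ m)], and [PhiG] bounds the second
   factor independently of [m]. *)
have close m z : Gam z -> md (D m.+1 z / Phi m.+1 z - m.+1%:R * (dF z / F z)) <= E1.
  move=> Gz; have n1 := F0 z Gz; have n2 := PhiG0 m z Gz.
  have -> : D m.+1 z / Phi m.+1 z - m.+1%:R * (dF z / F z) =
     dF z / F z * (m.+1%:R * (rho ^+ m.+1)%:C%C / Phi m.+1 z).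
    have PE : (rho ^+ m.+1)%:C%C = F z * F z ^+ m - Phi m.+1 z by rewrite /Phi (exprS (F z)); ring.
    by rewrite PE /D /=; field; rewrite n1 n2.
  rewrite mdM /E1; apply: ler_pM; rewrite ?md_ge0 ?hA // mdf mdM mdnat mr.
  rewrite ler_pdivrMr ?md_gt0 // -[leLHS]mul1r ler_pdivlMl //.
  by apply: le_trans (PhiG m z Gz); rewrite mul1r; apply: le_of_eq; ring.
(* Bound for the residue at a solution [c] of [T = 1], again independent of [m]: there
   [|F c| <= rho / q], so [rho ^ m] dominates [F c ^ m]. *)
pose G c := md (dF c / F c) / (q - 1) * md (dT c)^-1.
pose E2 := \sum_(c <- s) G c.
have avg m : (q - 1) / (q + 1) * (m.+1%:R * d%:R - K * E1) - (E2 + E2) <=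
   m.+1%:R * d%:R + K * E1 + (m.+1%:R * (Re X + Re X) + (K * (E1 * A') + K * (E1 * A'))).
  have [|z Gz|t [w rP]] := @roots_exist _ N Gam bN (Phi m.+1) (ePhi m.+1).
  - exists ze; rewrite /Phi Fze expr0n sub0r oppr_eq0 -md_eq0 mr gt_eqF //.
  - exact: PhiG0.
  have tP a : a \in t -> q <= md (T a).
    move=> at_; have [[Na _] /eqP] := rnin rP at_; rewrite subr_eq0 => /eqP h.
    apply: mT => //; rewrite -(@ler_pXn2r _ m.+1) ?nnegrE ?md_ge0 ?(ltW rho0) //.
    by rewrite -mdX h mr.
  have sPhi c : c \in s -> F c != 0 /\ rho ^+ m.+1 * (m.+1%:R * (q - 1)) * md (F c) ^+ m.+1 <= md (Phi m.+1 c) * rho ^+ m.+1.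
    move=> cs; have [Nc Tc hc Lc cb] := sP c cs; split.
      by apply/eqP => Fc; move: Tc; rewrite /T Fc mulr0 => /esym/eqP; rewrite oner_eq0.
    have h : rho ^+ m.+1 - md (F c) ^+ m.+1 <= md (Phi m.+1 c).
      by rewrite -mdX -(mr m.+1) /Phi mdC mdBr.
    have y0 : 0 <= md (F c) ^+ m.+1 by rewrite exprn_ge0 // md_ge0.
    have : md (F c) ^+ m.+1 * (1 + m.+1%:R * (q - 1)) <= rho ^+ m.+1.
      apply: le_trans (ler_wpM2l y0 (bernoulli_le m.+1 (ltW q1))) _.
      by rewrite -exprMn; apply: lerXn2r; rewrite ?nnegrE ?(ltW rho0) // mulr_ge0 ?md_ge0 ?(ltW qp).
    exact: ar1 (rm _) h.
  have sP0 c : c \in s -> Phi m.+1 c != 0.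
    move=> cs; have [Fc h] := sPhi c cs; rewrite -md_gt0 -(pmulr_lgt0 _ (rm m.+1)).
    by apply: lt_le_trans h; rewrite !mulr_gt0 // exprn_gt0 // md_gt0.
  have BM := B_mixed ct rP (ePhi m.+1) (eD m.+1) (hD m) (PhiG0 m) rs eT1 hT1 T1G us
     (fun c cs => conj (sP0 c cs) (dT0 c cs)) (fun a at_ => T1n a (tP a at_)).
  have BC := B_count ct rP (ePhi m.+1) (eD m.+1) (hD m) (PhiG0 m).
  have cD : contG Gam (fun z => D m.+1 z / Phi m.+1 z) by apply: contG_log => //; exact: PhiG0.
  have cm : contG Gam (fun z => m.+1%:R * (dF z / F z)) by apply: contGM => //; exact: contG_cst.
  have c1 : md ((size t)%:R - m.+1%:R * d%:R) <= K * E1.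
    by rewrite -BC -BF -(ctZ ct) //; apply: B_close => //; exact: close.
  have c2 : md (B (fun z => D m.+1 z / Phi m.+1 z / T1 z) - m.+1%:R * X) <= K * (E1 * A').
    rewrite -(ctZ ct); last exact: contGM.
    apply: B_close => //; first exact: contGM.
    - by apply: contGM; [exact: contG_cst | exact: contGM].
    - move=> z Gz; rewrite mulrA -mulrBl mdM; apply: ler_pM; rewrite ?md_ge0 //; [exact: close | exact: hA'].
    - exact: mulr_ge0.
  have c3 : (q - 1) / (q + 1) * (size t)%:R <= Re (\sum_(a <- t) (1 + ((T1 a)^-1 + (T1 a)^-1))).
    by apply: Re_sum_ge => a /tP; exact: Re_moebius.
  have c4 : md (\sum_(c <- s) D m.+1 c / Phi m.+1 c / dT c) <= E2.
    apply: md_sum_seq => c cs; rewrite /G mdM ler_wpM2r ?md_ge0 //.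
    have [Fc h] := sPhi c cs; have P0 := sP0 c cs.
    have fp : 0 < md (F c) by rewrite md_gt0.
    have Pp : 0 < md (Phi m.+1 c) by rewrite md_gt0.
    have {}h : m.+1%:R * (q - 1) * (md (F c) * md (F c) ^+ m) <= md (Phi m.+1 c).
      by rewrite -(ler_pM2r (rm m.+1)) -exprS; apply: le_trans h; apply: le_of_eq; ring.
    have -> : md (D m.+1 c / Phi m.+1 c) = m.+1%:R * md (F c) ^+ m * md (dF c) / md (Phi m.+1 c).
      by rewrite mdf /D !mdM mdnat mdX.
    have -> : md (dF c / F c) / (q - 1) = md (dF c) / (md (F c) * (q - 1)) by rewrite mdf invfM mulrA.
    rewrite ler_pdivlMr ?(mulr_gt0 fp q0) // mulrAC ler_pdivrMr //.
    apply: le_trans (ler_wpM2l (md_ge0 (dF c)) h); apply: le_of_eq; ring.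
  set S1 := \sum_(a <- t) (T1 a)^-1 in BM.
  set S2 := \sum_(c <- s) _ in BM c4.
  rewrite big_split /= big_split /= big_const_seq count_predT iter_addr_0 -/S1 in c3.
  have {BM}BM : S1 = B (fun z => D m.+1 z / Phi m.+1 z / T1 z) - S2 by rewrite BM addrK.
  have r1 := Re_md ((size t)%:R - m.+1%:R * d%:R : C); have r2 := le_trans r1 c1.
  have r3 := le_trans (Re_md _) c2; have r4 := le_trans (Re_md _) c4.
  have Ren (k : nat) : Re (k%:R : C) = k%:R.
    by elim: k => // k ih; rewrite !mulrSr ReD ih.
  have Remn (k : nat) z : Re (k%:R * z) = k%:R * Re z.
    by elim: k => [|k ih]; rewrite ?mul0r // !mulrSr !mulrDl !mul1r ReD ih.
  move: c3 r2 r3 r4; rewrite BM !(ReD, ReN, Remn, Ren).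
  rewrite !ler_norml => c3 /andP[p1 p2] /andP[_ p4] /andP[p5 _].
  by apply: ar2 c3 p1 p2 p4 p5; exact: ltW.
pose E := c0 * (K * E1) + (E2 + E2) + K * E1 + (K * (E1 * A') + K * (E1 * A')).
have dpos : 0 < (d%:R : R) by rewrite ltr0n.
(* The left-hand side grows with [m], the right-hand side is fixed. *)
have main m : m.+1%:R * (c0 * d%:R) <= E.
  by apply: ar3 (avg m) _; rewrite pmulr_rle0 // ltr0n.
have cd := mulr_gt0 c00 dpos.
have := truncnS_gt (E / (c0 * d%:R)); rewrite ltr_pdivrMr // ltNge => /negP; apply; exact: main.
Qed.
End Statement.
End WeaklyRepelling.

(** * Bounded pieces of sublevel sets *)
Section Pieces.
Variable R : realType.
Local Notation C := R[i].
Implicit Types (K L X A B S : C -> Prop).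

Definition clopen_in K L := (forall z, L z -> K z) /\ forall z, K z -> nearby z (fun w => K w -> (L w <-> L z)).
Definition conn A := forall B, clopen_in A B -> (exists z, B z) -> forall z, A z -> B z.

Lemma clopen_inI K L L' : clopen_in K L -> clopen_in K L' -> clopen_in K (fun z => L z /\ L' z).
Proof.
move=> [LK hL] [_ hL']; split=> [z [/LK]//|z Kz].
by apply: nearbyW (nearby_and (hL _ Kz) (hL' _ Kz)) => w [h h'] Kw; rewrite h // h'.
Qed.
Lemma clopen_inU K L L' : clopen_in K L -> clopen_in K L' -> clopen_in K (fun z => L z \/ L' z).
Proof.
move=> [LK hL] [LK' hL']; split=> [z [/LK|/LK']//|z Kz].
by apply: nearbyW (nearby_and (hL _ Kz) (hL' _ Kz)) => w [h h'] Kw; rewrite h // h'.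
Qed.
Lemma clopen_inD K L L' : clopen_in K L -> clopen_in K L' -> clopen_in K (fun z => L z /\ ~ L' z).
Proof.
move=> [LK hL] [LK' hL']; split=> [z [/LK]//|z Kz].
by apply: nearbyW (nearby_and (hL _ Kz) (hL' _ Kz)) => w [h h'] Kw; rewrite h // h'.
Qed.
Lemma clopen_in0 K : clopen_in K (fun=> False).
Proof. by split=> // z _; exact: nearbyT. Qed.
Lemma clopen_inT K : clopen_in K K.
Proof. by split=> // z Kz; exact: nearbyT. Qed.
Lemma clopen_in_clo K L : clo K -> clopen_in K L -> clo L.
Proof.
move=> cK [LK hL] z nLz; have [Kz|/cK] := pselect (K z); last by apply: nearbyW => w nK /LK.
by apply: nearbyW (hL _ Kz) => w h Lw; apply: nLz; apply/h => //; exact: LK.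
Qed.
(** By compactness of [Y] finitely many of the separating sets suffice, and their intersection is
    again clopen. *)
Lemma quasi_avoid X (x : C) Y : clo X -> X x -> cpt Y ->
  (forall y, Y y -> exists A, [/\ clopen_in X A, A x & ~ A y]) ->
  exists A, [/\ clopen_in X A, A x & forall y, Y y -> ~ A y].
Proof.
move=> cX Xx [bY cY] h.
have H y : exists p : R * (C -> Prop), [/\ 0 < p.1, clopen_in X p.2, p.2 x & forall w, md (w - y) < p.1 -> Y w -> ~ p.2 w].
  have [Yy|/cY[r r0 hr]] := pselect (Y y); last by exists (r, X); split=> //; [exact: clopen_inT | move=> w /hr].
  have [A [cA Ax nAy]] := h _ Yy.
  by have [r r0 hr] := clopen_in_clo cX cA nAy; exists (r, A); split=> // w /hr.
have [p hp] := choice H.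
have [|s hs] := @finite_cover R Y (fun y => (p y).1) bY; first by move=> y; case: (hp y).
have [A [cA Ax hA]] : exists A, [/\ clopen_in X A, A x & forall w, A w -> forall y, y \in s -> (p y).2 w].
  elim: s {hs} => [|y s [A [cA Ax hA]]]; first by exists X; split=> //; exact: clopen_inT.
  have [_ cp px _] := hp y.
  exists (fun z => A z /\ (p y).2 z); split=> //; first exact: clopen_inI.
  by move=> w [Aw pw] y'; rewrite inE => /orP[/eqP -> //|/hA]; exact.
exists A; split=> // w Yw Aw; have [y ys hy] := hs _ Yw.
by have [_ _ _] := hp y; apply; [exact: hy | exact: Yw | exact: hA].
Qed.

Lemma cpt_separated A B : cpt A -> clo B -> (forall z, A z -> ~ B z) ->
  exists2 e : R, 0 < e & forall z w, A z -> B w -> e <= md (w - z).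
Proof.
move=> cA cB AB.
have [|z Az|e e0 h] := @cpt_unif R A (fun z e => forall w, B w -> e <= md (w - z)) cA.
- by move=> z e e' h ee w Bw; apply: le_trans ee (h _ Bw).
- have [r r0 hr] := cB _ (AB _ Az); exists (r / 2); first lra.
  exists (r / 2); first lra; move=> w wz _ v Bv; rewrite leNgt; apply/negP => vw.
  by apply: (hr v) Bv; apply: le_lt_trans (mdTr _ _ w) _; lra.
- by exists e => // z w Az; exact: h.
Qed.

Definition quasi X x z := X z /\ forall A, clopen_in X A -> A x -> A z.

Lemma quasi_clo X x : clo X -> clo (quasi X x).
Proof.
move=> cX z h; have [Xz|/cX] := pselect (X z); last by apply: nearbyW => w nX [].
have [A [cA Ax nAz]] : exists A, [/\ clopen_in X A, A x & ~ A z].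
  by apply: contrapT => n; apply: h; split=> // A cA Ax; apply: contrapT => nAz; apply: n; exists A.
by apply: nearbyW (clopen_in_clo cX cA nAz) => w nAw [_ hw]; apply: nAw; exact: hw.
Qed.

(** [B] and the rest of the quasi-component are a positive distance apart, with disjoint
    neighbourhoods [U] and [V]. Some clopen set around [x] lies in their union; its part in [U] is
    clopen too, hence contains the whole quasi-component. *)
Lemma quasi_split X x B : cpt X -> X x -> clopen_in (quasi X x) B -> B x -> forall z, quasi X x z -> B z.
Proof.
move=> cX Xx cB Bx z Qz; have [bX clX] := cX; have clQ := quasi_clo (x := x) clX.
have cQ : cpt (quasi X x) by split=> //; case: bX => M hM; exists M => w [/hM].
have clB := clopen_in_clo clQ cB; have clD := clopen_in_clo clQ (clopen_inD (clopen_inT _) cB).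
have cptB : cpt B by split=> //; case: cQ => -[M hM] _; exists M => w Bw; apply: hM; case: cB => h _; exact: h.
have [|e e0 sep] := cpt_separated cptB clD; first by move=> w Bw [].
pose U w := exists2 v, B v & md (w - v) < e / 2.
pose V w := exists2 v, quasi X x v /\ ~ B v & md (w - v) < e / 2.
have oU w : U w -> nearby w U.
  move=> [v Bv wv]; exists (e / 2 - md (w - v)); first lra.
  by move=> u uw; exists v => //; apply: le_lt_trans (mdTr _ _ w) _; lra.
have oV w : V w -> nearby w V.
  move=> [v Bv wv]; exists (e / 2 - md (w - v)); first lra.
  by move=> u uw; exists v => //; apply: le_lt_trans (mdTr _ _ w) _; lra.
have UV w : U w -> ~ V w.
  move=> [v Bv wv] [v' Dv wv']; have := sep _ _ Bv Dv; have := mdTr v' v w; rewrite (mdC v' w); lra.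
have [||A [cA Ax hA]] := @quasi_avoid X x (fun w => X w /\ (~ U w /\ ~ V w)) clX Xx.
- apply: cptI => //; apply: cloI => w; by [move=> /contrapT/oU; apply: nearbyW => v Uv; apply | move=> /contrapT/oV; apply: nearbyW => v Uv; apply].
- move=> y [Xy [nU nV]]; have nQ : ~ quasi X x y.
    by move=> Qy; have [By|nB] := pselect (B y); [apply: nU; exists y | apply: nV; exists y]; rewrite ?subrr ?md0 //; lra.
  by apply: contrapT => n; apply: nQ; split=> // A cA Ax; apply: contrapT => nAz; apply: n; exists A.
have cAU : clopen_in X (fun w => A w /\ U w).
  split=> [w [/(proj1 cA)]//|w Xw]; have [Aw|nAw] := pselect (A w); last first.
    by apply: nearbyW (clopen_in_clo clX cA nAw) => v nAv _; split=> -[].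
  have [Uw|nUw] := pselect (U w).
    by apply: nearbyW (nearby_and (oU _ Uw) ((proj2 cA) _ Xw)) => v [Uv h] Xv; split=> // _; split=> //; exact/h.
  have Vw : V w by apply: contrapT => nV; exact: (hA w).
  by apply: nearbyW (oV _ Vw) => v Vv _; split=> -[_ // /UV].
have Ux : U x by exists x; rewrite ?subrr ?md0 //; lra.
have [_ Uz] := (proj2 Qz) _ cAU (conj Ax Ux).
by apply: contrapT => nB; apply: UV Uz _; exists z; rewrite ?subrr ?md0 //; lra.
Qed.

Lemma quasi_conn X x : cpt X -> X x -> conn (quasi X x).
Proof.
move=> cX Xx B cB [z0 Bz0] z Qz; have [Bx|nBx] := pselect (B x); first exact: quasi_split cB Bx _ Qz.
have Qx : quasi X x x by [].
have [_ []//] := quasi_split cX Xx (clopen_inD (clopen_inT _) cB) (conj Qx nBx) ((proj1 cB) _ Bz0).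
Qed.

Section Exhaust.
Variable X : C -> Prop.
Hypothesis (cX : clo X).
Hypothesis bcomp : forall x, X x -> exists N : R, forall A, (forall z, A z -> X z) -> A x -> conn A -> forall z, A z -> md z <= N.

(** In the compact [X'] the quasi-component of [x] is connected, so it stays within norm [N], and
    some clopen set around [x] misses the shell from [N + 1] to [N + 2]. Being away from the rim, it
    is clopen in [X] as well. *)
Lemma clopen_bounded x : X x -> exists E, [/\ clopen_in X E, bdd E & E x].
Proof.
move=> Xx; have [N' hN'] := bcomp Xx; pose N := Num.max N' (md x); pose P z := md z <= N + 2.
have Nx : md x <= N by rewrite le_max lexx orbT.
pose X' z := P z /\ X z.
have cX' : cpt X' by apply: cptI => //; exact: cpt_ball.
have X'x : X' x by split=> //; rewrite /P; lra.
have hQ z : quasi X' x z -> md z <= N.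
  move=> Qz; rewrite le_max; apply/orP; left; move: z Qz; apply: hN' => [w [[]]| |]//; exact: quasi_conn.
have [||A [cA Ax hA]] := @quasi_avoid X' x (fun z => X' z /\ ~ md z < N + 1) (proj2 cX') X'x.
- apply: cptI => // z /contrapT h; apply: nearbyW (ccont_nearby_lt (ccont_id z) h) => w hw; exact.
- move=> y [Xy ny]; have nQ : ~ quasi X' x y by move=> /hQ h; apply: ny; lra.
  by apply: contrapT => n; apply: nQ; split=> // A cA Ax; apply: contrapT => nAz; apply: n; exists A.
have AN z : A z -> md z < N + 1 by move=> Az; apply: contrapT => h; apply: (hA z) => //; split=> //; exact: (proj1 cA).
exists A; split=> //; last by exists (N + 1) => z /AN/ltW.
split=> [z /(proj1 cA)[]//|z Xz]; have [zN|Nz] := ltP (md z) (N + 2).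
  have X'z : X' z by split=> //; exact: ltW.
  apply: nearbyW (nearby_and (ccont_nearby_lt (ccont_id z) zN) ((proj2 cA) _ X'z)) => w [/ltW wN h] Xw.
  exact: h.
have h1 : N + 1 < md z by lra.
by apply: nearbyW (ccont_nearby_gt (ccont_id z) h1) => w hw _; split=> /AN; lra.
Qed.

Lemma clopen_exhaust S : bdd S -> exists E, [/\ clopen_in X E, bdd E & forall z, S z -> X z -> E z].
Proof.
move=> bS.
have H x : exists p : R * (C -> Prop), [/\ 0 < p.1, clopen_in X p.2, bdd p.2 & forall w, md (w - x) < p.1 -> X w -> p.2 w].
  have [Xx|/cX[r r0 hr]] := pselect (X x); last first.
    exists (r, (fun=> False)); split; [by [] | exact: clopen_in0 | by exists 0 | by move=> w /hr].
  have [E [cE bE Ex]] := clopen_bounded Xx.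
  by have [r r0 hr] := (proj2 cE) _ Xx; exists (r, E); split=> // w /hr h Xw; apply/h.
have [p hp] := choice H.
have [|s hs] := @finite_cover R S (fun y => (p y).1) bS; first by move=> y; case: (hp y).
have [E [cE bE hE]] : exists E, [/\ clopen_in X E, bdd E & forall y, y \in s -> forall z, (p y).2 z -> E z].
  elim: s {hs} => [|y s [E [cE [M hM] hE]]]; first by exists (fun=> False); split=> //; [exact: clopen_in0 | by exists 0].
  have [_ cp [M' hM'] _] := hp y.
  exists (fun z => (p y).2 z \/ E z); split; first exact: clopen_inU.
    by exists (Num.max M M') => z [/hM' h|/hM h]; rewrite le_max h ?orbT.
  by move=> y'; rewrite inE => /orP[/eqP -> z pz|/hE h z /h Ez]; [left|right].
exists E; split=> // z Sz Xz; have [y ys hy] := hs _ Sz.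
by have [_ _ _ h] := hp y; apply: hE ys _ _; exact: h.
Qed.
End Exhaust.

(* A [bool]-valued cocycle on a rectangle is a coboundary: bisect and glue along the common sides. *)
Section Cocycle.
Variable g : C -> C -> bool.
Definition primitive S (h : C -> bool) := forall z, S z -> nearby z (fun w => S w -> h w = h z (+) g z w).

(** On the overlap the two primitives differ by a locally constant function, which [con] makes
    constant; adding that constant to one of them makes them agree. *)
Lemma primitive_glue S1 S2 S o : clo S1 -> clo S2 -> (forall z, S z -> S1 z \/ S2 z) ->
  S1 o -> S2 o ->
  (forall k : C -> bool, (forall z, S1 z /\ S2 z -> nearby z (fun w => S1 w /\ S2 w -> k w = k z)) ->
    forall z, S1 z /\ S2 z -> k z = k o) ->
  (exists h, primitive S1 h) -> (exists h, primitive S2 h) -> exists h, primitive S h.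
Proof.
move=> c1 c2 SE o1 o2 con [h1 hh1] [h2 hh2].
have E z : S1 z /\ S2 z -> h1 z (+) h2 z = h1 o (+) h2 o.
  apply: (con (fun z => h1 z (+) h2 z)) => {}z [z1 z2].
  apply: nearbyW (nearby_and (hh1 _ z1) (hh2 _ z2)) => w [e1 e2] [w1 w2].
  by rewrite e1 // e2 //; case: (h1 z); case: (h2 z); case: (g z w).
pose c := h1 o (+) h2 o; pose h z := if `[< S1 z >] then h1 z else h2 z (+) c.
have H1 z : S1 z -> h z = h1 z by rewrite /h; case: asboolP.
have H2 z : S2 z -> h z = h2 z (+) c.
  rewrite /h; case: asboolP => // z1 z2; rewrite /c -(E z) //.
  by case: (h1 z); case: (h2 z).
exists h => z Sz.
have n1 : nearby z (fun w => S1 w -> h w = h z (+) g z w).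
  have [z1|/c1] := pselect (S1 z); last by apply: nearbyW.
  by apply: nearbyW (hh1 _ z1) => w hw w1; rewrite !H1 // hw.
have n2 : nearby z (fun w => S2 w -> h w = h z (+) g z w).
  have [z2|/c2] := pselect (S2 z); last by apply: nearbyW.
  by apply: nearbyW (hh2 _ z2) => w hw w2; rewrite !H2 // hw // addbAC.
by apply: nearbyW (nearby_and n1 n2) => w [e1 e2] /SE[]; [exact: e1 | exact: e2].
Qed.

Hypothesis loc : forall z, exists2 r : R, 0 < r & exists h, primitive (fun w => md (w - z) < r) h.

Lemma primitive_sub S S' h : (forall z, S z -> S' z) -> primitive S' h -> primitive S h.
Proof. by move=> SS hp z /SS /hp; apply: nearbyW => w hw /SS. Qed.

Lemma primitive_rect a b c d : a <= b -> c <= d -> exists h, primitive (inrect a b c d) h.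
Proof.
move=> ab cd; apply: (@cousin R (fun a b c d => a <= b -> c <= d -> exists h, primitive (inrect a b c d) h)) => //.
- move=> {ab cd} {}a {}b {}c {}d ab cd m n p1 p2 p3 p4 _ _.
  have am : a <= m by rewrite /m; lra.
  have mb : m <= b by rewrite /m; lra.
  have cn : c <= n by rewrite /n; lra.
  have nd : n <= d by rewrite /n; lra.
  have H c' d' : c' <= d' -> (exists h, primitive (inrect a m c' d') h) -> (exists h, primitive (inrect m b c' d') h) ->
     exists h, primitive (inrect a b c' d') h.
    move=> cd'; apply: (primitive_glue (o := Complex m c')).
    + exact: (proj2 (cpt_rect _ _ _ _)).
    + exact: (proj2 (cpt_rect _ _ _ _)).
    + move=> z /andP[/andP[z1 z2] /andP[z3 z4]]; rewrite /inrect z1 z2 z3 z4 /= !andbT.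
      by have [h|/ltW h] := leP (Re z) m; [left|right].
    + by rewrite /inrect /= lexx am cd' lexx.
    + by rewrite /inrect /= lexx mb cd' lexx.
    + have E z : inrect a m c' d' z /\ inrect m b c' d' z <-> inrect m m c' d' z.
        rewrite /inrect; split => [[/andP[/andP[? ->] ->] /andP[/andP[-> ?] _]]//|].
        by move=> /andP[/andP[h1 h2] ->]; rewrite h1 h2 (le_trans am h1) (le_trans h2 mb).
      move=> k hk z /E hz; apply: (@rect_const R bool k m m c' d') => //; last by rewrite /inrect /= !lexx cd'.
      by move=> w /E/hk; apply: nearbyW => v hv /E.
  have [||h12 hh12] := H c n cn; [exact: p1 | exact: p2 |].
  have [||h34 hh34] := H n d nd; [exact: p3 | exact: p4 |].
  apply: (primitive_glue (o := Complex a n)) (ex_intro _ _ hh12) (ex_intro _ _ hh34).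
  + exact: (proj2 (cpt_rect _ _ _ _)).
  + exact: (proj2 (cpt_rect _ _ _ _)).
  + move=> z /andP[/andP[z1 z2] /andP[z3 z4]]; rewrite /inrect z1 z2 z3 z4 /= !andbT.
    by have [h|/ltW h] := leP (Im z) n; [left|right].
  + by rewrite /inrect /= lexx ab cn lexx.
  + by rewrite /inrect /= lexx ab nd lexx.
  + have E z : inrect a b c n z /\ inrect a b n d z <-> inrect a b n n z.
      rewrite /inrect; split => [[/andP[-> /andP[? ->]] /andP[_ /andP[-> ?]]]//|].
      by move=> /andP[-> /andP[h1 h2]]; rewrite h1 h2 (le_trans cn h1) (le_trans h2 nd).
    move=> k hk z /E hz; apply: (@rect_const R bool k a b n n) => //; last by rewrite /inrect /= !lexx ab.
    by move=> w /E/hk; apply: nearbyW => v hv /E.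
- move=> z _; have [r r0 [h hh]] := loc z.
  exists (r / 2) => [|a' b' c' d' zx zy lb ld _ _ _ _ _ _]; first lra.
  have hz : inrect a' b' c' d' z by rewrite /inrect zx.
  by exists h; apply: primitive_sub hh => w hw; have := rect_diam hz hw; lra.
Qed.
End Cocycle.

Lemma inrect_ball (B : R) z : md z <= B -> inrect (- B) B (- B) B z.
Proof.
move=> zB; have := le_trans (Re_md z) zB; have := le_trans (Im_md z) zB.
by rewrite /inrect !ler_norml => -> ->.
Qed.

(** Four strips around the square of half-side [B] are rectangles that share corners; [|z| > 2 * B]
    places [z] in one of them. *)
Lemma frame_const (h : C -> bool) (B D : R) : 0 < B -> B <= D ->
  (forall z, inrect (- D) D (- D) D z -> B <= md z -> nearby z (fun w => inrect (- D) D (- D) D w -> h w = h z)) ->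
  forall z, 2 * B < md z -> inrect (- D) D (- D) D z -> h z = h (Complex D D).
Proof.
move=> B0 BD hh; have ND : - D <= D by lra.
have NB : - D <= B by lra.
have BN : - B <= D by lra.
have NN : - D <= - B by rewrite lerN2.
have H a b c d : - D <= a -> b <= D -> - D <= c -> d <= D -> (forall z, inrect a b c d z -> B <= md z) ->
    forall z w, inrect a b c d z -> inrect a b c d w -> h z = h w.
  move=> h1 h2 h3 h4 far; have sub z : inrect a b c d z -> inrect (- D) D (- D) D z by exact: inrectW.
  by apply: rect_const => z hz; apply: nearbyW (hh _ (sub _ hz) (far _ hz)) => w hw /sub.
have far z x : `|x| <= md z -> B <= x \/ x <= - B -> B <= md z.
  by move=> xz hx; apply: le_trans xz; rewrite ler_normr; apply/orP; case: hx => hx; [left | right; rewrite lerNr].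
have right := H B D (- D) D NB (lexx D) (lexx _) (lexx D)
  (fun z hz => far z _ (Re_md z) (or_introl (proj1 (andP (proj1 (andP hz)))))).
have top := H (- D) D B D (lexx _) (lexx D) NB (lexx D)
  (fun z hz => far z _ (Im_md z) (or_introl (proj1 (andP (proj2 (andP hz)))))).
have left := H (- D) (- B) (- D) D (lexx _) BN (lexx _) (lexx D)
  (fun z hz => far z _ (Re_md z) (or_intror (proj2 (andP (proj1 (andP hz)))))).
have bot := H (- D) D (- D) (- B) (lexx _) (lexx D) (lexx _) BN
  (fun z hz => far z _ (Im_md z) (or_intror (proj2 (andP (proj2 (andP hz)))))).
have cor1 : h (Complex (- D) D) = h (Complex D D) by apply: top; rewrite /inrect /= !lexx ND BD.
have cor2 : h (Complex D (- D)) = h (Complex D D) by apply: right; rewrite /inrect /= !lexx ND BD.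
move=> z zB /andP[/andP[z1 z2] /andP[z3 z4]].
have [h1|h1] := leP B (Re z); first by apply: right; rewrite /inrect /= ?h1 ?z2 ?z3 ?z4 ?lexx ?BD ?ND.
have [h2|h2] := leP (Re z) (- B).
  by rewrite -cor1; apply: left; rewrite /inrect /= ?h2 ?z1 ?z3 ?z4 ?lexx ?NN ?ND.
have [h3|h3] := leP B (Im z); first by apply: top; rewrite /inrect /= ?h3 ?z1 ?z2 ?z4 ?lexx ?BD ?ND.
have [h4|h4] := leP (Im z) (- B).
  by rewrite -cor2; apply: bot; rewrite /inrect /= ?h4 ?z1 ?z2 ?z3 ?lexx ?NN ?ND.
have rB : `|Re z| <= B by rewrite ler_norml !ltW.
have iB : `|Im z| <= B by rewrite ler_norml !ltW.
have := md_ReIm z; lra.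
Qed.

Section Level.
Variables (F : C -> C) (rho : R).
Hypothesis eF : entire F.
Definition bd S z := S z /\ ~ nearby z S.
Let K z := md (F z) <= rho.
Hypothesis bcomp : forall x, bd K x -> exists N : R, forall A, (forall z, A z -> bd K z) -> A x -> conn A -> forall z, A z -> md z <= N.

Lemma clo_bd S : clo S -> clo (bd S).
Proof.
move=> cS z h; have [Sz|/cS] := pselect (S z); last by apply: nearbyW => w nS [].
have : nearby z S by apply: contrapT => n; apply: h.
by move=> /nearby_nearby; apply: nearbyW => w hw [].
Qed.

Lemma bd_const S z : clo S -> ~ bd S z -> nearby z (fun w => `[< S w >] = `[< S z >]).
Proof.
move=> cS h; have [Sz|nSz] := pselect (S z); last first.
  by apply: nearbyW (cS _ nSz) => w nSw; rewrite !(asboolF _).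
have : nearby z S by apply: contrapT => n; apply: h.
by apply: nearbyW => w Sw; rewrite !asboolT.
Qed.

(** [E] is a bounded clopen part of the boundary of [K] containing all of it within the square [S],
    and [h] flips when [E] is crossed. Far out [h] is a constant [c]; the points of [K] with
    [h <> c] are those enclosed by [E]. *)
Theorem bounded_pieces w0 (M : R) : rho < md (F w0) ->
  exists L, [/\ clopen_in K L, bdd L & forall z, md z <= M -> K z -> L z].
Proof.
move=> Ww0; have cK : clo K by apply: clo_sublevel => z; exact: entire_cont.
pose N0 := Num.max `|M| (md w0); pose S := inrect (- N0) N0 (- N0) N0.
have N00 : 0 <= N0 by rewrite le_max normr_ge0.
have [E [cE [ME hME] hE]] := clopen_exhaust (clo_bd cK) bcomp (proj1 (cpt_rect (- N0) N0 (- N0) N0)).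
have clE := clopen_in_clo (clo_bd cK) cE.
pose B := 1 + N0 + `|ME|; have B0 : 0 < B by rewrite /B; have := normr_ge0 ME; lra.
have EB z : E z -> md z < B by move=> /hME; rewrite /B; have := ler_norm ME; lra.
have NB : N0 < B by rewrite /B; have := normr_ge0 ME; lra.
clearbody B.
(* The cocycle records a change of membership in [K], but only for steps starting in [E]. *)
pose k z := `[< K z >]; pose g z w := `[< E z >] && (k w (+) k z).
have gE z w : E z -> g z w = k w (+) k z by move=> Ez; rewrite /g asboolT.
have gN z w : ~ E z -> g z w = false by move=> Ez; rewrite /g asboolF.
have kW v : rho < md (F v) -> k v = false by move=> Wv; apply: asboolF; rewrite /K leNgt Wv.
have kK v : K v -> k v = true by move=> Kv; apply: asboolT.
have [z|||h hh] := @primitive_rect g _ (- (3 * B)) (3 * B) (- (3 * B)) (3 * B); [|lra|lra|].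
  have [Ez|nEz] := pselect (E z); last first.
    have [r r0 hr] := clE _ nEz; exists r => //; exists (fun=> false) => w wz.
    by apply: nearbyT => v _; rewrite gN //; exact: hr.
  have [r r0 hr] := (proj2 cE) _ ((proj1 cE) _ Ez); exists r => //; exists k => w wz.
  have [Ew|nEw] := pselect (E w); first by apply: nearbyT => v _; rewrite gE //; case: (k v); case: (k w).
  have : ~ bd K w by move=> bw; apply: nEw; apply/(hr _ wz bw).
  by move=> /(bd_const cK); apply: nearbyW => v kv _; rewrite gN // addbF.
set Q := inrect _ _ _ _ in hh.
have QB z : md z < 3 * B -> Q z by move=> /ltW; exact: inrect_ball.
pose c := h (Complex (3 * B) (3 * B)).
have out z : 2 * B < md z -> md z < 3 * B -> h z = c.
  have B3 : B <= 3 * B by lra.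
  move=> zB zB'; apply: (frame_const B0 B3) => //; last exact: QB.
  move=> {zB zB'}z Qz zB; apply: nearbyW (hh _ Qz) => w hw Qw; rewrite hw // gN ?addbF //.
  by move=> /EB; lra.
have far z : 3 * B <= md z -> nearby z (fun w => md w < 3 * B -> h w = c).
  move=> zB; have : 2 * B < md z by lra.
  by move=> /(ccont_nearby_gt (ccont_id z)); apply: nearbyW => w; exact: out.
have near z : md z < 3 * B -> nearby z (fun w => md w < 3 * B /\ h w = h z (+) g z w).
  move=> zB; apply: nearbyW (nearby_and (ccont_nearby_lt (ccont_id z) zB) (hh _ (QB _ zB))) => w [wB hw].
  by split=> //; exact: hw (QB _ wB).
(* Otherwise the points with [h <> c] and [|F|] at least [|F z|] form a compact set that contradicts
   [max_principle]. *)
have hW z : md z < 3 * B -> rho < md (F z) -> h z = c.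
  have same p : rho < md (F p) -> md p < 3 * B -> nearby p (fun w => md w < 3 * B /\ h w = h p).
    move=> Wp pB; apply: nearbyW (nearby_and (ccont_nearby_gt (entire_cont p eF) Wp) (near _ pB)) => w [Ww [wB ->]].
    split=> //; have -> : g p w = false; last by rewrite addbF.
    by rewrite /g !kW // andbF.
  move=> zB Wz; apply: contrapT => hz.
  apply: (@max_principle R F (fun w => md w < 3 * B /\ h w <> c /\ md (F z) <= md (F w))).
  - split; first by exists (3 * B) => w [/ltW].
    move=> w nw; have [wB|Bw] := ltP (md w) (3 * B); last first.
      by apply: nearbyW (far _ Bw) => v hv [/hv hc [hn _]]; exact: hn.
    have [zw|wz] := leP (md (F z)) (md (F w)); last first.
      by apply: nearbyW (ccont_nearby_lt (entire_cont w eF) wz) => v hv [_ [_]]; rewrite leNgt hv.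
    have hw : h w = c by apply: contrapT => hw; apply: nw.
    by apply: nearbyW (same _ (lt_le_trans Wz zw) wB) => v [_ ->] [_ [hn _]]; exact: hn.
  - by exists z.
  - by move=> p _; exact: entire_hol.
  - move=> p [pB [hp zp]]; apply: nearbyW (same _ (lt_le_trans Wz zp) pB) => v [vB ->] pv.
    by split=> //; split=> //; exact: le_trans zp pv.
exists (fun z => K z /\ md z < 3 * B /\ h z <> c); split.
- split=> [z []//|z Kz]; have [zB|Bz] := ltP (md z) (3 * B).
    apply: nearbyW (near _ zB) => w [wB hw] Kw.
    have -> : h w = h z by rewrite hw /g !kK // andbF addbF.
    by split=> -[_ [_ hc]].
  by apply: nearbyW (far _ Bz) => w hw Kw; split=> -[_ [wB hc]] //; case: hc; exact: hw.
- by exists (3 * B) => z [_ [/ltW]].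
- move=> z zM Kz; have Sz : S z.
    by apply: inrect_ball; apply: le_trans zM _; rewrite le_max ler_norm.
  have Sw : S w0 by apply: inrect_ball; rewrite le_max lexx orbT.
  have SB w : S w -> md w < 3 * B.
    move=> /andP[]; rewrite -!ler_norml => h1 h2; have := md_ReIm w; lra.
  (* On [S] every boundary point of [K] is in [E], so [h] and [k] change together; as [w0] is
     outside [K] and has [h w0 = c], points of [K] in [S] have [h <> c]. *)
  have e : h z (+) k z = h w0 (+) k w0.
    apply: (@rect_const R bool (fun w => h w (+) k w) (- N0) N0 (- N0) N0) => // w Sww.
    have [Ew|nEw] := pselect (E w).
      by apply: nearbyW (near _ (SB _ Sww)) => v [_ ->] _; rewrite gE //; case: (h w); case: (k v); case: (k w).
    have nb : ~ bd K w by move=> /hE bw; apply: nEw; exact: bw.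
    by apply: nearbyW (nearby_and (near _ (SB _ Sww)) (bd_const cK nb)) => v [[_ ->] kv] _; rewrite gN // addbF /k kv.
  split=> //; split; first exact: SB.
  move=> hz; move: e; rewrite hz (hW w0) ?SB // (kW w0) // (kK z) //.
  by case: (c).
Qed.
End Level.
End Pieces.

(** * The Ahlfors comparison *)
Section Asymptotics.
Variable R : realType.
Local Notation C := R[i].
Implicit Types (phi psi t l r : C -> C) (n m : nat).

(** Landau's [o(h ^ n)], and below [O(h ^ n)], at 0; the non-strict bounds include [h = 0]. *)
Definition lo n phi := forall e : R, 0 < e -> nearby 0 (fun h => md (phi h) <= e * md h ^+ n).
Definition bo n phi := exists2 K : R, 0 < K & nearby 0 (fun h => md (phi h) <= K * md h ^+ n).

Lemma lo_ext n phi psi : (forall h, phi h = psi h) -> lo n phi -> lo n psi.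
Proof. by move=> e hl d d0; apply: nearbyW (hl _ d0) => h; rewrite e. Qed.
Lemma bo_ext n phi psi : (forall h, phi h = psi h) -> bo n phi -> bo n psi.
Proof. by move=> e [K K0 hK]; exists K => //; apply: nearbyW hK => h; rewrite e. Qed.
Lemma lo_near n phi psi : nearby 0 (fun h => phi h = psi h) -> lo n phi -> lo n psi.
Proof. by move=> e hl d d0; apply: nearbyW (nearby_and e (hl _ d0)) => h [->]. Qed.
Lemma loD n phi psi : lo n phi -> lo n psi -> lo n (fun h => phi h + psi h).
Proof.
move=> h1 h2 e e0; have e2 : 0 < e / 2 by lra.
apply: nearbyW (nearby_and (h1 _ e2) (h2 _ e2)) => h [k1 k2].
by apply: le_trans (mdD _ _) _; lra.
Qed.
Lemma loN n phi : lo n phi -> lo n (fun h => - phi h).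
Proof. by move=> h1 e /h1; apply: nearbyW => h; rewrite mdN. Qed.
Lemma loB n phi psi : lo n phi -> lo n psi -> lo n (fun h => phi h - psi h).
Proof. by move=> h1 h2; apply: loD => //; exact: loN. Qed.
Lemma lo_bo n phi : lo n phi -> bo n phi.
Proof. by move=> h1; exists 1 => //; exact: h1. Qed.
Lemma bo_lo n phi : bo n.+1 phi -> lo n phi.
Proof.
move=> [K K0 hK] e e0; have eK : 0 < e / K by rewrite divr_gt0.
apply: nearbyW (nearby_and hK (@nearby_lt R 0 _ eK)) => h [k1 k2].
apply: le_trans k1 _; rewrite subr0 ltr_pdivlMr // mulrC in k2.
by rewrite exprS mulrA ler_wpM2r ?exprn_ge0 ?md_ge0 // ltW.
Qed.
Lemma lo_le n phi : lo n.+1 phi -> lo n phi. Proof. by move=> /lo_bo/bo_lo. Qed.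
Lemma boD n phi psi : bo n phi -> bo n psi -> bo n (fun h => phi h + psi h).
Proof.
move=> [K K0 h1] [L L0 h2]; exists (K + L); first lra.
apply: nearbyW (nearby_and h1 h2) => h [k1 k2].
by apply: le_trans (mdD _ _) _; lra.
Qed.
Lemma boM n m phi psi : bo n phi -> bo m psi -> bo (n + m) (fun h => phi h * psi h).
Proof.
move=> [K K0 h1] [L L0 h2]; exists (K * L); first exact: mulr_gt0.
apply: nearbyW (nearby_and h1 h2) => h [k1 k2].
by rewrite mdM exprD mulrACA ler_pM ?md_ge0.
Qed.
Lemma loM n m phi psi : lo n phi -> bo m psi -> lo (n + m) (fun h => phi h * psi h).
Proof.
move=> h1 [L L0 h2] e e0; have eL : 0 < e / L by rewrite divr_gt0.
apply: nearbyW (nearby_and (h1 _ eL) h2) => h [k1 k2].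
rewrite mdM exprD (_ : e * _ = e / L * md h ^+ n * (L * md h ^+ m)) ?ler_pM ?md_ge0 //.
by field; rewrite gt_eqF.
Qed.
Lemma bo_cst c : bo 0 (fun=> c).
Proof.
exists (1 + md c); first by have := md_ge0 c; lra.
by apply: nearbyT => h; rewrite expr0 mulr1; lra.
Qed.
Lemma bo_id : bo 1 (fun h => h).
Proof. by exists 1 => //; apply: nearbyT => h; rewrite mul1r expr1. Qed.
Lemma lo_unit n phi u : md u = 1 -> lo n phi -> lo n (fun h => phi (u * h)).
Proof.
move=> u1 hl e /hl[r r0 hr]; exists r => // h; rewrite subr0 => hh.
have := hr (u * h); rewrite subr0 mdM u1 mul1r; exact.
Qed.
Lemma loZ n c phi : lo n phi -> lo n (fun h => c * phi h).
Proof.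
move=> h1; have := loM h1 (bo_cst c); rewrite addn0; apply: lo_ext => h; exact: mulrC.
Qed.

Let I : C := 'i%C.
(** Sum, and below product, over the rotations by powers of [i]. The sum annihilates holomorphic
    terms of degrees 1 and 2, so what it leaves at order 2 measures the Laplacian. *)
Definition rsum phi h := phi h + phi (- h) + (phi (I * h) + phi (- (I * h))).
Definition rprod phi h := phi h * phi (- h) * (phi (I * h) * phi (- (I * h))).

Lemma ii : I * I = -1. Proof. by have := sqr_i R; rewrite expr2. Qed.
Lemma lo_rots n phi : lo n phi -> [/\ lo n (fun h => phi (- h)), lo n (fun h => phi (I * h)) & lo n (fun h => phi (- (I * h)))].
Proof.
move=> hl; split.
- by have := @lo_unit n phi (- 1) _ hl; rewrite mdN md1 => /(_ erefl); apply: lo_ext => h; rewrite mulN1r.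
- by apply: lo_unit hl; exact: mdi.
- by have := @lo_unit n phi (- I) _ hl; rewrite mdN mdi => /(_ erefl); apply: lo_ext => h; rewrite mulNr.
Qed.
Lemma lo_rsum n phi : lo n phi -> lo n (rsum phi).
Proof. by move=> hl; have [h1 h2 h3] := lo_rots hl; apply: loD; apply: loD. Qed.

(** Formally [ln t = (t - 1) - l ^ 2 / 2 + o(h ^ 2)]. Summed over the rotations, the terms [t - 1]
    cancel by assumption, and [l h ^ 2] and [l (i h) ^ 2] occur twice each. *)
Lemma lo_rprod t l : (forall h, l (- h) = - l h) -> bo 1 l -> lo 1 (fun h => t h - 1 - l h) ->
  lo 2 (fun h => rsum t h - 4) -> lo 2 (fun h => rprod t h - 1 + (l h ^+ 2 + l (I * h) ^+ 2)).
Proof.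
move=> lN bl h1 h2; pose r h := t h - 1 - l h.
have [r1 r2 r3] := lo_rots (h1 : lo 1 r).
have bli : bo 1 (fun h => l (I * h)).
  have [K K0 [d d0 hd]] := bl; exists K => //; exists d => // h; rewrite subr0 => hh.
  by have := hd (I * h); rewrite subr0 mdM mdi mul1r; exact.
pose A h := t h * t (- h) - 1; pose B h := t (I * h) * t (- (I * h)) - 1.
have key (l' r' s' : C -> C) : bo 1 l' -> lo 1 r' -> lo 1 s' ->
   lo 2 (fun h => (1 + l' h + r' h) * (1 - l' h + s' h) - 1 - (r' h + s' h) + l' h ^+ 2).
  move=> bl' lr ls; have := loD (loM (loB ls lr) bl') (loM lr (lo_bo ls)).
  by apply: lo_ext => h; ring.
have key1 (l' r' s' : C -> C) : bo 1 l' -> lo 1 r' -> lo 1 s' ->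
   lo 1 (fun h => (1 + l' h + r' h) * (1 - l' h + s' h) - 1).
  move=> bl' lr ls; have := loB (loD (lo_le (key _ _ _ bl' lr ls)) (loD lr ls)) (bo_lo (boM bl' bl')).
  by apply: lo_ext => h; ring.
have EA h : (1 + l h + r h) * (1 - l h + r (- h)) = t h * t (- h).
  by rewrite /r lN; ring.
have EB h : (1 + l (I * h) + r (I * h)) * (1 - l (I * h) + r (- (I * h))) = t (I * h) * t (- (I * h)).
  by rewrite /r lN; ring.
have kA := key _ _ _ bl (h1 : lo 1 r) r1; have kB := key _ _ _ bli r2 r3.
have kA1 := key1 _ _ _ bl (h1 : lo 1 r) r1; have kB1 := key1 _ _ _ bli r2 r3.
have := loD (loD (loD kA kB) (loM kA1 (lo_bo kB1))) h2.
apply: lo_ext => h; rewrite !EA /rprod /rsum /r !lN; ring.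
Qed.

Lemma hol_jet G p : hol G p -> exists a b, lo 2 (fun h => G (p + h) - (G p + a * h + b * h ^+ 2)).
Proof.
move=> hG; have [g [Gg hg]] := hol_div hG; have [g2 [gg hg2]] := hol_div (hg _ hG).
exists (g p), (g2 p) => e e0.
have [r r0 hr] := hol_cont (hg2 _ (hg _ hG)) e0.
exists r => // h; rewrite subr0 => hh.
have := hr (p + h); rewrite addrC addKr => /(_ hh)/ltW h1.
rewrite Gg gg [_ - p]addrC addKr.
rewrite (_ : _ - _ = (g2 (p + h) - g2 p) * h ^+ 2); last by ring.
by rewrite mdM mdX ler_wpM2r // exprn_ge0 // md_ge0.
Qed.

Lemma lo_cdiff G p a : G p != 0 -> lo 1 (fun h => G (p + h) / G p - 1 - a * h) -> cdiff G p (a * G p).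
Proof.
move=> Gp /(loZ (G p)) hl e /hl [r r0 hr]; exists r => // w wr.
have := hr (w - p); rewrite subr0 expr1 [p + _]addrC subrK => /(_ wr).
by rewrite (_ : G p * _ = G w - G p - a * G p * (w - p)) //; field.
Qed.

(** For complex linear [l] the two squares in [lo_rprod] cancel, since [(i h) ^ 2 = - h ^ 2]. This
    is harmonicity of [ln |G|] in multiplicative form. *)
Lemma hol_rot G p : hol G p -> G p != 0 -> exists a, lo 1 (fun h => G (p + h) / G p - 1 - a * h) /\
   lo 2 (fun h => rprod (fun h => G (p + h) / G p) h - 1).
Proof.
move=> hG Gp; have [a [b jet]] := hol_jet hG; exists (a / G p).
have h0 : lo 2 (fun h => G (p + h) / G p - 1 - a / G p * h - b / G p * h ^+ 2).
  by have := loZ (G p)^-1 jet; apply: lo_ext => h; field.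
have h1 : lo 1 (fun h => G (p + h) / G p - 1 - a / G p * h).
  have := bo_lo (boM (bo_cst (b / G p)) (boM bo_id bo_id)).
  by move=> /(loD (lo_le h0)); apply: lo_ext => h; rewrite expr2 addrNK.
split=> //; have bl : bo 1 (fun h => a / G p * h) := boM (bo_cst _) bo_id.
have sm : lo 2 (fun h => rsum (fun h => G (p + h) / G p) h - 4).
  have := lo_rsum h0; apply: lo_ext => h; rewrite /rsum !sqrrN exprMn [I ^+ 2]expr2 ii; ring.
have := lo_rprod (fun h => mulrN _ _) bl h1 sm.
by apply: lo_ext => h; rewrite !exprMn [I ^+ 2]expr2 ii; ring.
Qed.

(** From [|1 + x| ^ 2 = 1 + (2 Re x + |x| ^ 2)] and [s - 2 s ^ 2 <= ln (1 + s) <= s] for [s] in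
    [[-1/2, 1]]; 6 and 3 are generous. *)
Lemma ln_md1D (x : C) : md x <= 1 / 4 -> `|ln (md (1 + x)) - Re x| <= 6 * md x ^+ 2 /\ `|ln (md (1 + x))| <= 3 * md x.
Proof.
move=> x4; have xR := Re_md x; have x0 := md_ge0 x; have /andP[xl xr] : - md x <= Re x <= md x by rewrite -ler_norml.
have x2 : md x ^+ 2 <= md x / 4 by rewrite expr2 ler_wpM2l //; lra.
have x22 : 0 <= md x ^+ 2 by rewrite exprn_ge0.
pose m := md (1 + x).
have m1 : 1 - md x <= m <= 1 + md x.
  apply/andP; split; last by have := mdD 1 x; rewrite md1.
  by have := mdDr 1 x; rewrite md1.
case/andP: m1 => m1 m2.
have m0 : 0 < m by lra.
have mm : m ^+ 2 = 1 + (2 * Re x + md x ^+ 2).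
  by rewrite /m !md_sqr ReD ImD /=; ring.
have lm : ln (m ^+ 2) = ln m * 2 by rewrite lnXn // mulr_natr.
have ub (s : R) : -1 < s -> ln (1 + s) <= s := @le_ln1Dx R s.
have lb (s : R) : - (1 / 2) <= s -> s <= 1 -> s - 2 * s ^+ 2 <= ln (1 + s).
  move=> s1 s2; have p1 : 0 < 1 + s by lra.
  have q0 : (1 + s)^-1 = 1 - s / (1 + s) by field; rewrite gt_eqF.
  have q : 0 < 1 - s / (1 + s) by rewrite -q0 invr_gt0.
  rewrite -[in leRHS](invrK (1 + s)) q0.
  rewrite lnV ?posrE //; rewrite lerNr; apply: le_trans (ub _ _) _; first by lra.
  rewrite lerNl opprK ler_pdivlMr //; have := sqr_ge0 s; nra.
have := ub (2 * Re x + md x ^+ 2) ltac:(lra); have := lb (2 * Re x + md x ^+ 2) ltac:(lra) ltac:(lra).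
rewrite -mm lm => h1 h2.
have h3 : (2 * Re x + md x ^+ 2) ^+ 2 <= 6 * md x ^+ 2.
  have : `|2 * Re x + md x ^+ 2| <= 9 / 4 * md x by rewrite ler_norml; apply/andP; split; lra.
  rewrite -(ler_pXn2r (n:=2)) ?nnegrE ?mulr_ge0 // real_normK ?num_real // exprMn; lra.
move: h1 h2 h3 xl xr x2 x22; rewrite -/m; clear; split; rewrite ler_norml; apply/andP; split; lra.
Qed.

Lemma nearby_small phi n : bo n.+1 phi -> forall e : R, 0 < e -> nearby 0 (fun h => md (phi h) <= e).
Proof.
move=> /bo_lo hl e e0; apply: nearbyW (nearby_and (hl _ e0) (@nearby_lt R 0 1 ltr01)) => h [h1].
rewrite subr0 => /ltW h2; apply: le_trans h1 _; rewrite ler_piMr ?(ltW e0) //.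
by rewrite exprn_ile1 ?md_ge0.
Qed.

(** The four logarithms add up to the logarithm of the modulus of the product in [hol_rot], which is
    [1 + o(h ^ 2)]. *)
Lemma ln_rot G p : hol G p -> G p != 0 -> exists a, [/\ cdiff G p (a * G p),
   lo 1 (fun h => (ln (md (G (p + h))) - ln (md (G p)) - Re (a * h))%:C%C) &
   lo 2 (rsum (fun h => (ln (md (G (p + h))) - ln (md (G p)))%:C%C))].
Proof.
move=> hG Gp; have [a [h1 h2]] := hol_rot hG Gp; exists a.
pose w h := G (p + h) / G p - 1.
have bw : bo 1 w.
  have := boD (lo_bo h1) (boM (bo_cst a) bo_id).
  by apply: bo_ext => h; rewrite addrNK.
have m0 : 0 < md (G p) by rewrite md_gt0.
have nz : nearby 0 (fun h => 0 < md (G (p + h))).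
  have [r r0 hr] := ccontN0 (hol_cont hG) Gp; exists r => // h; rewrite subr0 => hh.
  by rewrite md_gt0; have [] := hr (p + h); rewrite // addrC addKr.
have lE : nearby 0 (fun h => ln (md (G (p + h))) - ln (md (G p)) = ln (md (1 + w h))).
  apply: nearbyW nz => h h0; rewrite /w [1 + _]addrC subrK mdf ln_div ?posrE //.
have q4 : (0:R) < 1 / 4 by lra.
have sw := nearby_small bw q4.
split; first exact: lo_cdiff.
  have h3 : lo 1 (fun h => (ln (md (1 + w h)) - Re (w h))%:C%C).
    have [K K0 hK] := boM bw bw.
    suff : bo 2 (fun h => (ln (md (1 + w h)) - Re (w h))%:C%C) by exact: bo_lo.
    exists (6 * K); first lra.
    apply: nearbyW (nearby_and sw hK) => h [s1 s2]; rewrite mdr.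
    apply: le_trans (ln_md1D s1).1 _; rewrite -mulrA ler_wpM2l // expr2 -mdM; exact: s2.
  have h4 : lo 1 (fun h => (Re (w h) - Re (a * h))%:C%C).
    move=> e /h1; apply: nearbyW => h; rewrite mdr -ReB; apply: le_trans; exact: Re_md.
  apply: lo_near (loD h3 h4); apply: nearbyW lE => h ->.
  by rewrite -rmorphD /= addrA subrK.
pose W h := rprod (fun h => G (p + h) / G p) h - 1.
have [K K0 hK] := lo_bo h2.
have sW := nearby_small (lo_bo h2) q4.
have sum : nearby 0 (fun h => rsum (fun h => (ln (md (G (p + h))) - ln (md (G p)))%:C%C) h = (ln (md (1 + W h)))%:C%C).
  have [r r0 hr] := nz; exists r => // h; rewrite subr0 => hh.
  have n1 : 0 < md (G (p + h)) by apply: hr; rewrite subr0.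
  have n2 : 0 < md (G (p + - h)) by apply: hr; rewrite subr0 mdN.
  have n3 : 0 < md (G (p + I * h)) by apply: hr; rewrite subr0 mdM mdi mul1r.
  have n4 : 0 < md (G (p + - (I * h))) by apply: hr; rewrite subr0 mdN mdM mdi mul1r.
  rewrite /rsum /W [1 + _]addrC subrK /rprod !mdM !mdV.
  have v0 : 0 < (md (G p))^-1 by rewrite invr_gt0.
  rewrite !lnM ?posrE ?mulr_gt0 // lnV ?posrE // -!rmorphD /=; congr (_%:C)%C; ring.
move=> e e0; have e3 : 0 < e / 3 by lra.
apply: nearbyW (nearby_and (nearby_and sum sW) (h2 _ e3)) => h [[-> s1] s2].
rewrite mdr; apply: le_trans (ln_md1D s1).2 _; rewrite /W; lra.
Qed.

(* [u] stands for [u0 -+ ln |G|]: a harmonic [u] has [ln u] of Laplacian [- (|grad u| / u)^2]. *)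
Lemma harmonic_rot (u : C -> R) p a : u p != 0 ->
   lo 1 (fun h => (u (p + h) - u p - Re (a * h))%:C%C) ->
   lo 2 (rsum (fun h => (u (p + h) - u p)%:C%C)) ->
   lo 2 (fun h => rprod (fun h => (u (p + h) / u p)%:C%C) h - 1 + ((md a / u p) ^+ 2 * md h ^+ 2)%:C%C).
Proof.
move=> up h1 h2; pose l h := (Re (a * h) / u p)%:C%C : C.
have lN h : l (- h) = - l h by rewrite /l mulrN ReN mulNr rmorphN.
have bl : bo 1 l.
  exists (md a / `|u p| + 1); first by rewrite ltr_wpDl // divr_ge0 ?md_ge0.
  apply: nearbyT => h; rewrite mdr expr1 normrM normfV mulrDl mul1r.
  apply: ler_wpDr; first exact: md_ge0.
  by rewrite mulrAC ler_wpM2r ?invr_ge0 // -mdM Re_md.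
have cE (x : R) : (x / u p)%:C%C = ((u p)^-1)%:C%C * x%:C%C :> C by rewrite -rmorphM mulrC.
have t1 : lo 1 (fun h => (u (p + h) / u p)%:C%C - 1 - l h).
  have := loZ ((u p)^-1)%:C%C h1; apply: lo_ext => h.
  rewrite /l -(rmorph1 (real_complex R)) -!rmorphB -rmorphM /=; congr (_%:C)%C; field; exact: up.
have t2 : lo 2 (fun h => rsum (fun h => (u (p + h) / u p)%:C%C) h - 4).
  have := loZ ((u p)^-1)%:C%C h2; apply: lo_ext => h.
  rewrite /rsum -(rmorph_nat (real_complex R)) -!rmorphD -rmorphB -rmorphM /=; congr (_%:C)%C; field; exact: up.
have := lo_rprod lN bl t1 t2; apply: lo_ext => h; congr (_ + _).
rewrite /l -!rmorphXn -rmorphD /=; congr (_%:C)%C.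
rewrite !expr_div_n -mulrDl [RHS]mulrAC -exprMn -mdM md_sqr; congr (_ / _).
have -> : Re (a * (I * h)) = - Im (a * h) :> R by rewrite /I; case: (a) (h) => ? ? [? ?] /=; ring.
by rewrite sqrrN.
Qed.

Lemma rprod_real (q : C -> R) h : rprod (fun h => (q h)%:C%C) h =
  (q h * q (- h) * (q (I * h) * q (- (I * h))))%:C%C.
Proof. by rewrite /rprod !rmorphM. Qed.

Lemma laplacian_arith (e A B S X Y g : R) : 0 < e -> 0 < S -> 0 <= A -> 0 <= X -> e / 4 * S <= 1 ->
  1 - e / 4 * S <= g -> g * X <= Y -> 1 - A * S - e / 4 * S <= X -> Y <= 1 - B * S + e / 4 * S -> B <= A + e.
Proof.
move=> e0 S0 A0 X0 es g1 key X1 Y1; rewrite -(ler_pM2r S0).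
have k1 : (1 - e / 4 * S) * X <= g * X by rewrite ler_wpM2r.
have k2 : (1 - e / 4 * S) * (1 - A * S - e / 4 * S) <= (1 - e / 4 * S) * X by rewrite ler_wpM2l ?subr_ge0.
have k3 : 0 <= e * S by rewrite ltW // mulr_gt0.
have k4 : 0 <= e * S * (A * S) by rewrite !mulr_ge0 // ltW.
have k5 : 0 <= (e * S) ^+ 2 by rewrite sqr_ge0.
lra.
Qed.

(** Discrete form of the sign of the Laplacian at a maximum: multiplying [|g| x <= y] over the four
    rotations of a step of length [s] gives [1 - A s ^ 2 <= 1 - B s ^ 2 + o(s ^ 2)]. The factor [g]
    drops out, [ln |g|] being harmonic to this order. *)
Lemma local_max_laplacian (g : C -> C) (x y : C -> R) (A B : R) :
  lo 2 (fun h => rprod g h - 1) ->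
  lo 2 (fun h => rprod (fun h => (x h)%:C%C) h - 1 + (A * md h ^+ 2)%:C%C) ->
  lo 2 (fun h => rprod (fun h => (y h)%:C%C) h - 1 + (B * md h ^+ 2)%:C%C) ->
  nearby 0 (fun h => 0 <= x h /\ md (g h) * x h <= y h) -> 0 <= A -> B <= A.
Proof.
move=> hg hx hy [d d0 hd] A0; apply/ler_addgt0Pr => e e0; have e4 : 0 < e / 4 by lra.
have [r r0 hr] := nearby_and (nearby_and (hg _ e4) (hx _ e4)) (hy _ e4).
pose s := Num.min (Num.min r d) (Num.min 1 (e / 4)^-1) / 2.
have s0 : 0 < s by rewrite divr_gt0 // !lt_min r0 d0 ltr01 invr_gt0 e4.
have [sr sd s1 se] : [/\ s < r, s < d, s < 1 & s < (e / 4)^-1].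
  have : 2 * s <= Num.min (Num.min r d) (Num.min 1 (e / 4)^-1) by rewrite /s mulrC divfK.
  by rewrite !le_min => /andP[/andP[r1 r2] /andP[r3 r4]]; move: s0 r1 r2 r3 r4; clear; split; lra.
clearbody s; pose h : C := s%:C%C; have mh : md h = s by rewrite mdr ger0_norm // ltW.
have := hr h; rewrite subr0 mh => /(_ sr) [[h1 h2] h3].
have dn u : md u = 1 -> 0 <= x (u * h) /\ md (g (u * h)) * x (u * h) <= y (u * h).
  by move=> u1; apply: hd; rewrite subr0 mdM u1 mul1r mh.
have [x1 y1] := dn 1 (md1 R); have [x2 y2] := dn (- 1) ltac:(by rewrite mdN md1).
have [x3 y3] := dn I (mdi R); have [x4 y4] := dn (- I) ltac:(by rewrite mdN mdi).
rewrite mul1r in x1 y1; rewrite mulN1r in x2 y2; rewrite mulNr in x4 y4.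
have key : md (rprod g h) * (x h * x (- h) * (x (I * h) * x (- (I * h)))) <= y h * y (- h) * (y (I * h) * y (- (I * h))).
  rewrite /rprod !mdM; apply: (@le_trans _ _ ((md (g h) * x h) * (md (g (- h)) * x (- h)) * ((md (g (I * h)) * x (I * h)) * (md (g (- (I * h))) * x (- (I * h)))))).
    by apply: le_of_eq; ring.
  by rewrite !ler_pM ?mulr_ge0 ?md_ge0.
move: h2 h3; rewrite !rprod_real -(rmorph1 (real_complex R)) -!rmorphB -!rmorphD /= !mdr.
set X := x h * _ * _ in key *; set Y := y h * _ * _ in key *.
rewrite !ler_norml => /andP[h2 _] /andP[_ h3].
have g1 : 1 - e / 4 * s ^+ 2 <= md (rprod g h).
  by have := mdDr 1 (rprod g h - 1); rewrite addrCA subrr addr0 md1; move: h1; clear; lra.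
have s2 : 0 < s ^+ 2 by rewrite exprn_gt0.
have X0 : 0 <= X by rewrite !mulr_ge0.
have es : e / 4 * s ^+ 2 <= 1.
  have : e / 4 * s <= 1 by rewrite mulrC -ler_pdivlMr // mul1r ltW.
  apply: le_trans; rewrite ler_wpM2l ?(ltW e4) // expr2 ler_piMr // ltW //.
by apply: (laplacian_arith e0 s2 A0 X0 es g1 key); [move: h2 | move: h3]; clear; lra.
Qed.
End Asymptotics.

(** * Comparison of the two metrics on a piece *)

Section Ahlfors.
Variable R : realType.
Local Notation C := R[i].
Variables (F dF : C -> C) (b : C) (rho M : R) (L : C -> Prop).
Hypotheses (eF : entire F) (edF : entire dF) (dFE : forall z, cdiff F z (dF z)).
Hypotheses (nzF : exists z, F z != 0) (cL : cpt L) (rho0 : 0 < rho) (M0 : 0 < M).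
Hypotheses (farL : forall z, L z -> M < md (z - b)) (Lrho : forall z, L z -> md (F z) <= rho).
Hypotheses (openL : forall z, L z -> md (F z) < rho -> nearby z L).
Hypothesis (ncrit : forall z, L z -> F z != 0 -> dF z != 0).

(** [V] is the density of the metric on [|z - b| > M] divided by the pull-back by [F] of the one on
    [0 < |w| < rho]. It is 0 where [|F| = rho] and at zeros of [F], so a positive maximum lies where
    both densities are smooth. *)
Let u z := ln rho - ln (md (F z)).
Let v z := ln (md (z - b)) - ln M.
Let V z := md (F z / ((z - b) * dF z)) * u z / v z.

Let v0 z : L z -> 0 < v z.
Proof. by move=> /farL h; rewrite subr_gt0 ltr_ln ?posrE //; exact: lt_trans h. Qed.

Let zb z : L z -> z - b != 0.
Proof. by move=> /farL h; rewrite -md_gt0; exact: lt_trans h. Qed.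

(** The sign [s] lets one statement serve [u], with [-1], and [v], with [1]. *)
Lemma harmonic_ln G p (s : R) (c : R) : hol G p -> G p != 0 -> s ^+ 2 = 1 -> s * ln (md (G p)) + c != 0 ->
  exists2 a, cdiff G p (a * G p) &
  lo 2 (fun h => rprod (fun h => ((s * ln (md (G (p + h))) + c) / (s * ln (md (G p)) + c))%:C%C) h - 1
     + ((md a / (s * ln (md (G p)) + c)) ^+ 2 * md h ^+ 2)%:C%C).
Proof.
move=> hG Gp s1 up; have [a [da l1 l2]] := ln_rot hG Gp; exists a => //.
have := @harmonic_rot R (fun z => s * ln (md (G z)) + c) p (s%:C%C * a) up.
have -> : md (s%:C%C * a) = md a.
  have : `|s| = 1 by apply/eqP; rewrite -(eqrXn2 (n:=2)) ?normr_ge0 // real_normK ?num_real // s1 expr1n.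
  by rewrite mdM mdr => ->; rewrite mul1r.
apply.
- have := loZ s%:C%C l1; apply: lo_ext => h; rewrite -rmorphM /=; congr (_%:C)%C.
  have -> : Re (s%:C%C * a * h) = s * Re (a * h) :> R by case: (a) (h) => ? ? [? ?] /=; ring.
  ring.
- have := loZ s%:C%C l2; apply: lo_ext => h; rewrite /rsum -!rmorphD -rmorphM /=; congr (_%:C)%C; ring.
Qed.

(** [local_max_laplacian] compares the negative Laplacians of [ln u] and [ln v], which are
    [(|F'| / (|F| u)) ^ 2] and [1 / (|z - b| v) ^ 2]. These are also the squared densities, as the
    curvature is constant, so the comparison is the claim itself. *)
Let Vmax p : L p -> F p != 0 -> md (F p) < rho -> (forall z, L z -> V z <= V p) -> V p <= 1.
Proof.
move=> Lp Fp Fr mx; have dFp := ncrit Lp Fp; have pb := zb Lp.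
have u0 : 0 < u p by rewrite subr_gt0 ltr_ln ?posrE ?md_gt0.
have Vp0 : 0 < V p by rewrite /V divr_gt0 ?mulr_gt0 ?v0 // md_gt0 mulf_neq0 ?invr_neq0 ?mulf_neq0.
have hF : hol F p by exact: entire_hol.
have hz : hol (fun z => z - b) p by apply: holB; [exact: hol_id | exact: hol_cst].
have hG : hol (fun z => F z / ((z - b) * dF z)) p.
  by apply: holM => //; apply: holV; [apply: holM => //; exact: entire_hol | exact: mulf_neq0].
have [a3 [_ g3]] := hol_rot hG ltac:(by rewrite mulf_neq0 ?invr_neq0 ?mulf_neq0).
have [||a1 d1 l1] := @harmonic_ln F p (- 1) (ln rho) hF Fp; [by rewrite sqrrN expr1n | by rewrite mulN1r addrC gt_eqF |].
have [||a2 d2 l2] := @harmonic_ln (fun z => z - b) p 1 (- ln M) hz pb; [by rewrite expr1n | by rewrite mul1r gt_eqF ?v0 |].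
rewrite mulN1r [- _ + _]addrC -/(u p) in l1; rewrite mul1r -/(v p) in l2.
have near : nearby 0 (fun h => L (p + h)).
  by have [r r0 hr] := openL Lp Fr; exists r => // h; rewrite subr0 => hh; apply: hr; rewrite addrC addKr.
have := local_max_laplacian g3 l1 l2.
have Fn : nearby 0 (fun h => F (p + h) != 0).
  have [r r0 hr] := ccontN0 (entire_cont p eF) Fp; exists r => // h; rewrite subr0 => hh.
  by have [] := hr (p + h); rewrite // addrC addKr.
case/(_ _ _)/wrap.
- apply: nearbyW (nearby_and near Fn) => h [Lh Fh].
  rewrite mulN1r [- _ + _]addrC -/(u (p + h)) mul1r -/(v (p + h)).
  have uh : 0 <= u (p + h) by rewrite subr_ge0 ler_ln ?posrE ?md_gt0 // Lrho.
  split; first by rewrite divr_ge0 // ltW.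
  have := mx _ Lh; rewrite /V ler_pdivrMr ?v0 // => h1.
  rewrite mdf; set g := md _ in h1 *; set g0 := md _ in h1 *.
  have g00 : 0 < g0 by rewrite md_gt0 mulf_neq0 ?invr_neq0 ?mulf_neq0.
  have k0 : 0 < g0 * u p by rewrite mulr_gt0.
  rewrite (_ : g / g0 * _ = g * u (p + h) / (g0 * u p)); last by field; rewrite !gt_eqF.
  rewrite (_ : v (p + h) / v p = g0 * u p / v p * v (p + h) / (g0 * u p)); last by field; rewrite !gt_eqF ?v0.
  by rewrite ler_wpM2r // invr_ge0 ltW.
- by rewrite sqr_ge0.
move=> le2.
have e1 : md a1 = md (dF p) / md (F p).
  by rewrite (cdiff_uniq (dFE p) d1) mdM mulfK // md_eq0.
have e2 : md a2 = (md (p - b))^-1.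
  have : 1 = a2 * (p - b).
    by apply: (cdiff_uniq _ d2); rewrite -[1]subr0; apply: cdiffB; [exact: cdiff_id | exact: cdiff_cst].
  move=> /(congr1 (fun z => md z)); rewrite md1 mdM => e.
  by apply: (mulIf (x := md (p - b))); rewrite ?md_eq0 // -e mulVf // md_eq0.
move: le2; rewrite ler_pXn2r ?nnegrE ?divr_ge0 ?md_ge0 ?(ltW u0) ?(ltW (v0 Lp)) // e1 e2.
rewrite ler_pdivrMr ?v0 // => le2.
rewrite /V ler_pdivrMr ?v0 // mul1r mdf mdM.
have F0 : 0 < md (F p) by rewrite md_gt0.
have D0 : 0 < md (dF p) by rewrite md_gt0.
have Z0 : 0 < md (p - b) by rewrite md_gt0.
rewrite (_ : _ * u p = (md (p - b))^-1 * (md (F p) * u p / md (dF p))); last by field; rewrite !gt_eqF.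
have k0 : 0 < md (F p) * u p / md (dF p) by rewrite !mulr_gt0 ?invr_gt0.
apply: le_trans (ler_wpM2r (ltW k0) le2) _; apply: le_of_eq.
by field; rewrite !gt_eqF.
Qed.

Lemma ccont_md (f : C -> C) z : ccont f z -> ccont (fun w => (md (f w))%:C%C) z.
Proof.
move=> cf e /cf; apply: nearbyW => w h; rewrite -rmorphB mdr; apply: le_lt_trans h.
by rewrite ler_norml mdBr andbT lerNl opprB mdC mdBr.
Qed.

Lemma ccont_ln (f : C -> C) z : ccont f z -> f z != 0 -> ccont (fun w => (ln (md (f w)))%:C%C) z.
Proof.
move=> cf fz e e0; have m0 : 0 < md (f z) by rewrite md_gt0.
have d0 : 0 < Num.min (1 / 4) (e / 4) * md (f z) by rewrite mulr_gt0 // lt_min; apply/andP; split; lra.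
apply: nearbyW (nearby_and (cf _ d0) (ccontN0 cf fz)) => w [h [fw _]].
have h1 : md (f w / f z - 1) < Num.min (1 / 4) (e / 4).
  by rewrite (_ : _ - 1 = (f w - f z) / f z) ?mdf ?ltr_pdivrMr //; field.
move: h1; rewrite lt_min => /andP[/ltW h1 h2].
have := (ln_md1D h1).2; rewrite addrCA subrr addr0 mdf ln_div ?posrE ?md_gt0 // -rmorphB mdr; lra.
Qed.

Lemma ccont_real_lt (f : C -> R) z (e : R) : ccont (fun w => (f w)%:C%C) z -> 0 < e -> nearby z (fun w => `|f w - f z| < e).
Proof. by move=> cf /cf; apply: nearbyW => w; rewrite -rmorphB mdr. Qed.

Let cont_v z : L z -> ccont (fun w => (v w)%:C%C) z.
Proof.
move=> Lz; have cz : ccont (fun w => w - b) z by apply: ccontB; [exact: ccont_id | exact: ccont_cst].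
have := ccontB (ccont_ln cz (zb Lz)) (ccont_cst (ln M)%:C%C z).
by apply: ccont_ext; apply: nearbyT => w; rewrite -rmorphB.
Qed.

Let cont_bound (f : C -> C) z : ccont f z -> nearby z (fun w => md (f w) <= md (f z) + 1).
Proof.
move=> cf; have h : md (f z) < md (f z) + 1 by lra.
by apply: nearbyW (ccont_nearby_lt cf h) => w /ltW.
Qed.

Let usc_regular z e : L z -> F z != 0 -> 0 < e -> nearby z (fun w => V w < V z + e).
Proof.
move=> Lz Fz e0; have cz : ccont (fun w => w - b) z by apply: ccontB; [exact: ccont_id | exact: ccont_cst].
have cF := entire_cont z eF; have cdF := entire_cont z edF; have dz := ncrit Lz Fz.
have vz : (v z)%:C%C != 0 :> C by rewrite -md_eq0 mdr normr_eq0 gt_eqF // v0.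
have c1 := ccont_md (ccontM cF (ccontV (ccontM cz cdF) (mulf_neq0 (zb Lz) dz))).
have c2 := ccontB (ccont_cst (ln rho)%:C%C z) (ccont_ln cF Fz).
have c3 := ccontM (ccontM c1 c2) (ccontV (cont_v Lz) vz).
have c4 : ccont (fun w => (V w)%:C%C) z.
  apply: ccont_ext c3; apply: nearbyT => w.
  by rewrite -rmorphB -rmorphM -fmorphV -rmorphM.
by apply: nearbyW (ccont_real_lt c4 e0) => w; rewrite ltr_norml => /andP[_]; lra.
Qed.

(** From [ln y < y] at [y = 1 / sqrt x]. *)
Let xlnx (x : R) : 0 < x -> x <= 1 -> - (x * ln x) <= 2 * Num.sqrt x.
Proof.
move=> x0 x1; have s0 : 0 < Num.sqrt x by rewrite sqrtr_gt0.
have xs : x = Num.sqrt x ^+ 2 by rewrite sqr_sqrtr // ltW.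
have := @ln_sublinear R (Num.sqrt x)^-1; rewrite invr_gt0 lnV ?posrE // => /(_ s0)/ltW h.
rewrite [in ln x]xs lnXn // (_ : - _ = 2 * (x * - ln (Num.sqrt x))); last by rewrite -mulr_natl; ring.
rewrite ler_wpM2l //.
apply: le_trans (ler_wpM2l (ltW x0) h) _.
by rewrite {1}xs expr2 mulfK // gt_eqF.
Qed.

(** At distance [x] from a zero of order [k + 1], [|F / F'|] is [O(x)] and [u] is [O(1 - ln x)], so
    [V] tends to 0; [Num.sqrt x] serves as a common majorant. *)
Let usc_zero z e : L z -> F z = 0 -> 0 < e -> nearby z (fun w => V w < e).
Proof.
move=> Lz Fz e0; have [k [g [Fg eg gz]]] := entire_order z eF nzF.
case: k Fg => [|k] Fg; first by move: gz; rewrite -[g z]mul1r -(expr0 (z - z)) -Fg Fz eqxx.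
have [dg edg dgE] := entire_deriv eg.
pose q w := k.+1%:R * g w + (w - z) * dg w.
have dFq w : dF w = (w - z) ^+ k * q w.
  apply: (cdiff_uniq (dFE w)).
  have := cdiffM (cdiffX k (cdiffB (cdiff_id w) (cdiff_cst z w))) (dgE w).
  rewrite (_ : _ + _ = (w - z) ^+ k * q w); last by rewrite /q exprS; ring.
  by apply: cdiff_ext; apply: nearbyT => x; rewrite Fg.
have qz : q z != 0 by rewrite /q subrr mul0r addr0 mulf_neq0 // pnatr_eq0.
have cg := entire_cont z eg.
have cq : ccont q z.
  apply: ccontD; first by apply: ccontM => //; exact: ccont_cst.
  by apply: ccontM; [apply: ccontB; [exact: ccont_id | exact: ccont_cst] | exact: entire_cont].
have c1 := cont_bound (ccontM cg (ccontV cq qz)).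
have c2 := cont_bound (ccont_ln cg gz).
have cz : ccont (fun w => w - b) z by apply: ccontB; [exact: ccont_id | exact: ccont_cst].
have vz : (v z)%:C%C != 0 :> C by rewrite -md_eq0 mdr normr_eq0 gt_eqF // v0.
have c3 := cont_bound (ccontV (ccontM cz (cont_v Lz)) (mulf_neq0 (zb Lz) vz)).
have vpos : nearby z (fun w => 0 < v w).
  by apply: nearbyW (ccont_real_lt (cont_v Lz) (v0 Lz)) => w; rewrite ltr_norml => /andP[h _]; lra.
set K1 := _ + 1 in c1; set K2 := _ + 1 in c2; set K3 := _ + 1 in c3.
have K10 : 0 < K1 by rewrite ltr_wpDl ?md_ge0.
have K20 : 0 < K2 by rewrite ltr_wpDl ?md_ge0.
have K30 : 0 < K3 by rewrite ltr_wpDl ?md_ge0.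
pose K := K3 * K1 * (`|ln rho| + K2 + 2 * k.+1%:R).
have K0 : 0 < K by rewrite !mulr_gt0 // addr_gt0 ?mulr_gt0 ?ltr0n // ltr_wpDl.
have r0 : 0 < Num.min 1 ((e / K) ^+ 2) by rewrite lt_min ltr01 exprn_gt0 // divr_gt0.
apply: nearbyW (nearby_and (nearby_and (nearby_and c1 c2) (nearby_and c3 vpos)) (nearby_and (@nearby_lt R z _ r0) (ccontN0 cg gz))).
move=> w [[[h1 h2] [h3 h4]] [h5 [gw _]]].
have [wz|wz] := eqVneq w z; first by rewrite /V wz Fz mul0r md0 !mul0r.
have x0 : 0 < md (w - z) by rewrite md_gt0 subr_eq0.
move: h5; rewrite lt_min; set x := md (w - z) in x0 * => /andP[x1 x2].
have s2 : Num.sqrt x < e / K.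
  by rewrite -(ltr_pXn2r (n:=2)) ?nnegrE ?sqrtr_ge0 ?divr_ge0 ?(ltW e0) ?(ltW K0) // sqr_sqrtr // ltW.
have sx : x <= Num.sqrt x.
  have xs : x = Num.sqrt x ^+ 2 by rewrite sqr_sqrtr // ltW.
  have s1 : Num.sqrt x <= 1 by rewrite -sqrtr1 ler_wsqrtr // ltW.
  by rewrite {1}xs expr2 ler_piMr ?sqrtr_ge0.
have wzk : (w - z) ^+ k != 0 by rewrite expf_neq0 // subr_eq0.
have E1 : md (F w / ((w - b) * dF w)) = x * md (g w / q w) / md (w - b).
  have : x ^+ k != 0 by rewrite expf_neq0 // gt_eqF.
  rewrite Fg dFq exprS !mdf !mdM !invfM !mdX -/x.
  move: (x ^+ k) (md (q w))^-1 (md (w - b))^-1 => y i j y0; by field.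
have E2 : u w <= `|ln rho| + K2 - k.+1%:R * ln x.
  have xk : x ^+ k.+1 \in Num.pos by rewrite posrE exprn_gt0.
  have gp : md (g w) \in Num.pos by rewrite posrE md_gt0.
  rewrite /u Fg mdM mdX -/x lnM // lnXn // -mulr_natl.
  move: h2; rewrite mdr ler_norml => /andP[h2 _]; have := ler_norm (ln rho); lra.
have lnx : ln x <= 0 by rewrite ln_le0 // ltW.
have U0 : 0 <= `|ln rho| + K2 - k.+1%:R * ln x.
  have : 0 <= - (k.+1%:R * ln x) by rewrite -mulrN mulr_ge0 // oppr_ge0.
  have := normr_ge0 (ln rho); lra.
have P3 : (md (w - b) * v w)^-1 <= K3.
  by move: h3; rewrite mdV mdM mdr ger0_norm // ltW.
have P0 : 0 <= (md (w - b) * v w)^-1 by rewrite invr_ge0 mulr_ge0 ?md_ge0 // ltW.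
have -> : V w = (md (w - b) * v w)^-1 * (md (g w / q w) * (x * u w)).
  by rewrite /V E1 invfM; ring.
apply: le_lt_trans (_ : K * Num.sqrt x < e); last by rewrite mulrC -ltr_pdivlMr.
apply: (@le_trans _ _ ((md (w - b) * v w)^-1 * (md (g w / q w) * (x * (`|ln rho| + K2 - k.+1%:R * ln x))))).
  by rewrite !ler_wpM2l ?md_ge0 // ltW.
rewrite /K -!mulrA; apply: ler_pM => //; first by rewrite !mulr_ge0 ?md_ge0 // ltW.
apply: ler_pM => //; rewrite ?md_ge0 // ?mulr_ge0 // ?(ltW x0) //.
have := xlnx x0 (ltW x1) => /(ler_wpM2l (ler0n R k.+1)) h.
have h6 : (`|ln rho| + K2) * x <= (`|ln rho| + K2) * Num.sqrt x by rewrite ler_wpM2l // addr_ge0 // ltW.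
lra.
Qed.

Theorem ahlfors_inequality z : L z -> F z != 0 ->
  md (F z) * (ln rho - ln (md (F z))) <= md (z - b) * md (dF z) * (ln (md (z - b)) - ln M).
Proof.
move=> Lz Fz; suff : V z <= 1.
  have dz := ncrit Lz Fz.
  have D0 : 0 < md (z - b) * md (dF z) by rewrite mulr_gt0 // md_gt0 // zb.
  rewrite /V ler_pdivrMr ?v0 // mul1r mdf mdM mulrAC ler_pdivrMr // => h.
  by rewrite [leRHS]mulrC.
have V0 w : F w = 0 -> V w = 0 by move=> Fw; rewrite /V Fw mul0r md0 !mul0r.
have [||p Lp pmax] := @cpt_max R L V cL; [by exists z | |].
  move=> w e Lw e0; have [Fw|Fw] := eqVneq (F w) 0.
    by apply: nearbyW (usc_zero Lw Fw e0) => x hx _; rewrite (V0 w) // add0r.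
  by apply: nearbyW (usc_regular Lw Fw e0).
apply: le_trans (pmax _ Lz) _.
have [Fp|Fp] := eqVneq (F p) 0; first by rewrite V0.
have := Lrho Lp; rewrite le_eqVlt => /orP[/eqP e|h]; last exact: Vmax.
by rewrite /V /u e subrr mulr0 mul0r.
Qed.
End Ahlfors.

(** * The theorem *)
Section Bridge.
Variable R : realType.
Local Notation C := (R[i]^o).

Lemma disk_md (z : C) (r : C) w : 0 < r -> disk z r w <-> md (w - z) < Re r.
Proof. by move=> r0; rewrite /disk /= ltc_md. Qed.

Lemma bounded_md (A : set C) : bounded_set A <-> exists M : R, forall z, A z -> md z <= M.
Proof.
split=> [[M0 [M0r hM]]|[M hM]].
  have Mr : M0 < (Re M0 + 1)%:C%C.
    have i0 : Im M0 = 0 by move: M0r; rewrite realE !lecE /= => /orP[] /andP[/eqP].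
    by rewrite ltcE /= i0 eqxx ltrDl ltr01.
  by exists (Re M0 + 1) => z /(hM _ Mr) /=; rewrite mdE lecR.
exists M%:C%C; split; first by rewrite complex_real.
by move=> x Mx z /hM zM /=; rewrite mdE; apply: ltW; apply: le_lt_trans Mx; rewrite lecR.
Qed.
End Bridge.

(** * Sublevel sets of a transcendental function and fixed points in their pieces *)

Section LevelSets.
Variable R : realType.
Local Notation C := R[i].

Lemma md_prod (t : seq C) z : 1 <= md z -> md (\prod_(a <- t) (z - a)) <= (\prod_(a <- t) (1 + md a)) * md z ^+ size t.
Proof.
move=> z1; elim: t => [|a t ih]; first by rewrite !big_nil md1 mul1r expr0.
rewrite !big_cons mdM /= exprS mulrACA ler_pM ?md_ge0 //.
have h : md a <= md a * md z by rewrite ler_peMr ?md_ge0.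
apply: le_trans (mdB _ _) _; lra.
Qed.

(** If [|F| <= rho] everywhere, [F] is constant. If [{|F| <= rho}] is bounded, dividing out the
    finitely many zeros leaves a zero-free [u], and [1 / u], being at most the product of the
    factors over [rho] outside, is a polynomial; then [F] is rational. *)
Lemma level_unbounded (F : C -> C) (rho : R) : entire F -> (exists z, F z != 0) -> 0 < rho ->
  (forall p q : {poly C}, q != 0 -> (forall z, p.[z] != 0) -> ~ forall z, F z * p.[z] = q.[z]) ->
  (exists w, rho < md (F w)) /\ ~ bdd (fun z => md (F z) <= rho).
Proof.
move=> eF [z0 nz0] rho0 tr; split.
  apply: contrapT => h.
  have [p Fp] : exists p : {poly C}, forall z, F z = p.[z].
    apply: (@poly_growth R F 0 rho eF) => z _; rewrite expr0 mulr1 leNgt; apply/negP => hz; apply: h; by exists z.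
  apply: (tr 1 p) => [|z|z]; rewrite ?hornerC ?oner_neq0 ?mulr1 //.
  by apply/eqP => p0; rewrite Fp p0 horner0 eqxx in nz0.
have nzF : exists z, F z != 0 by exists z0.
move=> bK; have [t [u [eu Fu uK _]]] := entire_factor eF nzF bK.
have u0 z : u z != 0.
  have [Kz|] := leP (md (F z)) rho; first exact: uK.
  by apply: contraTneq => uz; rewrite Fu uz mulr0 md0 -leNgt ltW.
have eV : entire (fun z => (u z)^-1) by move=> z; apply: diffatV.
have [M hM] := bK.
have [||m _ hm] := @cpt_max R (fun z => md z <= `|M|) (fun z => md (u z)^-1) (@cpt_ball R `|M|).
- by exists 0; rewrite md0.
- move=> z e _ e0; have h : md (u z)^-1 < md (u z)^-1 + e by lra.
  by apply: nearbyW (ccont_nearby_lt (entire_cont z eV) h) => w hw _.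
pose P := \prod_(a <- t) (1 + md a); pose B := md (u m)^-1.
have P0 : 0 <= P by apply: prodr_ge0 => a _; rewrite addr_ge0 ?md_ge0.
have [p Vp] : exists p : {poly C}, forall z, (u z)^-1 = p.[z].
  apply: (@poly_growth R _ (size t) (B + P / rho) eV) => z z1.
  have zn : 1 <= md z ^+ size t by rewrite exprn_ege1.
  have PR : 0 <= P / rho by rewrite divr_ge0 // ltW.
  have B0 : 0 <= B := md_ge0 _.
  rewrite mulrDl; have [Kz|Wz] := leP (md (F z)) rho.
    have : md (u z)^-1 <= B by apply: hm; apply: le_trans (hM _ Kz) (ler_norm _).
    move=> h; apply: le_trans h _; apply: ler_wpDr; first by rewrite mulr_ge0 // (le_trans ler01).
    by rewrite ler_peMr.
  apply: ler_wpDl; first by rewrite mulr_ge0 // (le_trans ler01).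
  rewrite mulrAC ler_pdivlMr //; apply: le_trans (md_prod t z1).
  have -> : \prod_(a <- t) (z - a) = (u z)^-1 * F z by rewrite Fu mulrCA mulVf ?mulr1.
  by rewrite mdM ler_wpM2l ?md_ge0 // ltW.
apply: (tr p (\prod_(a <- t) ('X - a%:P))).
- by rewrite monic_neq0 // monic_prod_XsubC.
- by move=> z; rewrite -Vp invr_neq0.
- by move=> z; rewrite -Vp Fu mulfK // horner_prod; apply: eq_bigr => a _; rewrite hornerXsubC.
Qed.

Lemma fixed_point_in_piece (F dF : C -> C) (b : C) (rho : R) (L : C -> Prop) :
  entire F -> entire dF -> (forall z, cdiff F z (dF z)) -> (exists z, F z != 0) -> 0 < rho ->
  cpt L -> (forall z, L z -> nearby z (fun w => md (F w) <= rho -> L w)) ->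
  (forall z, L z -> md b + 1 + 2 / rho < md z) -> (exists2 z, L z & F z = 0) ->
  exists z, [/\ L z, (z - b) * F z = 1 & - (z - b) ^+ 2 * dF z = 1 \/ 1 < md ((z - b) ^+ 2 * dF z)].
Proof.
move=> eF edF dFE nzF rho0 cL Liso far zero.
have [|z Lz|e e0 he] := @cpt_unif R L (fun z e => forall w, md (w - z) < e -> md (F w) <= rho -> L w) cL.
- by move=> z e e' h ee w wz; apply: h; exact: lt_le_trans ee.
- have [r r0 hr] := Liso _ Lz; exists (r / 2); first lra.
  exists (r / 2); first lra; move=> w wz _ v vw; apply: hr; apply: le_lt_trans (mdTr _ _ w) _; lra.
(* Within [e] of [L] only points of [L] satisfy [|F| <= rho]; within 1 of [L], [rho * |z - b|] is at
   least 2, the value taken for [q]. *)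
have eta0 : 0 < Num.min 1 e by rewrite lt_min ltr01.
have [N [Gam [B ct]]] := contour_exists cL eta0.
have NL z : N z -> exists2 w, L w & md (z - w) < 1 /\ md (z - w) < e.
  by move=> /(ctN ct)[w Lw]; rewrite lt_min => /andP[h1 h2]; exists w.
have bN : bdd N.
  by case: cL => -[M hM] _; exists (M + 1) => z /NL[w /hM wM [h _]]; have := mdD (z - w) w; rewrite subrK; lra.
apply: (weakly_repelling_solution ct bN (rho := rho) (q := 2)) => //.
- by rewrite ltr1n.
- move=> z /NL[w Lw [_ h]]; have [Kz|] := leP (md (F z)) rho; last by right.
  by left; exact: he Lw _ h Kz.
- move=> z /NL[w /far wM [h _]]; rewrite mulrC -ler_pdivrMr //.
  have := mdBr z b; have := mdBr w (w - z); rewrite opprB addrCA subrr addr0 mdC; lra.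
Qed.

Lemma piece_zero (F : C -> C) (rho : R) (L : C -> Prop) : entire F -> cpt L -> (exists z, L z) ->
  (forall z, L z -> md (F z) <= rho) -> (forall z, L z -> nearby z (fun w => md (F w) <= rho -> L w)) ->
  exists2 z, L z & F z = 0.
Proof.
move=> eF cL neL Lrho Liso; apply: contrapT => h.
have F0 z : L z -> F z != 0 by move=> Lz; apply/eqP => Fz; apply: h; exists z.
apply: (@max_principle R (fun z => (F z)^-1) L) => // p Lp.
  by apply: holV; [exact: entire_hol | exact: F0].
apply: nearbyW (nearby_and (Liso _ Lp) (ccontN0 (entire_cont p eF) (F0 _ Lp))) => w [hw [Fw _]].
have Fp := F0 _ Lp; rewrite !mdV lef_pV2 ?posrE ?md_gt0 // => h1; apply: hw; exact: le_trans h1 (Lrho _ Lp).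
Qed.
End LevelSets.

Section FarPieces.
Variable R : realType.
Local Notation C := R[i].
Variables (F dF : C -> C) (b : C) (rho : R).
Hypotheses (eF : entire F) (edF : entire dF) (dFE : forall z, cdiff F z (dF z)).
Hypotheses (nzF : exists z, F z != 0) (rho0 : 0 < rho).
Let K z := md (F z) <= rho.
Hypothesis exhaust : forall M : R, exists L, [/\ clopen_in K L, bdd L & forall z, md z <= M -> K z -> L z].
Hypothesis unbK : ~ bdd K.

(** Difference of two pieces of the exhaustion: [L1] swallows [K] up to norm [M], and [L2] reaches a
    point of [K] beyond [L1]. *)
Lemma far_piece (M : R) : exists L, [/\ clopen_in K L, cpt L, exists2 z, L z & F z = 0 & forall z, L z -> M < md z].
Proof.
have cK : clo K by apply: clo_sublevel => z; exact: entire_cont.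
have [L1 [c1 [M1 h1] s1]] := exhaust M.
have [z1 Kz1 z1M] : exists2 z, K z & M1 < md z.
  by apply: contrapT => h; apply: unbK; exists M1 => z Kz; rewrite leNgt; apply/negP => hz; apply: h; exists z.
have [L2 [c2 b2 s2]] := exhaust (md z1).
have cl := clopen_inD c2 c1.
have cptL : cpt (fun z => L2 z /\ ~ L1 z).
  by split; [case: b2 => B hB; exists B => z [/hB] | exact: clopen_in_clo cl].
exists (fun z => L2 z /\ ~ L1 z); split => //.
- apply: (piece_zero (rho := rho)) => //.
  + by exists z1; split; [exact: s2 | move=> /h1; rewrite leNgt z1M].
  + by move=> z /(proj1 cl).
  + by move=> z Lz; apply: nearbyW ((proj2 cl) _ ((proj1 cl) _ Lz)) => w hw Kw; apply/hw.
- move=> z [Lz nL]; rewrite ltNge; apply/negP => zM; apply: nL; apply: s1 => //; exact: (proj1 c2).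
Qed.

Lemma far_weakly_repelling (M : R) : exists z, [/\ M < md z, (z - b) * F z = 1 &
  - (z - b) ^+ 2 * dF z = 1 \/ 1 < md ((z - b) ^+ 2 * dF z)].
Proof.
have [L [cl cL zL far]] := far_piece (Num.max M (md b + 1 + 2 / rho)).
have [|z Lz|z [Lz h1 h2]] := @fixed_point_in_piece R F dF b rho L eF edF dFE nzF rho0 cL _ _ zL.
- by move=> z Lz; apply: nearbyW ((proj2 cl) _ ((proj1 cl) _ Lz)) => w hw Kw; apply/hw.
- by have := far _ Lz; rewrite gt_max => /andP[].
- by exists z; split=> //; have := far _ Lz; rewrite gt_max => /andP[].
Qed.

(** At the lower level [rho2 < e] only zeros of [F] can be critical; pieces for [rho] still serve,
    cut down to [{|F| <= rho2}]. The inner radius in [ahlfors_inequality] is [2 / rho2], whose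
    product with [rho2] exceeds 1. *)
Lemma far_repelling (e M : R) : 0 < e -> (forall z, F z != 0 -> md (F z) < e -> dF z != 0) ->
  exists z, [/\ M < md z, (z - b) * F z = 1 & 1 < md ((z - b) ^+ 2 * dF z)].
Proof.
move=> e0 ncrit; pose rho2 := Num.min rho (e / 2).
have r20 : 0 < rho2 by rewrite lt_min rho0 divr_gt0.
have r2r : rho2 <= rho by rewrite ge_min lexx.
have r2e : rho2 < e by rewrite gt_min; apply/orP; right; lra.
clearbody rho2.
have [L [cl cL [z0 Lz0 Fz0] far]] := far_piece (Num.max M (md b + 1 + 2 / rho2)).
pose L2 z := L z /\ md (F z) <= rho2.
have cL2 : cpt L2 by apply: cptI => //; apply: clo_sublevel => z; exact: entire_cont.
have iso z : L z -> nearby z (fun w => md (F w) <= rho -> L w).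
  by move=> Lz; apply: nearbyW ((proj2 cl) _ ((proj1 cl) _ Lz)) => w hw Kw; apply/hw.
have farb z : L z -> 2 / rho2 < md (z - b).
  move=> /far; rewrite gt_max => /andP[_ h]; have := mdBr z b; lra.
have [|z [Lz _]||z [[Lz Fz] h1 _]] := @fixed_point_in_piece R F dF b rho2 L2 eF edF dFE nzF r20 cL2.
- move=> z [Lz Fz]; apply: nearbyW (iso _ Lz) => w hw Fw; split=> //; apply: hw; exact: le_trans r2r.
- by have := far _ Lz; rewrite gt_max => /andP[].
- by exists z0; rewrite /L2 ?Fz0 ?md0 //; split=> //; exact: ltW.
exists z; split=> //; first by have := far _ Lz; rewrite gt_max => /andP[].
have F0 : F z != 0 by apply/eqP => F0; move: h1; rewrite F0 mulr0 => /eqP; rewrite eq_sym oner_eq0.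
have m0 : 0 < 2 / rho2 by rewrite divr_gt0.
have := @ahlfors_inequality R F dF b rho2 (2 / rho2) L2 eF edF dFE nzF cL2 r20 m0 _ _ _ _ z (conj Lz Fz) F0.
have s0 : 0 < md (z - b) by apply: lt_trans (farb _ Lz).
have mF : md (F z) = (md (z - b))^-1.
  by apply: (mulfI (x := md (z - b))); rewrite ?gt_eqF // divff ?gt_eqF // -mdM h1 md1.
case/(_ _ _ _ _)/wrap.
- by move=> w [/farb].
- by move=> w [].
- move=> w [Lw Fw] lt; apply: nearbyW (nearby_and (iso _ Lw) (ccont_nearby_lt (entire_cont w eF) lt)) => v [hv /ltW Fv].
  by split=> //; apply: hv; exact: le_trans r2r.
- by move=> w [Lw Fw] nz; apply: ncrit => //; exact: le_lt_trans r2e.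
(* Multiplied by [|z - b|], the inequality reads [ln rho2 + ln |z - b| <= |lambda| * (ln |z - b| -
   ln (2 / rho2))]; with [|lambda| <= 1] it would give [ln 2 <= 0]. *)
rewrite mF lnV ?posrE // opprK => ineq.
rewrite mdM mdX ltNge; apply/negP => le1.
have l1 : 0 < ln (md (z - b)) - ln (2 / rho2) by rewrite subr_gt0 ltr_ln ?posrE ?farb.
have l2 : ln (2 / rho2) + ln rho2 > 0.
  by rewrite -lnM ?posrE // divfK ?gt_eqF // ln_gt0 // ltr1n.
have : ln rho2 + ln (md (z - b)) <= md (z - b) ^+ 2 * md (dF z) * (ln (md (z - b)) - ln (2 / rho2)).
  by rewrite ler_pdivrMl // in ineq; apply: le_trans ineq _; apply: le_of_eq; ring.
have := ler_wpM2r (ltW l1) le1; lra.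
Qed.
End FarPieces.

Lemma conn_connected (R : realType) (A : set (R[i]^o)) : conn A -> connected A.
Proof.
move=> cA B B0 [U oU BU] [D cD BD]; apply/seteqP; split=> [z|]; first by rewrite BU => -[].
have BA z : B z -> A z by rewrite BU => -[].
apply: cA => //; split=> // z Az; have [Bz|nBz] := pselect (B z).
  have Uz : U z by move: Bz; rewrite BU => -[].
  by have /nbhs_nearby := open_nbhs_nbhs (conj oU Uz); apply: nearbyW => w Uw Aw; split=> // _; rewrite BU.
have nD : (~` D) z by move=> Dz; apply: nBz; rewrite BD.
have oD : open (~` D) by rewrite openC.
by have /nbhs_nearby := open_nbhs_nbhs (conj oD nD); apply: nearbyW => w nDw Aw; split=> //; rewrite BD => -[_ /nDw].
Qed.

Lemma conn_component (R : realType) (S A : set (R[i]^o)) x z : A `<=` S -> A x -> conn A -> A z ->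
  connected_component S x z.
Proof. by move=> AS Ax /conn_connected cA; exact: (@connected_component_max _ S A x Ax AS cA z). Qed.

Section Main.
Variable R : realType.
Local Notation C := (R[i]^o).
Variables (f : C -> option C) (b : C).
Hypotheses (mf : meromorphic f) (om : omitted_value f b).

(* The omitted value makes [1 / (f - b)] entire. *)
Definition recip (z : C) : C := if f z is Some w then (w - b)^-1 else 0.

Lemma recip_some z w : f z = Some w -> recip z = (w - b)^-1 /\ w - b != 0.
Proof.
by move=> e; rewrite /recip e subr_eq0; split=> //; apply/eqP => wb; apply: (om (z := z)); rewrite e wb.
Qed.

Lemma recip_neq0 z : recip z != 0 -> f z = Some (b + (recip z)^-1).
Proof.
case e: (f z) => [w|]; last by rewrite /recip e eqxx.
by move=> _; have [-> _] := recip_some e; rewrite invrK addrC subrK.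
Qed.

Lemma disk_nearby (z : C) (r : C) (P : C -> Prop) : 0 < r -> (forall w, disk z r w -> P w) -> nearby z P.
Proof. by move=> r0 h; exists (Re r); [case: (posc r0) | move=> w wz; apply/h/disk_md]. Qed.

Lemma holo_cdiff (U : set C) (g : C -> C) z : holo_on U g -> U z -> exists d, cdiff g z d.
Proof. by move=> hg Uz; apply/derivable_cdiff; exact: hg. Qed.

Lemma disk_center (z r : C) : 0 < r -> disk z r z.
Proof. by move=> r0; rewrite /disk /= subrr normr0. Qed.

(** At a pole [f = 1 / h], and [1 / (f - b) = h / (1 - b * h)] extends by 0; elsewhere [f - b] does
    not vanish. *)
Lemma recip_entire : entire recip.
Proof.
move=> z; case: (mf z) => [[r [g [r0 [hg fg]]]]|[fz [r [h [r0 [hh [hz fh]]]]]]].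
  have zz := disk_center z r0; have [d dg] := holo_cdiff hg zz.
  have [_ gb] := recip_some (fg _ zz).
  eexists; apply: cdiff_ext (cdiffV (cdiffB dg (cdiff_cst b z)) gb).
  by apply: disk_nearby r0 _ => w /fg /recip_some[->].
have zz := disk_center z r0; have [d dh] := holo_cdiff hh zz.
have nz : 1 - b * h z != 0 by rewrite hz mulr0 subr0 oner_neq0.
have dn := cdiffM dh (cdiffV (cdiffB (cdiff_cst 1 z) (cdiffM (cdiff_cst b z) dh)) nz).
eexists; apply: cdiff_ext dn; apply: disk_nearby r0 _ => w zw.
have [->|wz] := eqVneq w z; first by rewrite hz mul0r /recip fz.
have [hw fw] := fh _ zw wz; have [-> _] := recip_some fw.
by rewrite (_ : (h w)^-1 - b = (1 - b * h w) / h w) ?invf_div //; field.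
Qed.

Lemma recip_nonzero : exists z, recip z != 0.
Proof.
case: (mf 0) => [[r [g [r0 [_ fg]]]]|[_ [r [h [r0 [_ [_ fh]]]]]]].
  by have [e n] := recip_some (fg _ (disk_center 0 r0)); exists 0; rewrite e invr_neq0.
have [r1 rE] := posc r0.
have [_ fz] := fh (Re r / 2)%:C%C ltac:(by apply/disk_md; rewrite // subr0 mdr ger0_norm; lra)
   ltac:(by rewrite -md_eq0 mdr gt_eqF // normr_gt0 gt_eqF //; lra).
by have [e n] := recip_some fz; exists (Re r / 2)%:C%C; rewrite e invr_neq0.
Qed.

(** Such an identity would make [f = b + p / q] rational. *)
Lemma recip_transcendental (p q : {poly R[i]}) : transcendental f -> q != 0 -> (forall z, p.[z] != 0) -> ~ forall z, recip z * p.[z] = q.[z].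
Proof.
move=> tf q0 p0 h; apply: tf; exists (b *: q + p), q; split=> // z qz.
have Fz : recip z != 0 by apply: contraNneq qz => Fz; rewrite -h Fz mul0r.
rewrite recip_neq0 // hornerD hornerZ mulrDl mulfK //; congr (Some (_ + _)).
by rewrite -h; field; rewrite Fz p0.
Qed.

Lemma recip_deriv dF z : (forall z, cdiff recip z (dF z)) -> recip z != 0 ->
  deriv_at f z (- dF z / recip z ^+ 2).
Proof.
move=> dFE Fz; have fz := recip_neq0 Fz.
case: (mf z) => [[r [g [r0 [hg fg]]]]|[fz' _]]; last by rewrite fz' in fz.
exists r, g; do 3!split=> //; apply: derive1_cdiff.
rewrite -[- _ / _]add0r; apply: cdiff_ext (cdiffD (cdiff_cst b z) (cdiffV (dFE z) Fz)).
apply: disk_nearby r0 _ => w /fg /recip_some[-> _]; by rewrite invrK addrC subrK.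
Qed.

Lemma fixed_deriv dF z : (forall z, cdiff recip z (dF z)) -> (z - b) * recip z = 1 ->
  f z = Some z /\ deriv_at f z (- ((z - b) ^+ 2 * dF z)).
Proof.
move=> dFE T1; have Fz : recip z != 0.
  by apply: contra_eq_neq T1 => ->; rewrite mulr0 eq_sym oner_eq0.
have Fi : (recip z)^-1 = z - b.
  by apply: (mulIf Fz); rewrite mulVf.
split; first by rewrite recip_neq0 // Fi addrC subrK.
have := recip_deriv dFE Fz; rewrite mulrC -exprVn Fi mulrN; exact.
Qed.

Lemma norm_gt1 (z : C) : (1 < `|z|) = (1 < md z).
Proof. by rewrite mdE ltcE /= eqxx. Qed.

(** [|f - b| < r] means [|F| > 1 / r], so the preimage of the disk is the complement of the sublevel
    set; poles, where [F = 0], belong to the latter. *)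
Lemma bd_boundary (r : C) z : 0 < r -> bd (fun z => md (recip z) <= (Re r)^-1) z -> boundary (Defs.preim f (disk b r)) z.
Proof.
move=> r0 [Kz nK]; have [r1 _] := posc r0.
have E w : Defs.preim f (disk b r) w <-> ~ md (recip w) <= (Re r)^-1.
  split=> [[v [fw /disk_md h]]|/negP].
    have [-> vb] := recip_some fw; apply/negP; rewrite -ltNge mdV ltf_pV2 ?posrE ?md_gt0 //; exact: h.
  rewrite -ltNge => h; have Fw : recip w != 0.
    by rewrite -md_gt0; apply: lt_trans h; rewrite invr_gt0.
  exists (b + (recip w)^-1); rewrite -recip_neq0 //; split=> //; apply/disk_md => //.
  by rewrite addrC addKr mdV invf_plt ?posrE // md_gt0.
split=> [B /nbhs_nearby nB|/nbhs_singleton]; last by move/E.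
apply: contrapT => h; apply: nK; apply: nearbyW nB => w Bw; apply: contrapT => nw.
by apply: h; exists w; split=> //; apply/E.
Qed.

Lemma unbounded_infinite (A : set C) : (forall M : R, exists z, A z /\ M < md z) -> infinite_set A.
Proof.
move=> h /finite_seqP[s As]; have [z [Az]] := h (\sum_(x <- s) md x).
apply/negP; rewrite -leNgt; move: Az; rewrite As /= => zs.
by rewrite (big_rem z) //= ler_wpDr // sumr_ge0 // => i _; exact: md_ge0.
Qed.
End Main.

Theorem theorem1p3 (R : realType) (f : R[i]^o -> option R[i]^o) (b : R[i]^o) :
  general_transcendental_meromorphic f ->
  baker_omitted_value f b -> stable_at f b ->
  infinite_set (weakly_repelling_fp f) /\
  (only_limit_point_of_crit_values f b -> infinite_set (repelling_fp f)).
Proof.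
move=> [mf [tf _]] [om [r [r0 bdb]]] _.
have eF := recip_entire mf om; have nzF := recip_nonzero mf om.
have [dF edF dFE] := entire_deriv eF.
have rho0 : 0 < (Re r)^-1 by rewrite invr_gt0; case: (posc r0).
have [[w0 Ww0] unbK] := level_unbounded eF nzF rho0 (fun p q => recip_transcendental om tf).
have exh M := @bounded_pieces R (recip f b) (Re r)^-1 eF _ w0 M Ww0.
have {}exh M : exists L, [/\ clopen_in (fun z => md (recip f b z) <= (Re r)^-1) L, bdd L & forall z, md z <= M -> md (recip f b z) <= (Re r)^-1 -> L z].
  apply: exh => x /(bd_boundary om r0) bx; have /bounded_md[N hN] := bdb _ bx.
  exists N => A Abd Ax cA z Az; apply: hN.
  by apply: (conn_component _ Ax cA Az) => w /Abd; exact: bd_boundary.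
split.
  apply: unbounded_infinite => M.
  have [z [zM T1 h]] := far_weakly_repelling b eF edF dFE nzF rho0 exh unbK M.
  exists z; split=> //; have [fz dz] := fixed_deriv mf om dFE T1.
  split=> //; eexists; split; first exact: dz.
  by case: h => h; [right; rewrite -mulNr | left; rewrite norm_gt1 mdN].
move=> [_ [_ /bounded_md[N hN]]]; apply: unbounded_infinite => M.
(* A critical value has the form [b + 1 / F]; if it is at most [N] in modulus, then
   [|1 / F| <= N + |b|], so [|F| < 1 / N'] excludes critical points other than zeros of [F]. *)
pose N' := `|N| + md b + 1; have N0 : 0 < N' by rewrite ltr_wpDl // addr_ge0 ?md_ge0.
have Ni0 : 0 < N'^-1 by rewrite invr_gt0.
have ncrit z : recip f b z != 0 -> md (recip f b z) < N'^-1 -> dF z != 0.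
  move=> Fz Fl; apply/eqP => dz; have := recip_deriv mf om dFE Fz; rewrite dz oppr0 mul0r => d0.
  have := hN (b + (recip f b z)^-1) (ex_intro _ z (conj (recip_neq0 om Fz) d0)).
  rewrite -[md _]invrK -mdV ltf_pV2 ?posrE ?invr_gt0 ?md_gt0 ?invr_neq0 // in Fl.
  have := mdDr (recip f b z)^-1 b; rewrite [_^-1 + b]addrC; have := ler_norm N; rewrite /N' in Fl; lra.
have [z [zM T1 h]] := far_repelling b eF edF dFE nzF rho0 exh unbK M Ni0 ncrit.
exists z; split=> //; have [fz dz] := fixed_deriv mf om dFE T1.
split=> //; eexists; split; first exact: dz.
by rewrite norm_gt1 mdN.
Qed.
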